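(* Let $f$, $\varphi$, $\Phi$ satisfy the hypotheses listed in the context (including $F(1)>0$), and let $c$ be the front speed defined in the context. Assume that $\{u_\varepsilon\}_{\varepsilon>0}$ is a family of admissible weak solutions (see context) of the Cauchy problem $$\partial_t u_\varepsilon=\operatorname{div}\bigl(\partial\Phi(\varepsilon\nabla_x u_\varepsilon)\bigr)+\tfrac1\varepsilon f(u_\varepsilon),\quad x\in\mathbb{R}^N,\ t>0,\qquad u_\varepsilon(\cdot,0)=u_{\varepsilon,0}\ \text{ in }\mathbb{R}^N,$$ with initial data $u_{\varepsilon,0}:\mathbb{R}^N\to\mathbb{R}$ such that, for a constant $\beta\in(0,1)$ independent of $\varepsilon$ and for constants $K_\varepsilon$ (which may depend on $\varepsilon$), $$-1\le u_{\varepsilon,0}(x)\le 1,\qquad |\nabla_x u_{\varepsilon,0}(x)|\le K_\varepsilon,\qquad |\nabla_x u_{\varepsilon,0}(x)-\nabla_x u_{\varepsilon,0}(y)|\le K_\varepsilon|x-y|^\beta\qquad\text{for all }x,y\in\mathbb{R}^N .$$ Let $G_-$ (resp. $G_+$) be the set of all $x\in\mathbb{R}^N$ having a neighborhood $U(x)\subset\mathbb{R}^N$ such that $$\limsup_{\varepsilon\to0+}\Bigl(\sup_{y\in U(x)}u_{\varepsilon,0}(y)\Bigr)<\mu\qquad\Bigl(\text{resp. }\ \liminf_{\varepsilon\to0+}\Bigl(\inf_{y\in U(x)}u_{\varepsilon,0}(y)\Bigr)>\mu\Bigr).$$ Assume $\overline{G}_-\cup\overline{G}_+=\mathbb{R}^N$,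 and set $\Gamma=\overline{G}_-\cap\overline{G}_+$. Let $\mathrm{dist}[x,\Gamma]$ be the signed distance defined in the context. Then, as $\varepsilon\searrow0$, $$u_\varepsilon\to-1\quad\text{uniformly in compact subsets of }\{(x,t):t>0,\ \mathrm{dist}[x,\Gamma]>ct\},$$ $$u_\varepsilon\to1\quad\text{uniformly in compact subsets of }\{(x,t):t>0,\ \mathrm{dist}[x,\Gamma]<ct\},$$ where $c>0$ is the uniquely determined front speed.
   Context: Hypotheses on $f$: $f:\mathbb{R}\to\mathbb{R}$ is Lipschitz continuous and there is $\mu\in(-1,1)$ with $f(-1)=f(\mu)=f(1)=0$, $f<0$ on $(-1,\mu)$, $f>0$ on $(\mu,1)$. With $F(r)=\int_{-1}^r f(s)\,ds$ for $-1\le r\le1$, one assumes $F(1)-F(r)=\int_r^1 f(s)\,ds>0$ for all $-1<r<1$, and $F(1)>0$. Hypotheses on $\Phi$: $\Phi:\mathbb{R}^N\to\mathbb{R}$, $\Phi(Z)=\varphi(|Z|)$, $\Phi\in C^1(\mathbb{R}^N)\cap C^2(\mathbb{R}^N\setminus\{0\})$, $\varphi\in C^1([0,\infty))\cap C^2((0,\infty))$, $\varphi(0)=\varphi'(0)=0$, and for all $z>0$: $\varphi'(z)>0$ and $\Lambda_1\le z\varphi''(z)/\varphi'(z)\le\Lambda_2$ with positive constants $\Lambda_1,\Lambda_2$; without loss of generality $0<\Lambda_1<1<\Lambda_2$. Moreover there is $\omega\in C([0,\infty))$, $\omega(0)=0$, with $|\varphi''(s)-\varphi''(y)|\le\omega(|s-y|/y)\,\varphi''(y)$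 for all $s,y>0$ with $|s-y|<y/2$. $\partial\Phi$ denotes the gradient of $\Phi$. Front speed: the 1D problem, with $\Phi(z)=\varphi(|z|)$ for $z\in\mathbb{R}$ and $\partial\Phi=\Phi'$, is to find a pair $[q,c]$, $c\in\mathbb{R}$, $q:\mathbb{R}\to\mathbb{R}$ continuously differentiable, with $\frac{d}{dx}[\partial\Phi(q_x)]+c\,q_x+f(q)=0$ on $\mathbb{R}$, $q_x\le0$, $\lim_{x\to-\infty}q(x)=1$, $\lim_{x\to\infty}q(x)=-1$, $q(0)=\mu$. This problem has exactly one solution $[q,c]$; its $c$ is the front speed. Signed distance: $\mathrm{dist}[x,\Gamma]=\inf\{|x-y|:y\in\Gamma\}$ for $x\in G_-$, $\mathrm{dist}[x,\Gamma]=-\inf\{|x-y|:y\in\Gamma\}$ for $x\in G_+$, and $\mathrm{dist}[x,\Gamma]=0$ for $x\in\Gamma$. Regularized functions: $\varphi_\alpha\in C^2([0,\infty))$ ($\alpha>0$), $\Phi_\alpha(Z)=\varphi_\alpha(|Z|)$, with: $\varphi_\alpha(0)=\varphi_\alpha'(0)=0$; $\varphi_\alpha'(z)>0$ and $\Lambda_1\le z\varphi_\alpha''(z)/\varphi_\alpha'(z)\le\Lambda_2$ for all $z>0$; $|\varphi_\alpha''(s)-\varphi_\alpha''(y)|\le\omega(|s-y|/y)\varphi_\alpha''(y)$ for $s,y>0$, $|s-y|<y/2$; $z\varphi_\alpha''(z)/\varphi_\alpha'(z)=1$ for $0<z\le\alpha$ (i.e. $\varphi_\alpha$ is a positive multiple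 of $z^2$ near $0$); $\varphi_\alpha'\to\varphi'$ as $\alpha\searrow0$ uniformly on compact subsets of $[0,\infty)$. The constants $\Lambda_1,\Lambda_2$ and function $\omega$ are the same as for $\varphi$. Admissible weak solution: $u$ is an admissible weak solution of $\partial_tu=\operatorname{div}(\partial\Phi(\nabla_xu))+f(u)$ in $\mathbb{R}^N\times(0,\infty)$, $u(\cdot,0)=u_0$, if there are $\alpha_n\searrow0$, regularized functions $\varphi_{\alpha_n}\in C^2([0,\infty))$ (that is, $\varphi_{\alpha_n}(0)=\varphi_{\alpha_n}'(0)=0$; $\varphi_{\alpha_n}'(z)>0$ and $\Lambda_1\le z\varphi_{\alpha_n}''(z)/\varphi_{\alpha_n}'(z)\le\Lambda_2$ for all $z>0$; $|\varphi_{\alpha_n}''(s)-\varphi_{\alpha_n}''(y)|\le\omega(|s-y|/y)\varphi_{\alpha_n}''(y)$ for $s,y>0$, $|s-y|<y/2$; $z\varphi_{\alpha_n}''(z)/\varphi_{\alpha_n}'(z)=1$ for $0<z\le\alpha_n$; and $\varphi_{\alpha_n}'\to\varphi'$ as $n\to\infty$ uniformly on compact subsets of $[0,\infty)$), with $\Phi_{\alpha_n}(Z)=\varphi_{\alpha_n}(|Z|)$, and initial data $u_{\alpha_n,0}$ with $-1\le u_{\alpha_n,0}\le1$, $u_{\alpha_n,0}$ and $\nabla u_{\alpha_n,0}$ bounded and uniformly continuous on $\mathbb{R}^N$, $\nabla u_{\alpha_n,0}$ globally Hölder continuous with some exponent in $(0,1]$, such that $u_{\alpha_n,0}\to u_0$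 uniformly on compact sets of $\mathbb{R}^N$ and $u_{\alpha_n}\to u$ uniformly on compact sets of $\mathbb{R}^N\times[0,\infty)$, where $u_{\alpha_n}$ is the (unique) classical solution of the same Cauchy problem with $\Phi=\Phi_{\alpha_n}$ and initial datum $u_{\alpha_n,0}$. For the scaled problem, $u_\varepsilon$ is called an admissible weak solution if $u(x,t)=u_\varepsilon(\varepsilon x,\varepsilon t)$ is an admissible weak solution of the unscaled problem with initial datum $x\mapsto u_{\varepsilon,0}(\varepsilon x)$.
   Formalization: Added assumption: G_- ∪ G_+ ∪ Γ = R^N, so the signed distance is defined at every point; covering by the closures alone leaves it undefined at some points, and the claim then fails (e.g. data equal to 1 on a ball of radius √ε inside a region where the data are -1). *)

(* Defs.v *)
From HB Require Import structures.
From mathcomp Require Import all_boot all_order all_algebra.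
From mathcomp Require Import all_classical all_reals all_analysis.

Set Implicit Arguments.
Unset Strict Implicit.
Unset Printing Implicit Defensive.

Import Order.TTheory GRing.Theory Num.Theory.
Import numFieldNormedType.Exports.

Local Open Scope ring_scope.
Local Open Scope classical_set_scope.

Section euclidean_space.
Context {R : realType} {N : nat}.

(* The norm that the library puts on ['rV[R]_N] is the sup norm. It induces the
   same topology, uniformity and derivatives as the Euclidean norm [enorm]. *)
Definition enorm (x : 'rV[R]_N) : R := Num.sqrt (\sum_i x 0 i ^+ 2).

Definition partial (i : 'I_N) (g : 'rV[R]_N -> R) (x : 'rV[R]_N) : R :=
  'D_(delta_mx 0 i) g x.

Definition grad (g : 'rV[R]_N -> R) (x : 'rV[R]_N) : 'rV[R]_N :=
  \row_i partial i g x.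

Definition divergence (V : 'rV[R]_N -> 'rV[R]_N) (x : 'rV[R]_N) : R :=
  \sum_i partial i (fun y => V y 0 i) x.

Definition C1_on (A : set 'rV[R]_N) (g : 'rV[R]_N -> R) : Prop :=
  forall i x, A x ->
    derivable g x (delta_mx 0 i) /\ {for x, continuous (partial i g)}.

Definition C2_on (A : set 'rV[R]_N) (g : 'rV[R]_N -> R) : Prop :=
  C1_on A g /\ forall i, C1_on A (partial i g).

Definition radial (phi : R -> R) (Z : 'rV[R]_N) : R := phi (enorm Z).

End euclidean_space.

Section half_line.
Context {R : realType}.
Implicit Types g : R -> R.

(* Functions on [0, oo) are represented by functions on R whose values on
   (-oo, 0) are irrelevant; at 0 the derivative is the right derivative. *)
Definition derivable_hl g (z : R) : Prop :=
  if z == 0 then cvg (h^-1 * (g h - g 0) @[h --> 0^'+]) else derivable g z 1.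

Definition derive_hl g (z : R) : R :=
  if z == 0 then lim (h^-1 * (g h - g 0) @[h --> 0^'+]) else derive1 g z.

Definition C1_hl g : Prop :=
  (forall z : R, 0 <= z -> derivable_hl g z) /\
  {within `[0, +oo[, continuous (derive_hl g)}.

Definition C2_hl g : Prop := C1_hl g /\ C1_hl (derive_hl g).

Definition C2_pos g : Prop :=
  forall z : R, 0 < z ->
    [/\ derivable g z 1, derivable (derive1 g) z 1 &
        {for z, continuous (derive1 (derive1 g))}].

End half_line.

Section hypotheses.
Context {R : realType}.

Record bistable (f : R -> R) (mu : R) : Prop := Bistable {
  bistable_lipschitz : exists k : R, k.-lipschitz f ;
  bistable_mu : -1 < mu < 1 ;
  bistable_zeros : [/\ f (-1) = 0, f mu = 0 & f 1 = 0] ;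
  bistable_neg : forall s : R, -1 < s < mu -> f s < 0 ;
  bistable_pos : forall s : R, mu < s < 1 -> 0 < f s }.

Definition potential (f : R -> R) (r : R) : R :=
  \int[lebesgue_measure]_(s in `[-1, r]) f s.

Record unbalanced (f : R -> R) : Prop := Unbalanced {
  unbalanced_lt : forall r : R, -1 < r < 1 -> 0 < potential f 1 - potential f r ;
  unbalanced_pos : 0 < potential f 1 }.

Record modulus (omega : R -> R) : Prop := Modulus {
  modulus_cont : {within `[0, +oo[, continuous omega} ;
  modulus0 : omega 0 = 0 }.

(* The conditions shared by [phi] and its regularizations. *)
Record structure_cond (Lam1 Lam2 : R) (omega phi : R -> R) : Prop :=
  StructureCond {
  structure0 : phi 0 = 0 ;
  structure_derive0 : derive_hl phi 0 = 0 ;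
  structure_derive_gt0 : forall z : R, 0 < z -> 0 < derive1 phi z ;
  structure_ratio : forall z : R, 0 < z ->
    Lam1 <= z * derive1 (derive1 phi) z / derive1 phi z <= Lam2 ;
  structure_modulus : forall s y : R, 0 < s -> 0 < y -> `|s - y| < y / 2 ->
    `|derive1 (derive1 phi) s - derive1 (derive1 phi) y| <=
      omega (`|s - y| / y) * derive1 (derive1 phi) y }.

Record diffusion (N : nat) (Lam1 Lam2 : R) (omega phi : R -> R) : Prop :=
  Diffusion {
  diffusion_Phi_C1 : C1_on setT (radial phi : 'rV[R]_N -> R) ;
  diffusion_Phi_C2 : C2_on [set Z | Z != 0] (radial phi : 'rV[R]_N -> R) ;
  diffusion_C1 : C1_hl phi ;
  diffusion_C2 : C2_pos phi ;
  diffusion_structure : structure_cond Lam1 Lam2 omega phi }.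

Record regularized (Lam1 Lam2 : R) (omega : R -> R) (alpha : R)
    (phia : R -> R) : Prop := Regularized {
  regularized_C2 : C2_hl phia ;
  regularized_structure : structure_cond Lam1 Lam2 omega phia ;
  regularized_quadratic : forall z : R, 0 < z <= alpha ->
    z * derive1 (derive1 phia) z / derive1 phia z = 1 }.

Definition flux1 (phi : R -> R) : R -> R := derive1 (fun z : R => phi `|z|).

Record front (phi f : R -> R) (mu : R) (q : R -> R) (c : R) : Prop := Front {
  front_C1 : (forall x : R, derivable q x 1) /\ continuous (derive1 q) ;
  front_flux : forall x : R, derivable (flux1 phi \o derive1 q) x 1 ;
  front_eq : forall x : R,
    derive1 (flux1 phi \o derive1 q) x + c * derive1 q x + f (q x) = 0 ;
  front_noninc : forall x : R, derive1 q x <= 0 ;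
  front_ninfty : q x @[x --> -oo] --> (1 : R) ;
  front_pinfty : q x @[x --> +oo] --> (-1 : R) ;
  front0 : q 0 = mu }.

End hypotheses.

Section solutions.
Context {R : realType} {N : nat}.
Notation E := 'rV[R]_N.

(* Functions on R^N x [0, oo) are represented by functions [E -> R -> R] whose
   values at negative times are irrelevant.

   Boundedness on the strips R^N x [0, T] fixes the class in which the
   classical solution is unique (without any growth condition it is not,
   already for linear diffusion); by comparison with the constants -1 and 1,
   such a solution then takes its values in [-1, 1] when its datum does. *)
Record classical_solution (Phi : E -> R) (f : R -> R) (u0 : E -> R)
    (u : E -> R -> R) : Prop := ClassicalSolution {
  classical_cont :
    {within [set p : E * R | 0 <= p.2], continuous (fun p => u p.1 p.2)} ;
  classical_dt : forall x t, 0 < t ->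
    derivable (u x) t 1 /\
    {for (x, t), continuous (fun p : E * R => derive1 (u p.1) p.2)} ;
  classical_dx : forall i x t, 0 < t ->
    derivable (u ^~ t) x (delta_mx 0 i) /\
    {for (x, t), continuous (fun p : E * R => partial i (u ^~ p.2) p.1)} ;
  classical_dxx : forall i j x t, 0 < t ->
    derivable (partial i (u ^~ t)) x (delta_mx 0 j) /\
    {for (x, t), continuous
      (fun p : E * R => partial j (partial i (u ^~ p.2)) p.1)} ;
  classical_eq : forall x t, 0 < t ->
    derive1 (u x) t = divergence (grad Phi \o grad (u ^~ t)) x + f (u x t) ;
  classical_bounded : forall T : R, exists M : R,
    forall x t, 0 <= t <= T -> `|u x t| <= M ;
  classical_init : forall x, u x 0 = u0 x }.

Definition holder (beta K : R) (V : E -> E) : Prop :=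
  forall x y, enorm (V x - V y) <= K * enorm (x - y) `^ beta.

Record regular_datum (v : E -> R) : Prop := RegularDatum {
  datum_range : forall x, -1 <= v x <= 1 ;
  datum_unif : unif_continuous v ;
  datum_diff : forall x, differentiable v x ;
  datum_grad_bounded : exists M : R, forall x, enorm (grad v x) <= M ;
  datum_grad_unif : unif_continuous (grad v) ;
  datum_grad_holder : exists theta K : R, 0 < theta <= 1 /\
    holder theta K (grad v) }.

Definition admissible (Lam1 Lam2 : R) (omega phi f : R -> R) (u0 : E -> R)
    (u : E -> R -> R) : Prop :=
  exists (alpha : nat -> R) (phin : nat -> R -> R)
         (u0n : nat -> E -> R) (un : nat -> E -> R -> R),
  [/\ [/\ forall n, 0 < alpha n, decreasing_seq alpha & alpha @ \oo --> (0 : R)],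
      (forall n, regularized Lam1 Lam2 omega (alpha n) (phin n)) /\
      (forall A : set R, compact A -> A `<=` `[0, +oo[ ->
        {uniform A, (fun n => derive_hl (phin n)) @ \oo --> derive_hl phi}),
      (forall n, regular_datum (u0n n)) /\
      (forall A : set E, compact A -> {uniform A, u0n @ \oo --> u0}),
      forall n, classical_solution (radial (phin n)) f (u0n n) (un n) &
      forall A : set (E * R), compact A -> A `<=` [set p | 0 <= p.2] ->
        {uniform A, (fun n p => un n p.1 p.2) @ \oo --> (fun p => u p.1 p.2)}].

Definition admissible_scaled (Lam1 Lam2 : R) (omega phi f : R -> R) (eps : R)
    (u0 : E -> R) (u : E -> R -> R) : Prop :=
  admissible Lam1 Lam2 omega phi f
    (fun x => u0 (eps *: x)) (fun x t => u (eps *: x) (eps * t)).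

Definition Gminus (mu : R) (u0 : R -> E -> R) : set E :=
  [set x | exists2 U, nbhs x U &
    (limf_esup (fun eps => ereal_sup [set (u0 eps y)%:E | y in U]) 0^'+
       < mu%:E)%E].

Definition Gplus (mu : R) (u0 : R -> E -> R) : set E :=
  [set x | exists2 U, nbhs x U &
    (mu%:E <
       limf_einf (fun eps => ereal_inf [set (u0 eps y)%:E | y in U]) 0^'+)%E].

Definition interface (mu : R) (u0 : R -> E -> R) : set E :=
  closure (Gminus mu u0) `&` closure (Gplus mu u0).

(* Equal to +oo when [G] is empty. *)
Definition edist (x : E) (G : set E) : \bar R :=
  ereal_inf [set (enorm (x - y))%:E | y in G].

(* The signed distance from [G]; the last branch is meant for points of [G],
   so this function is meaningful on [Gm `|` G `|` Gp] only. *)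
Definition signed_dist (Gm Gp G : set E) (x : E) : \bar R :=
  if x \in Gm then edist x G
  else if x \in Gp then (- edist x G)%E
  else 0%E.

End solutions.

(* Main.v *)
Require Import Defs.
From HB Require Import structures.
From mathcomp Require Import all_boot all_order all_algebra.
From mathcomp Require Import all_classical all_reals all_analysis.
From mathcomp Require Import ring lra.

Set Implicit Arguments.
Unset Strict Implicit.
Unset Printing Implicit Defensive.

Import Order.TTheory GRing.Theory Num.Theory.
Import numFieldNormedType.Exports.

Local Open Scope ring_scope.
Local Open Scope classical_set_scope.

(** Where the data are below [mu] the reaction drives the solution to [-1] almost
    at once, where they are above [mu] to [1], and the transition layer between the
    two regions moves with the speed [c] of the front.  Since [c > 0], the state
    [1] wins.  It is enough to show, for balls, that an initial value below [mu]
    gives a value close to [-1] on the ball that shrinks with a speed slightly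
    larger than [c] ([spreading]); the reflection [u |-> - u] turns [f] into
    [s |-> - f (- s)], [mu] into [- mu] and [c] into [- c], and the same result
    then says that the region of the state [1] grows with a speed slightly smaller
    than [c].  The signed distance condition provides the balls: a ball around a
    point of [Gminus] that does not meet the interface lies in [Gminus] because it
    is connected, and a point at signed distance less than [c t] is within distance
    [c t] of a point of [Gplus].

    An admissible solution is a limit of solutions for regularized fluxes, so all
    estimates are made for the latter, uniformly in the regularization.  They are
    comparisons with radial supersolutions [B t + V (|x - a| - rho t)], where the
    slope [V'] is given through its flux [W = g V'] ([profile]).  At the first
    contact with the solution the two gradients coincide, so that no bound on the
    gradient of the solution is required, and the diffusion term is bounded by an
    upper bound for the one-sided slopes of [W] plus a curvature term
    ([touching_divergence], [radial_comparison]).  Describing barriers by the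
    flux is what makes the degenerate or singular diffusion harmless: [W] does not
    depend on the regularization, only [V] does, continuously
    ([profile_slope_close]).

    There are two kinds of barriers.  A constant in space, raised by a ramp that travels
    inwards, shows that solutions stay in [[-1, 1]] and that they come close to
    [-1] within a bounded time ([finite_speed_comparison], [generation]).  The
    decisive one is built from the front ([front_barrier]): with [p] the front as
    an increasing function and [w = g p'] its flux, the perturbed flux
    [w + theta (p - mu)] is larger than [w] where [f] is positive and smaller where
    [f] is negative.  Reparametrizing the front so that its slope matches this
    flux gives a strict supersolution for any speed slightly larger than [c];
    moreover the perturbed flux vanishes at a value above [-1], so that the profile
    can be continued by a constant below, and it is positive at the value [1], so
    that the profile can be continued beyond [1], where it is above every solution.
    The strict margin absorbs the curvature of large balls and the replacement of
    the flux by a regularized one ([propagation]).  In the scaled variables balls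
    become large and bounded times become short ([scaled_propagation]).

    That [c > 0] and that the slope of the front does not vanish between [-1] and
    [1] follows from the energy of the front, whose derivative is [c p' ^ 2] and which
    runs from [F (-1)] to [F 1] ([front_energy]). *)

(** * Functions of one real variable *)

Section calculus.
Context {R : realType}.
Implicit Types (f g : R -> R) (x y a b : R).

Lemma is_derive_continuous f x l : is_derive x 1 f l -> {for x, continuous f}.
Proof.
by move=> [d _]; apply/differentiable_continuous/derivable1_diffP.
Qed.

Lemma is_deriveDf (V : normedModType R) (f g : V -> R) (x v : V) (a b : R) :
  is_derive x v f a -> is_derive x v g b ->
  is_derive x v (fun z => f z + g z) (a + b).
Proof. by move=> ? ?; exact: is_deriveD. Qed.

Lemma is_deriveBf (V : normedModType R) (f g : V -> R) (x v : V) (a b : R) :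
  is_derive x v f a -> is_derive x v g b ->
  is_derive x v (fun z => f z - g z) (a - b).
Proof. by move=> ? ?; exact: is_deriveB. Qed.

Lemma is_deriveNf (V : normedModType R) (f : V -> R) (x v : V) (a : R) :
  is_derive x v f a -> is_derive x v (fun z => - f z) (- a).
Proof. by move=> ?; exact: is_deriveN. Qed.

Lemma is_deriveMf (V : normedModType R) (f g : V -> R) (x v : V) (a b : R) :
  is_derive x v f a -> is_derive x v g b ->
  is_derive x v (fun z => f z * g z) (f x * b + g x * a).
Proof. by move=> ? ?; exact: is_deriveM. Qed.

Lemma is_deriveZf (V : normedModType R) (f : V -> R) (x v : V) (a k : R) :
  is_derive x v f a -> is_derive x v (fun z => k * f z) (k * a).
Proof. by move=> ?; exact: is_deriveZ. Qed.

Lemma is_derive_comp f g x a b : is_derive (g x) 1 f a -> is_derive x 1 g b ->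
  is_derive x 1 (fun y => f (g y)) (a * b).
Proof. by move=> ? ?; exact: is_derive1_comp. Qed.

Lemma is_derive_near f g x l : (\forall y \near x, f y = g y) ->
  is_derive x 1 f l -> is_derive x 1 g l.
Proof.
move=> fg df; apply/is_derive1_caratheodory.
move/is_derive1_caratheodory : df => [h [hE hC hx]].
have fgx : f x = g x by exact: nbhs_singleton fg.
exists (fun z => if z == x then l else (g z - g x) / (z - x)); split.
- move=> z; case: eqP => [->|/eqP zx]; first by rewrite !subrr mulr0.
  by rewrite divfK// subr_eq0.
- have hC' : h @ x --> l by rewrite -hx.
  rewrite /prop_for /continuous_at eqxx; apply: cvg_trans hC'.
  apply: near_eq_cvg; near=> z; case: eqP => [->//|/eqP zx].
  have <- : f z = g z by near: z.
  by rewrite -fgx hE mulfK// subr_eq0.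
- by rewrite eqxx.
Unshelve. all: by end_near. Qed.

Lemma is_derive_affine x a k : is_derive x 1 (fun y => a + k * y) k.
Proof.
have := is_deriveDf (is_derive_cst a x 1) (is_deriveZf k (is_derive_id x (1:R))).
by rewrite add0r mulr1.
Qed.

Lemma mvt_open f (df : R -> R) a b : a < b ->
  (forall x, a <= x <= b -> is_derive x 1 f (df x)) ->
  exists2 c, a < c < b & f b - f a = df c * (b - a).
Proof.
move=> ab fd; have [||c] := @MVT R f df a b ab _ _.
- by move=> x; rewrite in_itv/= => /andP[/ltW ax /ltW xb]; apply: fd; rewrite ax.
- apply: derivable_within_continuous => x; rewrite in_itv/= => /fd dfx.
  exact: ex_derive.
by rewrite in_itv/= => cab e; exists c.
Qed.

Lemma is_derive_homo f (df : R -> R) a b : a <= b ->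
  (forall x, a <= x <= b -> is_derive x 1 f (df x)) ->
  (forall x, a <= x <= b -> 0 <= df x) -> f a <= f b.
Proof.
rewrite le_eqVlt => /predU1P[->//|ab] fd f0.
have [c /andP[ac cb] e] := mvt_open ab fd.
by rewrite -subr_ge0 e mulr_ge0 ?f0 ?subr_ge0 ?ltW ?ac.
Qed.

Lemma is_derive_homo_lt f (df : R -> R) a b : a < b ->
  (forall x, a <= x <= b -> is_derive x 1 f (df x)) ->
  (forall x, a < x < b -> 0 < df x) -> f a < f b.
Proof.
move=> ab fd f0.
have [c cab e] := mvt_open ab fd.
by rewrite -subr_gt0 e mulr_gt0// ?subr_gt0// f0.
Qed.

Lemma is_derive_unique_eq f g (df : R -> R) a b : a <= b ->
  (forall x, a <= x <= b -> is_derive x 1 f (df x)) ->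
  (forall x, a <= x <= b -> is_derive x 1 g (df x)) ->
  f b - f a = g b - g a.
Proof.
move=> ab fd gd.
have d x : a <= x <= b -> is_derive x 1 (fun y => f y - g y) 0.
  by move=> xab; have := is_deriveBf (fd x xab) (gd x xab); rewrite subrr.
move: ab; rewrite le_eqVlt => /predU1P[->|ab]; first by rewrite !subrr.
have [c _] := @mvt_open _ (fun=> 0) _ _ ab d.
by rewrite mul0r; lra.
Qed.

(** Fermat's rule at an endpoint. *)
Lemma derive_ge0_left_max f x (l : R) : is_derive x (1 : R) f l ->
  (\forall y \near x, y <= x -> f y <= f x) -> 0 <= l.
Proof.
move=> /is_derive1_caratheodory [h [hE hC hx]] fM.
rewrite leNgt; apply/negP => l0.
have hneg : \forall y \near x, h y < 0 by apply: (cvgr_lt (h x) hC); rewrite hx.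
have [e /= e0 H] := (nbhs_ballP _ _).1 (filterI fM hneg).
have /H[] : ball x e (x - e / 2) by rewrite /ball/= ltr_distlC; lra.
move=> /(_ ltac:(lra)) + hn; apply/negP; rewrite -ltNge -subr_gt0 hE.
by rewrite nmulr_rgt0//; lra.
Qed.

Lemma derive_eq0_max f x (l : R) : is_derive x (1 : R) f l ->
  (\forall y \near x, f y <= f x) -> l = 0.
Proof.
move=> fd fM; apply/eqP; rewrite eq_le; apply/andP; split; last first.
  by apply: (derive_ge0_left_max fd); near=> y => _; near: y.
rewrite -oppr_ge0.
have D : is_derive (- x) (1 : R) (fun y => f (- y)) (- l).
  have fd' : is_derive (- - x) (1 : R) f l by rewrite opprK.
  have := is_derive_comp fd' (is_deriveNf (is_derive_id (- x) (1 : R))).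
  by rewrite mulrN1.
apply: (derive_ge0_left_max D).
have [e /= e0 H] := (nbhs_ballP _ _).1 fM.
apply/nbhs_ballP; exists e => //= y; rewrite /ball/= => xy _.
by rewrite opprK; apply: H; rewrite /ball/= opprK -normrN opprD.
Unshelve. all: by end_near. Qed.

(** If the second derivative were positive, the first one would be positive
    just to the right of the maximum. *)
Lemma second_derivative_test f (f' : R -> R) x (l : R) :
  (\forall y \near x, is_derive y (1 : R) f (f' y)) -> is_derive x 1 f' l ->
  (\forall y \near x, f y <= f x) -> l <= 0.
Proof.
move=> fd fd' fmax; rewrite leNgt; apply/negP => l0.
have [e1 /= e10 fdE] := (nbhs_ballP _ _).1 fd.
have [e2 /= e20 fM] := (nbhs_ballP _ _).1 fmax.
have f'x : f' x = 0.
  exact: (derive_eq0_max (nbhs_singleton fd) fmax).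
have [h [hE hC hx]] := (is_derive1_caratheodory _ _ _).1 fd'.
have hpos : \forall y \near x, 0 < h y.
  by apply: (cvgr_gt (h x) hC); rewrite hx.
have [e3 /= e30 hp] := (nbhs_ballP _ _).1 hpos.
pose e := Num.min (Num.min e1 e2) e3 / 2.
have e0 : 0 < e by rewrite divr_gt0// !lt_min e10 e20.
have lee : e < e1 /\ e < e2 /\ e < e3.
  have : 0 < Num.min (Num.min e1 e2) e3 by rewrite !lt_min e10 e20.
  have : Num.min (Num.min e1 e2) e3 <= e3 by rewrite ge_min lexx orbT.
  have : Num.min (Num.min e1 e2) e3 <= e1 by rewrite !ge_min lexx.
  have : Num.min (Num.min e1 e2) e3 <= e2 by rewrite !ge_min lexx orbT.
  by rewrite /e; lra.
have [ee1 [ee2 ee3]] := lee.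
have : ball x e2 (x + e) by rewrite /ball/= ltr_distlC; lra.
move=> /fM; apply/negP; rewrite -ltNge; apply: (@is_derive_homo_lt _ f'); first lra.
- by move=> t tx; apply: fdE; rewrite /ball/= ltr_distlC; lra.
- move=> t tx; have := hE t; rewrite f'x subr0 => ->.
  by rewrite mulr_gt0 ?subr_gt0; [|apply: hp; rewrite /ball/= ltr_distlC; lra|lra].
Qed.

(** The lower end of the integral depends on the point, because the fundamental
    theorem needs it to the left of the point; the choice does not matter, by
    uniqueness of antiderivatives. *)
Lemma antiderivative f : continuous f ->
  exists F : R -> R, forall x, is_derive x 1 F (f x).
Proof.
move=> fC; pose F a x := \int[lebesgue_measure]_(t in `[a, x]) f t.
have FD a x : a < x -> is_derive x 1 (F a) (f x).
  move=> ax; have [|d e] := @continuous_FTC1_closed R f a x (x + 1)%R ltac:(lra) _ ax (fC x).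
    apply: continuous_compact_integrable; first exact: segment_compact.
    exact: continuous_subspaceT.
  by apply: (DeriveDef d); rewrite -derive1E e.
have Feq a b x y : a < x -> b < x -> x <= y -> F a y - F a x = F b y - F b x.
  move=> ax bx xy; apply: (is_derive_unique_eq xy) => t /andP[xt _]; apply: FD.
    exact: lt_le_trans ax xt.
  exact: lt_le_trans bx xt.
pose a_ x := Num.min x 0 - 1.
have a_lt x : a_ x < x /\ a_ x < 0.
  have : Num.min x 0 <= x by rewrite ge_min lexx.
  have : Num.min x 0 <= 0 by rewrite ge_min lexx orbT.
  by rewrite /a_; lra.
exists (fun x => F (a_ x) x - F (a_ x) 0) => x.
pose b := a_ x - 1.
have [ax a0] := a_lt x.
have bl : b < x /\ b < 0 by rewrite /b; lra.
apply: (@is_derive_near (fun y => F b y - F b 0)); last first.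
  by have := is_deriveBf (FD _ _ bl.1) (is_derive_cst (F b 0) x 1); rewrite subr0.
near=> y.
have by_ : b < y by near: y; apply: lt_nbhsr; exact: bl.1.
have [ay ay0] := a_lt y.
case: (leP y 0) => y0.
  by have := @Feq b (a_ y) y 0 by_ ay y0; lra.
by have := @Feq b (a_ y) 0 y bl.2 ay0 (ltW y0); lra.
Unshelve. all: by end_near. Qed.

Lemma lt_mono_continuous (g h : R -> R) : {homo g : x y / x < y} ->
  continuous (g \o h) -> continuous h.
Proof.
move=> gm ghC x; apply/cvgrPdist_lt => e e0.
have gmle : {mono g : x y / x <= y} by exact: le_mono.
have gmlt : {mono g : x y / x < y} by exact: leW_mono.
near=> y; rewrite ltr_distlC; apply/andP; split; rewrite -gmlt.
  by near: y; apply: (cvgr_gt (g (h x)) (ghC x)); apply: gm; lra.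
by near: y; apply: (cvgr_lt (g (h x)) (ghC x)); apply: gm; lra.
Unshelve. all: by end_near. Qed.

Lemma increasing_inverse (g : R -> R) : {homo g : x y / x < y} ->
  (forall y, exists x, g x = y) ->
  exists h : R -> R, [/\ cancel g h, cancel h g, continuous h &
    {homo h : x y / x < y}].
Proof.
move=> gm gs; have [h hK] := choice gs.
have gmle : {mono g : x y / x <= y} by exact: le_mono.
have gmlt : {mono g : x y / x < y} by exact: leW_mono.
exists h; split => //.
- by move=> x; apply: (inc_inj gmle); rewrite hK.
- apply: (lt_mono_continuous gm) => x; rewrite (_ : g \o h = id); first exact: cvg_id.
  by apply/funext => y /=; rewrite hK.
- by move=> x y xy; rewrite -gmlt !hK.
Qed.

(** Separation of variables: the solution is the inverse of an antiderivative
    of [b]. *)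
Lemma autonomous_ode (b : R -> R) (m x0 : R) : continuous b -> 0 < m ->
  (forall x, m <= b x) ->
  exists X : R -> R, [/\ X 0 = x0, {homo X : x y / x < y},
    forall y, exists x, X x = y & forall x, is_derive x 1 X (b (X x))^-1].
Proof.
move=> bC m0 bm; have [F FD] := antiderivative bC.
have Fm : {homo F : x y / x < y}.
  move=> x y xy; apply: (@is_derive_homo_lt F b) => // t _.
  exact: lt_le_trans m0 (bm t).
have FC : continuous F by move=> x; apply: is_derive_continuous (FD x).
have Fgr x y : x <= y -> m * (y - x) <= F y - F x.
  rewrite le_eqVlt => /predU1P[->|xy]; first by rewrite !subrr mulr0.
  have [c _ ->] := mvt_open xy (fun t _ => FD t).
  by rewrite ler_wpM2r// subr_ge0 ltW.
have Fs y : exists x, F x = y.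
  pose d : R := `|y - F 0| / m.
  have d0 : 0 <= d by rewrite divr_ge0// ltW.
  have mdE : m * d = `|y - F 0| by rewrite /d mulrC divfK// gt_eqF.
  have [|||x _ <-] := @IVT R F (- d) d y; last by exists x.
  - lra.
  - exact: continuous_subspaceT.
  have H1 := Fgr 0 d d0; have H2 : m * (0 - - d) <= F 0 - F (- d) by apply: Fgr; lra.
  rewrite ge_min le_max; apply/andP; split; apply/orP.
    by left; have := ler_norm (- (y - F 0)); rewrite normrN; nra.
  by right; have := ler_norm (y - F 0); nra.
have [h [Fh hF hC hm]] := increasing_inverse Fm Fs.
have hD y : is_derive y 1 h (b (h y))^-1.
  rewrite -{1}(hF y); apply: is_derive_inverse.
  - by near=> z; rewrite Fh.
  - by near=> z; exact: FC.
  - by rewrite gt_eqF// (lt_le_trans m0).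
exists (fun y => h (y + F x0)); split.
- by rewrite add0r Fh.
- by move=> x y xy; apply: hm; rewrite ltrD2r.
- by move=> y; exists (F y - F x0); rewrite subrK Fh.
- move=> x; have := @is_derive_comp h (fun z => z + F x0) x _ _ (hD (x + F x0)) (is_deriveDf (is_derive_id x (1:R)) (is_derive_cst (F x0) x 1)).
  by rewrite addr0 mulr1.
Unshelve. all: by end_near. Qed.

End calculus.

(** * Calculus in Euclidean space *)

Section space_calculus.
Context {R : realType} {N : nat}.
Notation E := 'rV[R]_N.
Implicit Types (x y d : E) (g : E -> R).

Lemma is_derive_line g x d (s l : R) :
  is_derive (s *: d + x) d g l <->
  is_derive s 1 (fun h : R => g (h *: d + x)) l.
Proof.
have e : (fun h : R => h^-1 *: ((g \o shift (s *: d + x)) (h *: d) -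
                                g (s *: d + x))) =
    (fun h : R => h^-1 *: (((fun h : R => g (h *: d + x)) \o shift s) (h *: 1) -
                                g (s *: d + x))).
  by apply/funext => h /=; rewrite [h *: 1]mulr1 scalerDl addrA.
by split=> -[]; rewrite /derivable /derive ?e => d1 d2;
  apply: DeriveDef; rewrite /derivable /derive ?e.
Qed.

Lemma is_derive_line0 g x d (l : R) :
  is_derive x d g l <-> is_derive (0 : R) (1 : R) (fun h : R => g (h *: d + x)) l.
Proof. by rewrite -is_derive_line scale0r add0r. Qed.

Lemma continuous_line g x d (s : R) : {for s *: d + x, continuous g} ->
  {for s, continuous (fun h : R => g (h *: d + x))}.
Proof.
move=> gC; apply: (@continuous_comp _ _ _ (fun h : R => h *: d + x) g) => //.
by apply: cvgD; [apply: cvgZr_tmp; exact: cvg_id|exact: cvg_cst].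
Qed.

(** The increment along [d + a e_i] is the increment along [d] followed by one
    along a coordinate axis, to which the mean value theorem applies. *)
Lemma is_derive_add_axis g x d (a l : R) i :
  (forall y, derivable g y (delta_mx 0 i)) ->
  {for x, continuous (partial i g)} ->
  is_derive x d g l ->
  is_derive x (a *: delta_mx 0 i + d) g (a * partial i g x + l).
Proof.
move=> gd gC gl.
pose e : E := delta_mx 0 i.
have mv y (t : R) : exists th : R, `|th| <= `|t| /\
    g (t *: e + y) - g y = t * partial i g (th *: e + y).
  have D (s : R) : is_derive s (1 : R) (fun h : R => g (h *: e + y)) (partial i g (s *: e + y)).
    by apply/is_derive_line; exact/derivableP.
  case: (ltgtP t 0) => [t0|t0|->]; last first.
  - by exists 0; split => //; rewrite scale0r add0r subrr mul0r.
  - have [c /andP[c0 ct] ec] := mvt_open t0 (fun s _ => D s).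
    exists c; split; first by rewrite !ger0_norm ltW.
    by rewrite mulrC -[t in RHS]subr0 -ec scale0r add0r.
  - have [c /andP[c0 ct] ec] := mvt_open t0 (fun s _ => D s).
    exists c; split; first by rewrite !ltr0_norm// lerN2 ltW.
    by move: ec; rewrite scale0r add0r sub0r mulrN -opprB mulrC => /oppr_inj.
have [th thP] := choice (fun h : R => mv (h *: d + x) (h * a)).
apply/is_derive_line0/is_derive1_caratheodory.
have [G [GE GC G0]] := (is_derive1_caratheodory _ _ _).1 ((is_derive_line0 _ _ _ _).1 gl).
exists (fun h => a * partial i g (th h *: e + (h *: d + x)) + G h); split.
- move=> h; have [_ H] := thP h; rewrite !subr0 in GE *.
  rewrite !scale0r !add0r scalerDr scalerA -addrA (mulrC h a).
  have := GE h; rewrite subr0 scale0r add0r; rewrite mulrC in H.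
  by move: H; rewrite -/e; lra.
- rewrite /prop_for /continuous_at scale0r add0r.
  have th0 : th 0 = 0.
    have [] := thP 0; rewrite mul0r normr0 => + _.
    by rewrite normr_le0 => /eqP.
  rewrite th0 scale0r add0r; apply: cvgD; last exact: GC.
  apply: cvgM; first exact: cvg_cst.
  have c1 : th h *: e + (h *: d + x) @[h --> (0 : R)] --> x.
    have thc : th h @[h --> (0 : R)] --> (0 : R).
      apply/cvgrPdist_lt => eps eps0.
      have c2 : `|h * a| @[h --> (0 : R)] --> (0 : R).
        have : `|h * a| @[h --> (0 : R)] --> `|0 * a : R|.
          by apply: cvg_norm; apply: cvgM; [exact: cvg_id|exact: cvg_cst].
        by rewrite mul0r normr0.
      near=> h; rewrite sub0r normrN; apply: (@le_lt_trans _ _ `|h * a|).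
        by have [] := thP h.
      by near: h; apply: (cvgr_lt _ c2).
    suff : th h *: e + (h *: d + x) @[h --> (0 : R)] --> (0 : R) *: e + ((0 : R) *: d + x).
      by rewrite !scale0r !add0r.
    apply: cvgD; first exact: cvgZr_tmp.
    by apply: cvgD; [apply: cvgZr_tmp; exact: cvg_id|exact: cvg_cst].
  exact: (cvg_comp _ _ c1 gC).
- rewrite G0; have [] := thP 0; rewrite mul0r normr0 => + _.
  by rewrite normr_le0 => /eqP ->; rewrite !scale0r !add0r.
Unshelve. all: by end_near. Qed.

(** Continuity of all partial derivatives at [x] gives every directional
    derivative, one coordinate at a time. *)
Lemma is_derive_partial g x d :
  (forall i y, derivable g y (delta_mx 0 i)) ->
  (forall i, {for x, continuous (partial i g)}) ->
  is_derive x d g (\sum_i d 0 i * partial i g x).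
Proof.
move=> gd gC.
have H (s : seq 'I_N) : is_derive x (\sum_(i <- s) d 0 i *: delta_mx 0 i) g
    (\sum_(i <- s) d 0 i * partial i g x).
  elim: s => [|i s IH]; first by rewrite !big_nil; exact: is_derive0.
  by rewrite !big_cons; apply: is_derive_add_axis.
by rewrite {1}[d]row_sum_delta; exact: H.
Qed.

Lemma is_derive_sumf (V : normedModType R) n (f : 'I_n -> V -> R) (x v : V)
    (l : 'I_n -> R) : (forall i, is_derive x v (f i) (l i)) ->
  is_derive x v (fun z => \sum_i f i z) (\sum_i l i).
Proof.
move=> fd; have H (s : seq 'I_n) :
    is_derive x v (fun z => \sum_(i <- s) f i z) (\sum_(i <- s) l i).
  elim: s => [|i s IH].
    rewrite big_nil (_ : (fun _ => _) = cst 0); first exact: is_derive_cst.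
    by apply/funext => z; rewrite big_nil.
  rewrite big_cons (_ : (fun _ => _) = (fun z => f i z + \sum_(j <- s) f j z)).
    exact: is_deriveDf.
  by apply/funext => z; rewrite big_cons.
exact: H.
Qed.

Record C2_everywhere (g : E -> R) : Prop := C2Everywhere {
  C2_derivable : forall i y, derivable g y (delta_mx 0 i) ;
  C2_continuous : forall i, continuous (partial i g) ;
  C2_derivable2 : forall i j y, derivable (partial i g) y (delta_mx 0 j) ;
  C2_continuous2 : forall i j, continuous (partial j (partial i g)) }.

Definition hessian g x : 'M[R]_N := \matrix_(i, j) partial j (partial i g) x.

Definition quad (H : 'M[R]_N) d : R := (d *m H *m d^T) 0 0.

Lemma quadE H d : quad H d = \sum_i d 0 i * \sum_j d 0 j * H i j.
Proof.
rewrite /quad mxE; under eq_bigr do rewrite !mxE.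
under eq_bigr do rewrite mulr_suml.
rewrite exchange_big /=; apply: eq_bigr => i _.
by rewrite mulr_sumr; apply: eq_bigr => j _; ring.
Qed.

Lemma is_derive_line_C2 g x d (s : R) : C2_everywhere g ->
  is_derive s (1 : R) (fun h : R => g (h *: d + x))
    (\sum_i d 0 i * partial i g (s *: d + x)).
Proof.
move=> [g1 g2 _ _]; apply/is_derive_line; apply: is_derive_partial => //.
by move=> i; exact: g2.
Qed.

Lemma is_derive2_line_C2 g x d : C2_everywhere g ->
  is_derive (0 : R) (1 : R) (fun h : R => \sum_i d 0 i * partial i g (h *: d + x))
    (quad (hessian g x) d).
Proof.
move=> [_ _ g1 g2]; rewrite quadE; apply: is_derive_sumf => i.
apply: is_deriveZf; apply/is_derive_line0.
under eq_bigr do rewrite mxE.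
by apply: is_derive_partial => // j; exact: g2.
Qed.

(** The second derivative test along a line, applied to the difference with the
    parabola. *)
Lemma quad_hessian_le g x d (A c : R) : C2_everywhere g ->
  (\forall s \near (0 : R), g (s *: d + x) <= g x + A * s + c / 2 * s ^+ 2) ->
  quad (hessian g x) d <= c.
Proof.
move=> g2 gle.
have sq (s : R) : is_derive s (1 : R) (fun h : R => h ^+ 2) (2 * s).
  have := is_deriveMf (is_derive_id s (1 : R)) (is_derive_id s (1 : R)).
  rewrite mulr1 (_ : s + s = 2 * s); last by ring.
  by congr is_derive; apply/funext => h; rewrite expr2.
have D (s : R) : is_derive s (1 : R)
    (fun h : R => g (h *: d + x) - (A * h + c / 2 * h ^+ 2))
    (\sum_i d 0 i * partial i g (s *: d + x) - (A + c * s)).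
  apply: is_deriveBf; first exact: is_derive_line_C2.
  have := is_deriveDf (is_deriveZf A (is_derive_id s (1 : R))) (is_deriveZf (c / 2) (sq s)).
  by rewrite mulr1 mulrA divfK.
have D2 : is_derive (0 : R) (1 : R)
    (fun s : R => \sum_i d 0 i * partial i g (s *: d + x) - (A + c * s))
    (quad (hessian g x) d - c).
  apply: is_deriveBf; first exact: is_derive2_line_C2.
  exact: is_derive_affine.
rewrite -subr_le0; apply: (second_derivative_test _ D2).
  by near=> s; exact: D.
near=> s.
rewrite scale0r add0r !expr2 !mulr0 addr0 subr0.
have : g (s *: d + x) <= g x + A * s + c / 2 * s ^+ 2 by near: s.
by rewrite expr2; lra.
Unshelve. all: by end_near. Qed.

(** The vectors [e_i - (e_i . e) e] are the rows of the orthogonal projection [P]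
    along [e], so the sum is the trace of [P H P^T], that is of [H P]. *)
Lemma sum_quad_perp (H : 'M[R]_N) (e : E) : enorm e = 1 ->
  \sum_i quad H (delta_mx 0 i - e 0 i *: e) = \tr H - quad H e.
Proof.
move=> e1; pose P : 'M[R]_N := 1%:M - e^T *m e.
have ee : e *m e^T = 1%:M.
  rewrite [e *m _]mx11_scalar mxE; congr (_%:M).
  have : enorm e ^+ 2 = 1 by rewrite e1 expr1n.
  rewrite sqr_sqrtr; last by apply: sumr_ge0 => i _; exact: sqr_ge0.
  by move=> <-; apply: eq_bigr => i _; rewrite mxE expr2.
have PT : P^T = P by rewrite /P linearB/= trmx1 trmx_mul trmxK.
have PP : P *m P = P.
  rewrite /P mulmxBr mulmx1 mulmxBl mul1mx -mulmxA (mulmxA e) ee mul1mx.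
  by rewrite subrr subr0.
have rowP i : row i P = delta_mx 0 i - e 0 i *: e.
  by apply/rowP => j; rewrite !mxE big_ord1 !mxE eq_sym.
have -> : \sum_i quad H (delta_mx 0 i - e 0 i *: e) = \tr (P *m H *m P^T).
  apply: eq_bigr => i _; rewrite -rowP /quad.
  by rewrite -row_mul !mxE; apply: eq_bigr => j _; rewrite !mxE.
rewrite mxtrace_mulC PT mulmxA PP /P mulmxBl mul1mx linearB/=; congr (_ - _).
by rewrite -mulmxA mxtrace_mulC /mxtrace big_ord1.
Qed.

(** ** The Euclidean norm *)

Lemma enorm_ge0 x : 0 <= enorm x. Proof. exact: sqrtr_ge0. Qed.

Lemma sqr_enorm x : enorm x ^+ 2 = \sum_i x 0 i ^+ 2.
Proof. by rewrite sqr_sqrtr//; apply: sumr_ge0 => i _; exact: sqr_ge0. Qed.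

Lemma enorm_eq0 x : (enorm x == 0) = (x == 0).
Proof.
rewrite -sqrf_eq0 sqr_enorm psumr_eq0; last first.
  by move=> i _; exact: sqr_ge0.
apply/idP/eqP => [/allP H|->]; last first.
  by apply/allP => i _ /=; rewrite mxE expr0n.
apply/rowP => i; rewrite mxE; apply/eqP; rewrite -sqrf_eq0.
by have := H i; rewrite mem_index_enum => /(_ isT).
Qed.

Lemma enorm0 : enorm (0 : E) = 0. Proof. by apply/eqP; rewrite enorm_eq0. Qed.

Lemma enormZ (k : R) x : enorm (k *: x) = `|k| * enorm x.
Proof.
rewrite /enorm -sqrtr_sqr -sqrtrM ?sqr_ge0//; congr Num.sqrt.
by rewrite mulr_sumr; apply: eq_bigr => i _; rewrite mxE exprMn.
Qed.

Lemma enormN x : enorm (- x) = enorm x.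
Proof. by rewrite -scaleN1r enormZ normrN1 mul1r. Qed.

Lemma enorm_delta i : enorm (delta_mx 0 i : E) = 1.
Proof.
rewrite /enorm (bigD1 i)//= mxE !eqxx expr1n big1 ?addr0 ?sqrtr1// => j ji.
by rewrite mxE eqxx (negbTE ji) expr0n.
Qed.

Lemma coord_le_enorm x i : `|x 0 i| <= enorm x.
Proof.
rewrite -(ler_pXn2r (n := 2)) ?nnegrE ?enorm_ge0// real_normK ?num_real//.
rewrite sqr_enorm (bigD1 i)//= lerDl; apply: sumr_ge0 => j _; exact: sqr_ge0.
Qed.

Lemma continuous_enorm : continuous (@enorm R N).
Proof.
move=> x; apply: (continuous_comp (f := fun x : E => \sum_i x 0 i ^+ 2)).
  apply: continuous_big => [|i _ y]; first exact: add_continuous.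
  apply: (@continuous_comp _ _ _ (fun x : E => x 0 i) (fun a => a ^+ 2)).
    exact: coord_continuous.
  exact: exprn_continuous.
exact: sqrt_continuous.
Qed.

Lemma is_derive_enorm (Z : R -> E) (s : R) (Z' : E) : Z s != 0 ->
  (forall i, is_derive s (1 : R) (fun h => Z h 0 i) (Z' 0 i)) ->
  is_derive s (1 : R) (fun h => enorm (Z h)) ((\sum_i Z s 0 i * Z' 0 i) / enorm (Z s)).
Proof.
move=> Z0 Zd.
have D : is_derive s (1 : R) (fun h => \sum_i Z h 0 i ^+ 2) (2 * \sum_i Z s 0 i * Z' 0 i).
  rewrite mulr_sumr; apply: is_derive_sumf => i.
  have := is_deriveMf (Zd i) (Zd i); rewrite (_ : Z s 0 i * Z' 0 i + Z s 0 i * Z' 0 i = 2 * (Z s 0 i * Z' 0 i)); last by ring.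
  by congr is_derive; apply/funext => h; rewrite expr2.
have p0 : 0 < \sum_i Z s 0 i ^+ 2.
  by rewrite -sqr_enorm exprn_gt0// lt_def enorm_ge0 enorm_eq0 Z0.
have Ds : is_derive (\sum_i Z s 0 i ^+ 2) (1 : R) Num.sqrt (2 * enorm (Z s))^-1.
  exact: is_derive1_sqrt.
have := is_derive_comp Ds D; congr is_derive.
have e0 : enorm (Z s) != 0 by rewrite enorm_eq0.
by field.
Qed.

End space_calculus.

(** * The diffusion term for a radial potential *)

Section radial_divergence.
Context {R : realType} {N : nat}.
Notation E := 'rV[R]_N.
Implicit Types (x Z e : E).

(** At the origin, where the norm is not differentiable, the gradient vanishes
    because the flux does. *)
Lemma grad_radial (phi : R -> R) Z :
  (forall z : R, derivable (fun y : R => phi `|y|) z 1) -> flux1 phi 0 = 0 ->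
  grad (radial phi) Z = (flux1 phi (enorm Z) / enorm Z) *: Z.
Proof.
move=> phid phi0; apply/rowP => i; rewrite !mxE.
have psiD z : is_derive z (1 : R) (fun y : R => phi `|y|) (flux1 phi z).
  by rewrite /flux1 derive1E; exact/derivableP.
suff D : is_derive Z (delta_mx 0 i) (radial phi)
    (flux1 phi (enorm Z) / enorm Z * Z 0 i).
  by rewrite /partial (@derive_val _ _ _ _ _ _ _ D).
apply/is_derive_line0.
have [->|Z0] := eqVneq Z 0.
  rewrite mxE mulr0; have := psiD 0; rewrite phi0; congr is_derive.
  by apply/funext => h; rewrite /radial addr0 enormZ enorm_delta mulr1.
have Zd : is_derive (0 : R) (1 : R) (fun h : R => enorm (h *: delta_mx 0 i + Z))
    (Z 0 i / enorm Z).
  have := @is_derive_enorm R N (fun h => h *: delta_mx 0 i + Z) 0 (delta_mx 0 i).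
  rewrite scale0r add0r (bigD1 i)//= mxE !eqxx mulr1 big1 => [|j ji]; last first.
    by rewrite mxE eqxx (negbTE ji) mulr0.
  rewrite addr0; apply => // j.
  have := is_deriveDf (is_deriveZf ((delta_mx 0 i : E) 0 j) (is_derive_id 0 (1 : R)))
    (is_derive_cst (Z 0 j) 0 (1 : R)).
  rewrite mulr1 addr0; congr is_derive; apply/funext => h.
  by rewrite [in RHS]mxE [in RHS]mxE mulrC.
have psiZ : is_derive (enorm ((0 : R) *: delta_mx 0 i + Z)) (1 : R)
    (fun y : R => phi `|y|) (flux1 phi (enorm Z)).
  by rewrite scale0r add0r.
have := @is_derive_comp _ _ (fun h => enorm (h *: delta_mx 0 i + Z)) 0 _ _ psiZ Zd.
rewrite mulrA mulrAC; congr is_derive; apply/funext => h.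
by rewrite ger0_norm ?enorm_ge0.
Qed.

(** The diffusion coefficient in the directions orthogonal to the gradient; at a
    vanishing gradient it is the common limit of both coefficients. *)
Definition diffusivity (g : R -> R) (z : R) : R :=
  if z == 0 then derive1 g 0 else g z / z.

(** The flux matrix has the eigenvalue [g'] along the gradient and [g z / z] across.
    The direction [e] is arbitrary when the gradient vanishes: the flux is linear
    near the origin, so that both coefficients agree there. *)
Lemma divergence_radial (Phi : E -> R) (g : R -> R) (w : E -> R) x e (z : R) :
  (forall Z, grad Phi Z = (g (enorm Z) / enorm Z) *: Z) ->
  (forall z : R, derivable g z 1) ->
  (exists2 a : R, 0 < a & forall y : R, `|y| < a -> g y = derive1 g 0 * y) ->
  C2_everywhere w -> 0 <= z -> enorm e = 1 -> grad w x = z *: e ->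
  divergence (grad Phi \o grad w) x =
    (derive1 g z - diffusivity g z) * quad (hessian w x) e +
    diffusivity g z * \tr (hessian w x).
Proof.
move=> gPhi gd [a a0 ga] w2 z0 e1 wx.
pose H := hessian w x.
pose Z i (h : R) := grad w (h *: delta_mx 0 i + x).
have Z0 i : Z i 0 = z *: e by rewrite /Z scale0r add0r.
have Zd i j : is_derive (0 : R) (1 : R) (fun h => Z i h 0 j) (H j i).
  under eq_fun do rewrite mxE.
  apply/is_derive_line0; rewrite mxE; apply/derivableP; exact: C2_derivable2.
suff partE : forall i, is_derive (0 : R) (1 : R)
    (fun h : R => (grad Phi (Z i h)) 0 i)
    (diffusivity g z * H i i + z * e 0 i *
      (if z == 0 then 0 else (derive1 g z / z - g z / z ^+ 2) *
        \sum_j e 0 j * H j i)).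
  have -> : divergence (grad Phi \o grad w) x =
    \sum_i (diffusivity g z * H i i + z * e 0 i *
      (if z == 0 then 0 else (derive1 g z / z - g z / z ^+ 2) *
        \sum_j e 0 j * H j i)).
    apply: eq_bigr => i _; apply: derive_val; apply/is_derive_line0; exact: (partE i).
  rewrite big_split/= -mulr_sumr [RHS]addrC -/H /mxtrace; congr (_ + _).
  rewrite /diffusivity; case: eqP => [->|/eqP zn0].
    by rewrite subrr mul0r big1// => i _; rewrite mulr0.
  rewrite /quad mxE mulr_sumr; apply: eq_bigr => i _.
  by rewrite !mxE; field.
move=> i; have gPhiE h : grad Phi (Z i h) 0 i = g (enorm (Z i h)) / enorm (Z i h) * Z i h 0 i.
  by rewrite gPhi mxE.
rewrite /diffusivity; case: eqP => [zE|/eqP zn0].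
  rewrite mulr0 addr0.
  apply: (is_derive_near _ (is_deriveZf (derive1 g 0) (Zd i i))).
  have Zc : {for (0 : R), continuous (fun h => enorm (Z i h))}.
    apply: (@continuous_comp _ _ _ (fun h => \sum_j Z i h 0 j ^+ 2)).
      have D j : is_derive (0 : R) (1 : R) (fun h => Z i h 0 j ^+ 2)
          (Z i 0 0 j * H j i + Z i 0 0 j * H j i).
        have := is_deriveMf (Zd i j) (Zd i j); congr is_derive.
      exact: is_derive_continuous (is_derive_sumf D).
    exact: sqrt_continuous.
  have : \forall h \near (0 : R), enorm (Z i h) < a.
    by apply: (cvgr_lt _ Zc); rewrite Z0 zE scale0r enorm0.
  apply: filterS => h ha; rewrite gPhiE.
  rewrite ga ?ger0_norm ?enorm_ge0//.
  have [->|n0] := eqVneq (Z i h) 0; first by rewrite mxE !mulr0.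
  by rewrite mulfK// enorm_eq0.
have zp : 0 < z by rewrite lt_def zn0.
have ze0 : z *: e != 0.
  by rewrite scaler_eq0 (negbTE zn0)/= -enorm_eq0 e1 oner_eq0.
have eZ0 : enorm (Z i 0) = z by rewrite Z0 enormZ e1 mulr1 ger0_norm.
have eD : is_derive (0 : R) (1 : R) (fun h => enorm (Z i h)) (\sum_j e 0 j * H j i).
  have Zn0 : Z i 0 != 0 by rewrite Z0.
  have <- : (\sum_j Z i 0 0 j * (\row_j H j i) 0 j) / enorm (Z i 0) =
      \sum_j e 0 j * H j i.
    rewrite eZ0 mulr_suml; apply: eq_bigr => j _; rewrite Z0 2!mxE.
    by field.
  by apply: is_derive_enorm => // j; rewrite mxE; exact: Zd.
have aD : is_derive (enorm (Z i 0)) (1 : R) (fun y => g y / y)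
    (derive1 g z / z - g z / z ^+ 2).
  rewrite eZ0.
  have gD : is_derive z (1 : R) g (derive1 g z) by rewrite derive1E; exact/derivableP.
  have := is_deriveMf gD (is_deriveV zn0 (is_derive_id z (1 : R))).
  congr is_derive.
  by rewrite /GRing.scale/=; field.
have := is_deriveMf (@is_derive_comp _ _ (fun h => enorm (Z i h)) 0 _ _ aD eD) (Zd i i).
rewrite eZ0 Z0 mxE; congr is_derive.
  by apply/funext => h; rewrite gPhiE.
by rewrite mxE.
Qed.

End radial_divergence.

(** * The flux function *)

Section flux.
Context {R : realType}.
Implicit Types (phi g : R -> R).

(** The properties shared by the flux and its regularizations. *)
Record flux_law g : Prop := FluxLaw {
  flux_odd : forall z, g (- z) = - g z ;
  flux_incr : {homo g : x y / x < y} ;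
  flux_cont : continuous g ;
  flux_surj : forall y, exists x, g x = y }.

Record regular_flux g : Prop := RegularFlux {
  regular_flux_law : flux_law g ;
  regular_derivable : forall z : R, derivable g z 1 ;
  regular_derive_gt0 : forall z : R, 0 < derive1 g z ;
  regular_linear : exists2 a : R, 0 < a &
    forall y : R, `|y| < a -> g y = derive1 g 0 * y }.

Lemma is_derive1P g (z : R) : derivable g z 1 -> is_derive z (1 : R) g (derive1 g z).
Proof. by move=> gd; rewrite derive1E; exact/derivableP. Qed.

Lemma derive1_val g (z l : R) : is_derive z (1 : R) g l -> derive1 g z = l.
Proof. by move=> gd; rewrite derive1E; exact: derive_val. Qed.

Lemma is_derive_abs_pos phi (z : R) : 0 < z -> derivable phi z 1 ->
  is_derive z (1 : R) (fun y : R => phi `|y|) (derive1 phi z).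
Proof.
move=> z0 pd; apply: (@is_derive_near _ phi); last exact: is_derive1P.
by near=> y; rewrite gtr0_norm//; near: y; apply: lt_nbhsr.
Unshelve. all: by end_near. Qed.

Lemma is_derive_abs_neg phi (z : R) : z < 0 -> derivable phi (- z) 1 ->
  is_derive z (1 : R) (fun y : R => phi `|y|) (- derive1 phi (- z)).
Proof.
move=> z0 /is_derive1P pd; apply: (@is_derive_near _ (fun y => phi (- y))).
  by near=> y; rewrite ltr0_norm//; near: y; apply: lt_nbhsl.
have := is_derive_comp pd (is_deriveNf (is_derive_id z (1 : R))).
by rewrite mulrN1.
Unshelve. all: by end_near. Qed.

Lemma is_derive_abs0 phi : derivable_hl phi 0 -> derive_hl phi 0 = 0 ->
  is_derive (0 : R) (1 : R) (fun y : R => phi `|y|) 0.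
Proof.
rewrite /derivable_hl /derive_hl eqxx => pc p0.
have {}pc : h^-1 * (phi h - phi 0) @[h --> (0 : R)^'+] -->
    lim (h^-1 * (phi h - phi 0) @[h --> (0 : R)^'+]) by [].
rewrite {}p0 in pc.
have L : h^-1 *: (((fun y : R => phi `|y|) \o shift 0) (h *: 1) -
    phi `|0 : R|) @[h --> (0 : R)^'] --> (0 : R).
  apply/cvgrPdist_lt => e e0.
  have [d /= d0 H] := (cvgrPdist_lt _ _).1 pc e e0.
  exists d => //= h /= hd hn0; rewrite addr0 [h *: 1]mulr1 normr0.
  have hp : 0 < `|h| by rewrite normr_gt0.
  have := H `|h|; rewrite /= !sub0r !normrN normr_id => /(_ _ hp).
  rewrite sub0r normrN in hd.
  by rewrite /GRing.scale/= !normrM !normfV normr_id; apply.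
by apply: DeriveDef; [apply/cvg_ex; exists 0|exact: cvg_lim].
Qed.

Section structure.
Context (phi omega : R -> R) (L1 L2 : R).
Context (phiC : C1_hl phi) (phiS : structure_cond L1 L2 omega phi).

Let phid (z : R) : 0 < z -> derivable phi z 1.
Proof. by move=> z0; have := phiC.1 z (ltW z0); rewrite /derivable_hl gt_eqF. Qed.

Lemma flux1_pos (z : R) : 0 < z -> flux1 phi z = derive1 phi z.
Proof. by move=> z0; apply: derive1_val; apply: is_derive_abs_pos => //; exact: phid. Qed.

Lemma flux1_at0 : flux1 phi 0 = 0.
Proof.
apply: derive1_val; apply: is_derive_abs0; first exact: (phiC.1 0).
by case: phiS.
Qed.

Lemma flux1_derive_hl (z : R) : 0 <= z -> flux1 phi z = derive_hl phi z.
Proof.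
rewrite le_eqVlt => /predU1P[<-|z0]; last by rewrite flux1_pos// /derive_hl gt_eqF.
by rewrite flux1_at0; case: phiS.
Qed.

Lemma derivable_abs (z : R) : derivable (fun y : R => phi `|y|) z 1.
Proof.
case: (ltgtP z 0) => [z0|z0|->].
- by apply: ex_derive; apply: is_derive_abs_neg => //; apply: phid; lra.
- by apply: ex_derive; apply: is_derive_abs_pos => //; exact: phid.
- apply: ex_derive; apply: is_derive_abs0; first exact: (phiC.1 0).
  by case: phiS.
Qed.

Lemma flux1_odd (z : R) : flux1 phi (- z) = - flux1 phi z.
Proof.
have H (y : R) : 0 < y -> flux1 phi (- y) = - flux1 phi y.
  move=> y0; rewrite (flux1_pos y0); apply: derive1_val.
  rewrite -{2}[y]opprK; apply: is_derive_abs_neg; first by lra.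
  by rewrite opprK; exact: phid.
case: (ltgtP z 0) => [z0|z0|->]; last by rewrite oppr0 flux1_at0 oppr0.
- have z0' : 0 < - z by rewrite oppr_gt0.
  by have := H _ z0'; rewrite opprK => ->; rewrite opprK.
- exact: H.
Qed.

Context (L10 : 0 < L1).
Context (phi2 : forall z : R, 0 < z -> derivable (derive1 phi) z 1).

Lemma is_derive_flux1 (z : R) : 0 < z ->
  is_derive z (1 : R) (flux1 phi) (derive1 (derive1 phi) z).
Proof.
move=> z0; apply: (@is_derive_near _ (derive1 phi)).
  by near=> y; rewrite flux1_pos//; near: y; apply: lt_nbhsr.
exact/is_derive1P/phi2.
Unshelve. all: by end_near. Qed.

Lemma derive2_lower (z : R) : 0 < z ->
  L1 * derive1 phi z <= z * derive1 (derive1 phi) z /\ 0 < derive1 (derive1 phi) z.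
Proof.
move=> z0; have [_ _ /(_ z z0) p0 /(_ z z0)/andP[+ _] _] := phiS.
rewrite ler_pdivlMr// => H; split => //.
by rewrite -(pmulr_rgt0 _ z0) (lt_le_trans _ H)// mulr_gt0.
Qed.

Lemma flux1_gt0 (z : R) : 0 < z -> 0 < flux1 phi z.
Proof. by move=> z0; rewrite flux1_pos//; case: phiS => _ _ /(_ z z0). Qed.

Lemma flux1_incr : {homo flux1 phi : x y / x < y}.
Proof.
have pos (x y : R) : 0 < x -> x < y -> flux1 phi x < flux1 phi y.
  move=> x0 xy; apply: (is_derive_homo_lt xy (df := derive1 (derive1 phi))).
    by move=> t /andP[xt _]; apply: is_derive_flux1; exact: lt_le_trans xt.
  by move=> t /andP[xt _]; apply: (derive2_lower _).2; exact: lt_trans xt.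
have neg (x : R) : x < 0 -> flux1 phi x < 0.
  by move=> x0; rewrite -[x]opprK flux1_odd oppr_lt0 flux1_gt0//; lra.
move=> x y xy; case: (ltgtP x 0) => [x0|x0|xE]; last first.
- by rewrite xE flux1_at0 flux1_gt0// -xE.
- exact: pos.
case: (ltgtP y 0) => [y0|y0|yE]; last first.
- by rewrite yE flux1_at0 neg.
- by rewrite (lt_trans (neg _ x0))// flux1_gt0.
- by rewrite -[x]opprK -[y]opprK (flux1_odd (- x)) (flux1_odd (- y)) ltrN2 pos//; lra.
Qed.

Lemma flux1_continuous : continuous (flux1 phi).
Proof.
have pos (z : R) : 0 < z -> {for z, continuous (flux1 phi)}.
  by move=> z0; exact: is_derive_continuous (is_derive_flux1 z0).
move=> z; case: (ltgtP z 0) => [z0|z0|->]; last first.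
- have C0 : derive_hl phi @ within `[0, +oo[ (nbhs (0 : R)) --> derive_hl phi 0.
    have := phiC.2; rewrite continuous_subspace_in => /(_ 0).
    by rewrite inE/= in_itv/= lexx => /(_ isT); rewrite /continuous_at nbhs_subspace_in//= in_itv/= lexx.
  have d0 : derive_hl phi 0 = 0 by case: phiS.
  rewrite /continuous_at flux1_at0; apply/cvgrPdist_lt => e e0.
  rewrite d0 in C0.
  have [d /= dp H] := (cvgrPdist_lt _ _).1 C0 e e0.
  exists d => //= y /=; rewrite !sub0r !normrN => yd.
  have := H `|y|; rewrite /= in_itv/= !sub0r !normrN normr_id normr_ge0.
  move=> /(_ yd isT); rewrite -flux1_derive_hl//.
  by case: (leP 0 y) => y0; [rewrite (ger0_norm y0)|rewrite (ltr0_norm y0) flux1_odd normrN].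
- exact: pos.
- rewrite (_ : flux1 phi = fun y => - flux1 phi (- y)); last first.
    by apply/funext => y; rewrite flux1_odd opprK.
  apply: cvgN; apply: (@continuous_comp _ _ _ -%R (flux1 phi)).
    exact: opp_continuous.
  by apply: pos; lra.
Qed.

(** The lower bound on the logarithmic derivative makes the flux grow at least
    like a logarithm. *)
Lemma flux1_surj (y : R) : exists x, flux1 phi x = y.
Proof.
wlog y0 : y / 0 <= y.
  move=> H; case: (leP 0 y) => [/H//|y0].
  have [|x xE] := H (- y); first by lra.
  by exists (- x); rewrite flux1_odd xE opprK.
pose k := L1 * flux1 phi 1.
have k0 : 0 < k by rewrite mulr_gt0// flux1_gt0.
pose b := expR (y / k).
have b1 : 1 <= b by rewrite -expR0 ler_expR divr_ge0// ltW.
have : flux1 phi 1 - k * ln 1 <= flux1 phi b - k * ln b.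
  apply: (@is_derive_homo _ (fun x => flux1 phi x - k * ln x)
    (fun x => derive1 (derive1 phi) x - k * x^-1)) => //.
    move=> t /andP[t1 _]; have t0 : 0 < t by lra.
    apply: is_deriveBf; first exact: is_derive_flux1.
    apply: is_deriveZf; exact: is_derive1_ln.
  move=> t /andP[t1 _]; have t0 : 0 < t by lra.
  rewrite subr_ge0 ler_pdivrMr// mulrC (le_trans _ (derive2_lower t0).1)//.
  apply: ler_wpM2l; first exact: ltW.
  move: t1; rewrite le_eqVlt => /predU1P[<-|t1]; first by rewrite flux1_pos.
  by rewrite -flux1_pos// ltW// flux1_incr.
rewrite ln1 mulr0 subr0 expRK mulrC divfK ?gt_eqF// => gb.
have [|||x _ <-] := @IVT R (flux1 phi) 0 b y; last by exists x.
- by lra.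
- exact/continuous_subspaceT/flux1_continuous.
- rewrite flux1_at0 ge_min y0/= le_max; apply/orP; right.
  by have := flux1_gt0 ltr01; lra.
Qed.

Lemma flux1_law : flux_law (flux1 phi).
Proof.
split; [exact: flux1_odd|exact: flux1_incr|exact: flux1_continuous|exact: flux1_surj].
Qed.

End structure.

Lemma diffusion_flux_law N L1 L2 omega phi : 0 < L1 ->
  diffusion N L1 L2 omega phi -> flux_law (flux1 phi).
Proof.
move=> L10 [_ _ p1 p2 ps]; apply: (flux1_law p1 ps L10) => z z0.
by have [] := p2 z z0.
Qed.

Section regularized_flux.
Context (phi omega : R -> R) (L1 L2 a : R).
Context (L10 : 0 < L1) (a0 : 0 < a) (phiR : regularized L1 L2 omega a phi).

Let phiC : C1_hl phi. Proof. by case: phiR => -[]. Qed.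
Let phiS : structure_cond L1 L2 omega phi. Proof. by case: phiR. Qed.

Let phi2 (z : R) : 0 < z -> derivable (derive1 phi) z 1.
Proof.
move=> z0; have [[_ [+ _]] _ _] := phiR => /(_ z (ltW z0)).
rewrite /derivable_hl (gt_eqF z0) => /is_derive1P D.
apply: ex_derive; apply: (is_derive_near _ D).
by near=> y; rewrite /derive_hl gt_eqF//; near: y; apply: lt_nbhsr.
Unshelve. all: by end_near. Qed.

Lemma regularized_linear (y : R) : `|y| <= a -> flux1 phi y = flux1 phi a / a * y.
Proof.
have pos (z : R) : 0 < z -> z <= a -> flux1 phi z = flux1 phi a / a * z.
  move=> z0; rewrite le_eqVlt => /predU1P[->|za]; first by rewrite divfK ?gt_eqF.
  have D (t : R) : z <= t <= a -> is_derive t (1 : R) (fun y => flux1 phi y / y) 0.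
    move=> /andP[zt ta]; have t0 : 0 < t by lra.
    have := is_deriveMf (is_derive_flux1 phiC phi2 t0)
      (is_deriveV (lt0r_neq0 t0) (is_derive_id t (1 : R))).
    rewrite (flux1_pos phiC t0).
    have [_ _ /(_ t)] := phiR; rewrite t0 ta => /(_ isT) e.
    congr is_derive.
    have p0 : derive1 phi t != 0 by rewrite gt_eqF//; case: phiS => _ _ /(_ t t0).
    have tE : derive1 phi t = t * derive1 (derive1 phi) t.
      by rewrite -[RHS](divfK p0) e mul1r.
    rewrite {1}tE /GRing.scale/=; field.
    exact: lt0r_neq0.
  have [c _] := mvt_open za D; rewrite mul0r => /eqP; rewrite subr_eq0 => /eqP ->.
  by rewrite divfK ?gt_eqF.
move=> ya; case: (ltgtP y 0) => [y0|y0|->].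
- rewrite -[y]opprK (flux1_odd phiC phiS) pos ?mulrN//; first by lra.
  by rewrite -normrN in ya; rewrite (le_trans (ler_norm _) ya).
- by apply: pos => //; rewrite (le_trans (ler_norm _) ya).
- by rewrite mulr0 (flux1_at0 phiC phiS).
Qed.

Let flux1_derive0 : is_derive (0 : R) (1 : R) (flux1 phi) (flux1 phi a / a).
Proof.
apply: (@is_derive_near _ (fun y => flux1 phi a / a * y)).
  exists a => //= y /=; rewrite sub0r normrN => ya.
  by rewrite (regularized_linear (ltW ya)).
by have := is_deriveZf (flux1 phi a / a) (is_derive_id (0 : R) (1 : R)); rewrite mulr1.
Qed.

Lemma regularized_regular_flux : regular_flux (flux1 phi).
Proof.
have gl := flux1_law phiC phiS L10 phi2.
have D0 := derive1_val flux1_derive0.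
have dp (z : R) : 0 < z -> is_derive z (1 : R) (flux1 phi) (derive1 (derive1 phi) z).
  exact: is_derive_flux1.
have dn (z : R) : z < 0 -> is_derive z (1 : R) (flux1 phi) (derive1 (derive1 phi) (- z)).
  move=> z0; have z0' : 0 < - z by lra.
  have := is_deriveNf (is_derive_comp (dp _ z0') (is_deriveNf (is_derive_id z (1 : R)))).
  rewrite mulrN1 opprK; congr is_derive; apply/funext => y.
  by rewrite (flux_odd gl) opprK.
split => //.
- move=> z; case: (ltgtP z 0) => [z0|z0|->]; apply: ex_derive.
  + exact: dn.
  + exact: dp.
  + exact: flux1_derive0.
- move=> z; case: (ltgtP z 0) => [z0|z0|->].
  + rewrite (derive1_val (dn _ z0)); apply: (derive2_lower phiS L10 _).2; lra.
  + by rewrite (derive1_val (dp _ z0)); apply: (derive2_lower phiS L10 _).2.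
  + by rewrite D0 divr_gt0// (flux1_gt0 phiC phiS).
- by exists a => // y ya; rewrite D0 (regularized_linear (ltW ya)).
Qed.

Lemma regularized_grad N (Z : 'rV[R]_N) :
  grad (radial phi) Z = (flux1 phi (enorm Z) / enorm Z) *: Z.
Proof.
by apply: grad_radial; [exact: (derivable_abs phiC phiS)|exact: (flux1_at0 phiC phiS)].
Qed.

End regularized_flux.

End flux.

(** * Classical solutions of the regularized problems *)

Section classical.
Context {R : realType} {N : nat}.
Notation E := 'rV[R]_N.
Implicit Types (u : E -> R -> R) (g f : R -> R).

(** The equation is stated through the one-dimensional flux [g], at a gradient given
    in polar form; this form is invariant under [u |-> - u] and refers to second
    derivatives only, which are what a comparison at a point of contact bounds. *)
Record bounded_solution g f u : Prop := BoundedSolution {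
  sol_cont : {within [set p : E * R | 0 <= p.2], continuous (fun p => u p.1 p.2)} ;
  sol_dt : forall x (t : R), 0 < t -> derivable (u x) t 1 ;
  sol_C2 : forall t : R, 0 < t -> C2_everywhere (u ^~ t) ;
  sol_eq : forall x (t : R) e (z : R), 0 < t -> 0 <= z -> enorm e = 1 ->
    grad (u ^~ t) x = z *: e ->
    derive1 (u x) t =
      (derive1 g z - diffusivity g z) * quad (hessian (u ^~ t) x) e +
      diffusivity g z * \tr (hessian (u ^~ t) x) + f (u x t) ;
  sol_bounded : forall T : R, exists M : R,
    forall x (t : R), 0 <= t <= T -> `|u x t| <= M }.

Lemma classical_bounded_solution (Phi : E -> R) g f (u0 : E -> R) u :
  (forall Z, grad Phi Z = (g (enorm Z) / enorm Z) *: Z) -> regular_flux g ->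
  classical_solution Phi f u0 u -> bounded_solution g f u.
Proof.
move=> gPhi [_ gd _ gl] [uC ut ux uxx ueq ub _].
have slice (w : E * R -> R) x t : {for (x, t), continuous w} ->
    {for x, continuous (fun y => w (y, t))}.
  move=> wC; apply: (@continuous_comp _ _ _ (fun y => (y, t)) w) => //.
  move=> A [[B C] /= [Bx Ct] BC].
  by apply: filterS Bx => y By; apply: BC; split => //=; exact: nbhs_singleton.
have u2 t : 0 < t -> C2_everywhere (u ^~ t).
  move=> t0; split.
  - by move=> i y; have [] := ux i y t t0.
  - by move=> i y; apply: (slice (fun p => partial i (u ^~ p.2) p.1)); have [] := ux i y t t0.
  - by move=> i j y; have [] := uxx i j y t t0.
  - move=> i j y.
    by apply: (slice (fun p => partial j (partial i (u ^~ p.2)) p.1)); have [] := uxx i j y t t0.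
split => //; first by move=> x t t0; have [] := ut x t t0.
move=> x t e z t0 z0 e1 uz; rewrite ueq//; congr (_ + _).
by apply: divergence_radial => //; exact: u2.
Qed.

Lemma partialN (w : E -> R) i : (forall y, derivable w y (delta_mx 0 i)) ->
  partial i (fun y => - w y) = (fun y => - partial i w y).
Proof.
move=> wd; apply/funext => y; apply: derive_val.
by apply: is_deriveNf; exact/derivableP.
Qed.

Lemma C2_everywhereN (w : E -> R) : C2_everywhere w -> C2_everywhere (fun y => - w y).
Proof.
move=> [w1 w2 w3 w4]; split.
- by move=> i y; exact: derivableN.
- by move=> i; rewrite partialN// => y; exact: (cvgN (w2 i y)).
- by move=> i j y; rewrite partialN//; exact: derivableN.
- by move=> i j; rewrite partialN// partialN// => y; exact: (cvgN (w4 i j y)).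
Qed.

Lemma hessianN (w : E -> R) x : C2_everywhere w ->
  hessian (fun y => - w y) x = - hessian w x.
Proof.
by move=> [w1 w2 w3 w4]; apply/matrixP => i j; rewrite !mxE partialN// partialN.
Qed.

Lemma bounded_solutionN g f u : bounded_solution g f u ->
  bounded_solution g (fun s => - f (- s)) (fun x t => - u x t).
Proof.
move=> [uC ut u2 ueq ub]; split.
- by move=> p; apply: cvgN; exact: uC.
- by move=> x t t0; apply: derivableN; exact: ut.
- by move=> t t0; apply: C2_everywhereN; exact: u2.
- move=> x t e z t0 z0 e1 gz.
  have gz' : grad (u ^~ t) x = z *: - e.
    apply: oppr_inj; rewrite scalerN opprK -gz; apply/rowP => i.
    by rewrite !mxE partialN//; case: (u2 t t0).
  have := ueq x t (- e) z t0 z0; rewrite enormN => /(_ e1 gz') uE.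
  rewrite (hessianN _ (u2 t t0)).
  have -> : derive1 (fun t => - u x t) t = - derive1 (u x) t.
    by apply: derive1_val; apply: is_deriveNf; apply: is_derive1P; exact: ut.
  have qN (H : 'M[R]_N) : quad (- H) e = - quad H (- e).
    rewrite !quadE -sumrN; apply: eq_bigr => i _.
    rewrite !mxE mulNr opprK; congr (_ * _).
    by apply: eq_bigr => j _; rewrite !mxE; ring.
  by rewrite uE opprK linearN/= qN; ring.
- by move=> T; have [M HM] := ub T; exists M => x t /HM; rewrite normrN.
Qed.

End classical.

(** * Comparison with radial barriers *)

Section barrier.
Context {R : realType}.
Implicit Types (W zeta V g : R -> R).

(** An upper bound for the difference quotients on both sides.  Corners at which
    the slope jumps are admitted, as a comparison from above needs no more. *)
Definition slope_le W (xi K : R) : Prop :=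
  \forall s \near (0 : R), s * (W (xi + s) - W xi) <= K * s ^+ 2.

Lemma is_derive_scale V (xi c l : R) : is_derive xi (1 : R) V l ->
  is_derive (0 : R) (1 : R) (fun s => V (xi + c * s)) (c * l).
Proof.
move=> Vd; rewrite mulrC.
apply: (@is_derive_comp _ V (fun s => xi + c * s)); last exact: is_derive_affine.
by rewrite mulr0 addr0.
Qed.

(** A one-sided bound on the slope of the flux [g \o zeta] bounds the barrier
    from above by a parabola. *)
Lemma barrier_parabola g W zeta V (xi K c : R) :
  {homo g : x y / x < y} -> derivable g (zeta xi) 1 ->
  (forall x, is_derive x (1 : R) V (zeta x)) -> (forall x, g (zeta x) = W x) ->
  slope_le W xi K -> K < c * derive1 g (zeta xi) ->
  \forall s \near (0 : R), V (xi + s) <= V xi + zeta xi * s + c / 2 * s ^+ 2.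
Proof.
move=> gm gd Vd gW WK Kc.
have gmlt : {mono g : x y / x < y} by exact/leW_mono/le_mono.
have [h [hE hC h0]] := (is_derive1_caratheodory _ _ _).1
  (is_derive_scale c (is_derive1P gd)).
have hK : \forall s \near (0 : R), K < h s by apply: (cvgr_gt (h 0) hC); rewrite h0.
have [e /= e0 H] := (nbhs_ballP _ _).1 (filterI hK WK).
have zpos (s : R) : 0 < s -> s < e -> zeta (xi + s) <= zeta xi + c * s.
  move=> s0 se; have [|hs Ws] := H s; first by rewrite /ball/= sub0r normrN gtr0_norm.
  rewrite ltW// -gmlt gW; have := hE s; rewrite mulr0 addr0 subr0 gW.
  move: Ws; rewrite expr2 mulrCA -subr_le0 => Ws.
  have {}Ws : W (xi + s) - W xi <= K * s by nra.
  by nra.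
have zneg (s : R) : s < 0 -> - e < s -> zeta xi + c * s <= zeta (xi + s).
  move=> s0 se; have [|hs Ws] := H s; first by rewrite /ball/= sub0r normrN ltr0_norm//; lra.
  rewrite ltW// -gmlt gW; have := hE s; rewrite mulr0 addr0 subr0 gW.
  move: Ws; rewrite expr2 mulrCA -subr_le0 => Ws.
  have {}Ws : K * s <= W (xi + s) - W xi by nra.
  by nra.
pose m (s : R) := zeta xi * s + c / 2 * s ^+ 2 - V (xi + s).
have md (s : R) : is_derive s (1 : R) m (zeta xi + c * s - zeta (xi + s)).
  have sq : is_derive s (1 : R) (fun h : R => h ^+ 2) (2 * s).
    have := is_deriveMf (is_derive_id s (1 : R)) (is_derive_id s (1 : R)).
    by rewrite mulr1 (_ : s + s = 2 * s)//; ring.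
  have VD : is_derive s (1 : R) (fun h => V (xi + h)) (zeta (xi + s)).
    have := @is_derive_comp _ V (fun h => xi + 1 * h) s _ _ (Vd _) (is_derive_affine _ _ _).
    by rewrite mulr1 mul1r; congr is_derive; apply/funext => y; rewrite mul1r.
  have := is_deriveBf (is_deriveDf (is_deriveZf (zeta xi) (is_derive_id s (1 : R)))
    (is_deriveZf (c / 2) sq)) VD.
  by rewrite mulr1 mulrA divfK.
have m0 : m 0 = - V xi by rewrite /m mulr0 expr2 !mulr0 addr0 add0r addr0.
apply/nbhs_ballP; exists e => //= s; rewrite /ball/= sub0r normrN ltr_norml => /andP[s1 s2].
suff : m 0 <= m s by rewrite m0 /m; lra.
case: (ltgtP s 0) => [s0|s0|->//].
- rewrite -lerN2; apply: (@is_derive_homo _ (fun s => - m s)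
    (fun s => - (zeta xi + c * s - zeta (xi + s))) _ _ (ltW s0)).
  move=> t /andP[t1]; rewrite le_eqVlt => /predU1P[->|t0].
    by rewrite mulr0 !addr0 subrr oppr0.
  by have := zneg t t0; lra.
- apply: (is_derive_homo (ltW s0) (fun t _ => md t)) => t /andP[+ ts].
  rewrite le_eqVlt => /predU1P[<-|t0]; first by rewrite mulr0 !addr0 subrr.
  by have := zpos t t0; lra.
Qed.

Lemma barrier_above V (xi z eta : R) : is_derive xi (1 : R) V z -> 0 < eta ->
  \forall s \near (0 : R), 0 <= s -> V (xi + s) <= V xi + (z + eta) * s.
Proof.
move=> Vd eta0.
have := is_derive_scale 1 Vd; rewrite mul1r.
move=> /is_derive1_caratheodory[h [hE hC h0]].
have : \forall s \near (0 : R), h s < z + eta by apply: (cvgr_lt (h 0) hC); rewrite h0; lra.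
apply: filterS => s hs s0; have := hE s; rewrite mulr0 addr0 mul1r subr0.
by nra.
Qed.

End barrier.

Section comparison.
Context {R : realType} {N : nat}.
Notation E := 'rV[R]_N.
Implicit Types (x y d e : E).

Definition dotp x y : R := \sum_i x 0 i * y 0 i.

Lemma dotpp x : dotp x x = enorm x ^+ 2.
Proof. by rewrite sqr_enorm; apply: eq_bigr => i _; rewrite expr2. Qed.

Lemma sqr_enorm_line (s : R) d y :
  enorm (s *: d + y) ^+ 2 = s ^+ 2 * enorm d ^+ 2 + 2 * s * dotp d y + enorm y ^+ 2.
Proof.
rewrite !sqr_enorm /dotp !mulr_sumr -!big_split/=; apply: eq_bigr => i _.
by rewrite !mxE; ring.
Qed.

Lemma enorm_line_parallel (s : R) y : 0 < enorm y -> - enorm y < s ->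
  enorm (s *: ((enorm y)^-1 *: y) + y) = enorm y + s.
Proof.
move=> y0 sy; rewrite scalerA -{3}[y]scale1r -scalerDl enormZ ger0_norm.
  by field; exact: lt0r_neq0.
have : - enorm y / enorm y <= s / enorm y by rewrite ler_pM2r ?invr_gt0// ltW.
by rewrite mulNr divff ?lt0r_neq0//; lra.
Qed.

(** Along a tangent to a sphere the distance to the centre grows to second order
    only, the coefficient being the curvature. *)
Lemma enorm_line_perp (s : R) d y : 0 < enorm y -> dotp d y = 0 ->
  enorm (s *: d + y) <= enorm y + enorm d ^+ 2 / (2 * enorm y) * s ^+ 2.
Proof.
move=> y0 dy; set k := _ / _.
have k0 : 0 <= k by rewrite divr_ge0 ?sqr_ge0// mulr_ge0// ltW.
have kE : 2 * enorm y * k = enorm d ^+ 2.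
  by rewrite /k mulrC divfK// mulf_neq0// lt0r_neq0.
have s2 : 0 <= s ^+ 2 by exact: sqr_ge0.
have p0 : 0 <= enorm y + k * s ^+ 2 by apply: addr_ge0; [exact: ltW|exact: mulr_ge0].
rewrite -(ler_pXn2r (n := 2)) ?nnegrE ?enorm_ge0//.
rewrite sqr_enorm_line dy mulr0 addr0 -kE.
have : 0 <= (k * s ^+ 2) ^+ 2 by exact: sqr_ge0.
by rewrite !expr2; nra.
Qed.

Lemma quad_delta (H : 'M[R]_N) i : quad H (delta_mx 0 i) = H i i.
Proof. by rewrite /quad -rowE trmx_delta -colE !mxE. Qed.

Lemma sum_sqr_enorm_perp e : enorm e = 1 ->
  \sum_i enorm (delta_mx 0 i - e 0 i *: e) ^+ 2 = N%:R - 1.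
Proof.
move=> e1; have q1 d : quad 1%:M d = enorm d ^+ 2.
  rewrite /quad mulmx1 mxE sqr_enorm; apply: eq_bigr => i _.
  by rewrite mxE expr2.
under eq_bigr do rewrite -q1.
by rewrite sum_quad_perp// mxtrace1 q1 e1 expr1n.
Qed.

Lemma dotp_delta i y : dotp (delta_mx 0 i) y = y 0 i.
Proof.
rewrite /dotp (bigD1 i)//= mxE !eqxx mul1r big1 ?addr0// => j ji.
by rewrite mxE eqxx (negbTE ji) mul0r.
Qed.

Lemma dotpBZ d e (k : R) y : dotp (d - k *: e) y = dotp d y - k * dotp e y.
Proof.
rewrite /dotp mulr_sumr -sumrB; apply: eq_bigr => i _; rewrite !mxE; ring.
Qed.

Lemma diffusivityM g (z : R) : g 0 = 0 -> diffusivity g z * z = g z.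
Proof.
rewrite /diffusivity => g0; case: eqP => [->|/eqP zn0]; first by rewrite mulr0.
by rewrite divfK.
Qed.

Lemma dotpZr d e (k : R) : dotp d (k *: e) = k * dotp d e.
Proof. by rewrite /dotp mulr_sumr; apply: eq_bigr => i _; rewrite mxE; ring. Qed.

(** At a point where the radial barrier [b + V (|x - a| - rho)] touches [w] from
    above, the radial second derivative of [w] is bounded through the slope of
    the flux profile and the tangential ones by the curvature of the spheres. *)
Lemma touching_divergence (g W zeta V : R -> R) (w : E -> R) (a x : E) (b rho r0 K : R) :
  (0 < N)%N -> regular_flux g -> C2_everywhere w -> 0 < r0 -> r0 <= rho ->
  (forall s : R, is_derive s (1 : R) V (zeta s)) ->
  (forall s : R, g (zeta s) = W s) ->
  (forall s : R, 0 <= zeta s) -> (forall s : R, s <= 0 -> zeta s = 0) ->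
  slope_le W (enorm (x - a) - rho) K ->
  (forall y, w y <= b + V (enorm (y - a) - rho)) ->
  w x = b + V (enorm (x - a) - rho) ->
  exists e (z : R), [/\ enorm e = 1, 0 <= z, grad w x = z *: e &
    (derive1 g z - diffusivity g z) * quad (hessian w x) e +
      diffusivity g z * \tr (hessian w x) <=
    K + (N%:R - 1) / r0 * W (enorm (x - a) - rho)].
Proof.
move=> N0 [[godd gm gC _] gd gd0 _] w2 r00 r0rho Vd gW zeta0 zetaN WK wle wx.
set y := x - a in WK wx *; set xi := enorm y - rho in WK wx *.
have g0 : g 0 = 0 by have := godd 0; rewrite oppr0; lra.
have gmle : {mono g : x y / x <= y} by exact: le_mono.
have diff0 (z : R) : 0 <= z -> 0 <= diffusivity g z.
  move=> z0; rewrite /diffusivity; case: eqP => _; first by rewrite ltW.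
  by rewrite divr_ge0// -g0 gmle.
have W0 : 0 <= W xi by rewrite -gW -g0 gmle.
have N1 : (0 : R) <= N%:R - 1 by rewrite subr_ge0 ler1n.
have lineE (s : R) d : s *: d + x - a = s *: d + y by rewrite addrA.
have wline (s : R) d : w (s *: d + x) <= b + V (enorm (s *: d + y) - rho).
  by rewrite -lineE.
have lineC d : {for (0 : R), continuous (fun s : R => enorm (s *: d + y) - rho)}.
  apply: cvgB; last exact: cvg_cst.
  by apply: continuous_line; exact: continuous_enorm.
have gradE d (l : R) : is_derive (0 : R) (1 : R)
    (fun s => V (enorm (s *: d + y) - rho)) l ->
    \sum_i d 0 i * partial i w x = l.
  move=> Ld; apply/eqP; rewrite -subr_eq0; apply/eqP.
  have wd := is_derive_line_C2 x d 0 w2; rewrite scale0r add0r in wd.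
  have D := is_deriveBf wd (is_deriveDf (is_derive_cst b (0 : R) (1 : R)) Ld).
  rewrite add0r in D; apply: (derive_eq0_max D).
  near=> s; rewrite scale0r !add0r -/xi wx.
  by have := wline s d; rewrite /cst/=; lra.
have sum_delta (h : 'I_N -> R) i : \sum_j (delta_mx 0 i : E) 0 j * h j = h i.
  have := dotp_delta i (\row_j h j); rewrite mxE => <-.
  by apply: eq_bigr => j _; rewrite [in RHS]mxE.
case: (ltP xi 0) => xi0.
  have Vflat s : s <= 0 -> V s = V xi.
    have Vc c s1 : c <= s1 -> s1 <= 0 -> V s1 - V c = 0.
      move=> cs s10; have D (t : R) : c <= t <= s1 -> is_derive t (1 : R) V 0.
        by move=> /andP[_ ts]; have := Vd t; rewrite (zetaN t)//; lra.
      rewrite (@is_derive_unique_eq _ V (fun=> 0) (fun=> 0) c s1 cs D) ?subrr//.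
    move=> s0; case: (leP xi s) => xis; first by have := Vc _ _ xis s0; lra.
    by have := Vc _ _ (ltW xis) (ltW xi0); lra.
  have wmax d : \forall s \near (0 : R), w (s *: d + x) <= w x.
    have : \forall s \near (0 : R), enorm (s *: d + y) - rho < 0.
      by apply: (cvgr_lt _ (lineC d)); rewrite scale0r add0r.
    by apply: filterS => s sn; rewrite (le_trans (wline s d))// wx (Vflat _ (ltW sn)).
  have q0 d : quad (hessian w x) d <= 0.
    apply: (@quad_hessian_le _ _ _ _ _ 0 0 w2).
    by apply: filterS (wmax d) => s; rewrite !mul0r !addr0.
  exists (delta_mx 0 (Ordinal N0)), 0; split => //; first exact: enorm_delta.
    apply/rowP => i; rewrite scale0r !mxE -[LHS](sum_delta (fun j => partial j w x)).
    have wd := is_derive_line_C2 x (delta_mx 0 i) 0 w2; rewrite scale0r add0r in wd.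
    apply: (derive_eq0_max wd); rewrite scale0r add0r; exact: wmax.
  have WE s : s <= 0 -> W s = 0 by move=> s0; rewrite -gW zetaN// g0.
  rewrite (WE _ (ltW xi0)) mulr0 addr0 /diffusivity eqxx subrr mul0r add0r.
  have K0 : 0 <= K.
    have nn : \forall s \near (0 : R), xi + s < 0.
      have : xi + s @[s --> (0 : R)] --> xi + 0.
        by apply: cvgD; [exact: cvg_cst|exact: cvg_id].
      by rewrite addr0 => /cvgr_lt; apply.
    have [d /= d0 H] := (nbhs_ballP _ _).1 (filterI WK nn).
    have [|] := H (d / 2); first by rewrite /ball/= sub0r normrN gtr0_norm; lra.
    move=> + hd; rewrite !WE; [|lra|lra]; rewrite subrr mulr0 pmulr_lge0//.
    by rewrite exprn_gt0//; lra.
  apply: le_trans K0; rewrite pmulr_rle0// /mxtrace.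
  by apply: sumr_le0 => i _; rewrite -quad_delta.
have r1 : 0 < enorm y by move: xi0; rewrite /xi; lra.
have r0r : r0 <= enorm y by move: xi0; rewrite /xi; lra.
pose e := (enorm y)^-1 *: y.
have e1 : enorm e = 1.
  by rewrite enormZ ger0_norm ?invr_ge0 ?ltW// mulVf// lt0r_neq0.
have yn0 : y != 0 by rewrite -enorm_eq0 lt0r_neq0.
have yE : y = enorm y *: e by rewrite scalerA divff ?lt0r_neq0// scale1r.
have gE : grad w x = zeta xi *: e.
  apply/rowP => i; rewrite !mxE -(sum_delta (fun j => partial j w x)).
  apply: gradE.
  have ed : is_derive (0 : R) (1 : R) (fun s => enorm (s *: delta_mx 0 i + y) - rho)
      ((enorm y)^-1 * y 0 i).
    rewrite -[X in is_derive _ _ _ X]subr0; apply: is_deriveBf.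
    have := @is_derive_enorm R N (fun h => h *: delta_mx 0 i + y) 0 (delta_mx 0 i).
    rewrite scale0r add0r mulrC; under eq_bigr do rewrite mulrC.
    rewrite sum_delta mulrC; apply => // j.
    have := is_deriveDf (is_deriveZf ((delta_mx 0 i : E) 0 j) (is_derive_id 0 (1 : R)))
      (is_derive_cst (y 0 j) 0 (1 : R)).
    rewrite mulr1 addr0; congr is_derive; apply/funext => h.
    by rewrite [in RHS]mxE [in RHS]mxE mulrC.
  have Vd0 : is_derive (enorm ((0 : R) *: delta_mx 0 i + y) - rho) (1 : R) V (zeta xi).
    by rewrite scale0r add0r; exact: Vd.
  have := @is_derive_comp _ V (fun s => enorm (s *: delta_mx 0 i + y) - rho) 0 _ _ Vd0 ed.
  by rewrite [y 0 i]mxE [(- a) 0 i]mxE.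
exists e, (zeta xi); split => //.
set z := zeta xi in gE *; have z0 : 0 <= z by exact: zeta0.
have qe : derive1 g z * quad (hessian w x) e <= K.
  rewrite -ler_pdivlMl//; apply/ler_addgt0Pr => eta eta0.
  apply: (@quad_hessian_le _ _ _ _ _ z _ w2).
  have ep : \forall s \near (0 : R), - enorm y < s.
    by apply: lt_nbhsr; rewrite oppr_lt0.
  have bp := @barrier_parabola _ g W zeta V xi K ((derive1 g z)^-1 * K + eta)
    gm (gd _) Vd gW WK.
  have {}bp := bp ltac:(by rewrite mulrDl mulrAC mulVf ?lt0r_neq0// mul1r ltrDl mulr_gt0).
  near=> s; apply: (le_trans (wline s e)).
  rewrite enorm_line_parallel//; last by near: s.
  rewrite addrAC -/xi wx.
  have : V (xi + s) <= V xi + zeta xi * s + ((derive1 g z)^-1 * K + eta) / 2 * s ^+ 2.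
    by near: s.
  by rewrite -/z; lra.
have qf i : quad (hessian w x) (delta_mx 0 i - e 0 i *: e) <=
    z / r0 * enorm (delta_mx 0 i - e 0 i *: e) ^+ 2.
  set d := delta_mx 0 i - _.
  have dy : dotp d y = 0.
    rewrite /d dotpBZ dotp_delta {1}yE mxE.
    have -> : dotp e y = enorm y.
      have -> : dotp e y = dotp e (enorm y *: e) by rewrite -yE.
      by rewrite dotpZr dotpp e1 expr1n mulr1.
    by ring.
  have step eta : 0 < eta ->
      quad (hessian w x) d <= (z + eta) / r0 * enorm d ^+ 2.
    move=> eta0; apply: (@quad_hessian_le _ _ _ _ _ 0 _ w2).
    pose k := enorm d ^+ 2 / (2 * enorm y).
    have k0 : 0 <= k by rewrite divr_ge0 ?sqr_ge0// mulr_ge0// ltW.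
    have kc : k * s ^+ 2 @[s --> (0 : R)] --> (0 : R).
      have : k * s ^+ 2 @[s --> (0 : R)] --> k * 0 ^+ 2.
        by apply: cvgM; [exact: cvg_cst|exact: exprn_continuous].
      by rewrite expr0n mulr0.
    have ba := barrier_above (Vd xi) eta0.
    have {}ba := kc _ ba.
    near=> s; apply: (le_trans (wline s d)).
    have Vm t1 t2 : t1 <= t2 -> V t1 <= V t2.
      by move=> t12; apply: (is_derive_homo t12 (fun t _ => Vd t)) => t _.
    have s2 : 0 <= s ^+ 2 by exact: sqr_ge0.
    apply: (@le_trans _ _ (b + V (xi + k * s ^+ 2))).
      rewrite lerD2l; apply: Vm; rewrite /xi addrAC lerD2r.
      exact: enorm_line_perp.
    have : V (xi + k * s ^+ 2) <= V xi + (zeta xi + eta) * (k * s ^+ 2).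
      have : 0 <= k * s ^+ 2 -> V (xi + k * s ^+ 2) <= V xi + (zeta xi + eta) * (k * s ^+ 2).
        by near: s.
      by apply; rewrite mulr_ge0.
    have kle : k <= enorm d ^+ 2 / r0 / 2.
      rewrite /k invfM mulrA mulrAC ler_wpM2r// ler_wpM2l ?sqr_ge0//.
      by rewrite lef_pV2.
    rewrite wx -/z mul0r addr0 => HV.
    have : (z + eta) * (k * s ^+ 2) <= (z + eta) / r0 * enorm d ^+ 2 / 2 * s ^+ 2.
      rewrite mulrA ler_wpM2r//.
      rewrite (_ : _ / 2 = (z + eta) * (enorm d ^+ 2 / r0 / 2)); last by ring.
      by rewrite ler_wpM2l//; lra.
    by lra.
  apply/ler_addgt0Pr => eta eta0.
  have c0 : 0 <= enorm d ^+ 2 / r0 by rewrite divr_ge0 ?sqr_ge0// ltW.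
  pose eta' := eta / (enorm d ^+ 2 / r0 + 1).
  have eta'0 : 0 < eta' by rewrite divr_gt0//; lra.
  have := step eta' eta'0.
  have : eta' * (enorm d ^+ 2 / r0) <= eta.
    have : eta' * (enorm d ^+ 2 / r0 + 1) = eta by rewrite divfK// gt_eqF//; lra.
    by rewrite mulrDr mulr1; lra.
  rewrite mulrDl mulrDl [eta' / r0 * _]mulrAC -mulrA; lra.
have trE : \tr (hessian w x) - quad (hessian w x) e <= z / r0 * (N%:R - 1).
  rewrite -sum_quad_perp// -(sum_sqr_enorm_perp e1) mulr_sumr.
  by apply: ler_sum => i _.
have a2 := diff0 z z0.
have a2z : diffusivity g z * z = W xi by rewrite diffusivityM// gW.
have : diffusivity g z * (\tr (hessian w x) - quad (hessian w x) e) <=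
    (N%:R - 1) / r0 * W xi.
  apply: (le_trans (ler_wpM2l a2 trE)).
  by rewrite -a2z le_eqVlt; apply/orP; left; apply/eqP; ring.
by move: qe; lra.
Unshelve. all: by end_near. Qed.

End comparison.

Section balls.
Context {R : realType} {N : nat}.
Notation E := 'rV[R]_N.

Lemma norm_le_enorm (x : E) : `|x| <= enorm x.
Proof.
have -> : `|x| = mx_norm x by [].
have [->|/mx_norm_neq0[[i j] ->]] := eqVneq (mx_norm x) 0; first exact: enorm_ge0.
by rewrite (ord1 i); exact: coord_le_enorm.
Qed.

Lemma continuous_dist (a : E) : continuous (fun x : E => enorm (x - a)).
Proof.
move=> x; apply: (@continuous_comp _ _ _ (fun x : E => x - a) (@enorm R N)).
  exact: (@cvgB _ _ _ (nbhs x) _ id (cst a) x a (@cvg_id _ (nbhs x)) (cvg_cst a)).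
exact: continuous_enorm.
Qed.

Lemma compact_ball (a : E) (r : R) : compact [set x | enorm (x - a) <= r].
Proof.
apply: bounded_closed_compact.
  exists (r + `|a|); split; first exact: num_real.
  move=> M rM x /= xr; apply: le_trans (ltW rM).
  rewrite -[x](subrK a) (le_trans (ler_normD _ _))// lerD2r.
  exact: le_trans (norm_le_enorm _) xr.
apply: (@preimage_closed _ _ (fun x : E => enorm (x - a)) [set y | y <= r]).
  by move=> x _; exact: continuous_dist.
exact: closed_le.
Qed.

End balls.

Section radial_comparison.
Context {R : realType} {N : nat}.
Notation E := 'rV[R]_N.

(** The barrier stays above the solution: at the first time of contact the time
    derivatives are ordered by [derive_ge0_left_max], the diffusion terms by
    [touching_divergence], and this contradicts the strict differential
    inequality.  Since the gradient of the solution equals the one of the barrier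
    at the contact point, no bound on the gradient of the solution enters. *)
Lemma radial_comparison (g f : R -> R) (u : E -> R -> R) (a : E)
    (ta tb r0 M xi1 : R) (W zeta V B dB rho drho : R -> R) :
  (0 < N)%N -> regular_flux g -> bounded_solution g f u -> 0 <= ta ->
  (forall t : R, is_derive t (1 : R) B (dB t)) ->
  (forall t : R, is_derive t (1 : R) rho (drho t)) ->
  0 < r0 -> (forall t : R, ta <= t <= tb -> r0 <= rho t) ->
  (forall s : R, is_derive s (1 : R) V (zeta s)) ->
  (forall s : R, g (zeta s) = W s) ->
  (forall s : R, 0 <= zeta s) -> (forall s : R, s <= 0 -> zeta s = 0) ->
  (forall x (t : R), ta <= t <= tb -> u x t <= M) ->
  (forall t : R, ta <= t <= tb -> M < B t + V xi1) ->
  (forall t xi : R, ta < t <= tb -> xi <= xi1 -> exists2 K : R, slope_le W xi K &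
    K + (N%:R - 1) / r0 * W xi + f (B t + V xi) < dB t - drho t * zeta xi) ->
  (forall x, u x ta < B ta + V (enorm (x - a) - rho ta)) ->
  forall x (t : R), ta <= t <= tb -> u x t < B t + V (enorm (x - a) - rho t).
Proof.
move=> N0 rg su ta0 Bd rhod r00 r0rho Vd gW zeta0 zetaN uM MB strict init.
pose v (p : E * R) := B p.2 + V (enorm (p.1 - a) - rho p.2).
pose D (p : E * R) := u p.1 p.2 - v p.
have BC : continuous B by move=> t; exact: is_derive_continuous (Bd t).
have rhoC : continuous rho by move=> t; exact: is_derive_continuous (rhod t).
have VC : continuous V by move=> t; exact: is_derive_continuous (Vd t).
have vC : continuous v.
  move=> p; apply: cvgD.
    by apply: (@continuous_comp _ _ _ snd B); [exact: cvg_snd|exact: BC].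
  apply: (@continuous_comp _ _ _ (fun p : E * R => enorm (p.1 - a) - rho p.2) V);
    last exact: VC.
  apply: cvgB.
    apply: (@continuous_comp _ _ _ fst (fun x : E => enorm (x - a))).
      exact: cvg_fst.
    exact: continuous_dist.
  by apply: (@continuous_comp _ _ _ snd rho); [exact: cvg_snd|exact: rhoC].
have Vm t1 t2 : t1 <= t2 -> V t1 <= V t2.
  by move=> t12; apply: (is_derive_homo t12 (fun t _ => Vd t)) => t _.
move=> x1 t1 t1ab; rewrite ltNge; apply/negP => x1t1.
have tab : ta <= tb by move: t1ab => /andP[]; exact: le_trans.
have [tm _ rhoM] := EVT_max tab (continuous_subspaceT rhoC).
pose K := [set p : E * R | enorm (p.1 - a) <= xi1 + rho tm /\ ta <= p.2 <= tb].
have KC : compact K.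
  have := compact_setX (@compact_ball R N a (xi1 + rho tm)) (@segment_compact R ta tb).
  by congr compact; apply/seteqP; split => p [p1 p2]; split; rewrite /= in_itv/= in p2 *.
pose S := K `&` [set p | 0 <= D p].
have contact x t : ta <= t <= tb -> 0 <= D (x, t) -> S (x, t).
  move=> tt xt; split => //; split => //=.
  rewrite leNgt; apply/negP => xr.
  have /uM := tt => /(_ x) ux; have := MB t tt.
  have : V xi1 <= V (enorm (x - a) - rho t).
    apply: Vm; rewrite lerBrDr (le_trans _ (ltW xr))// lerD2l; apply: rhoM.
    by rewrite in_itv.
  by move: xt; rewrite /D /v /=; lra.
have DC p : K p -> D @ within K (nbhs p) --> D p.
  move=> Kp; apply: cvgB; last first.
    by apply: cvg_trans (vC p); apply: cvg_app; exact: cvg_within.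
  have := (subspace_continuousP _ _).1 (sol_cont su) p.
  move=> /(_ (le_trans ta0 (andP Kp.2).1)) H; apply: cvg_trans H; apply: cvg_app.
  move=> Q HQ; apply: (@filterS _ (nbhs p) (nbhs_filter p)) HQ => q Hq [_ /andP[tq _]].
  by apply: Hq; exact: le_trans tq.
have SC : compact S.
  apply: (subclosed_compact _ KC); last by move=> p [].
  have Kcl : closed K by apply: compact_closed => //; exact: norm_hausdorff.
  move=> p clp; have Kp : K p by apply: Kcl => B0 /clp[q [[Kq _] Bq]]; exists q.
  split => //=; rewrite leNgt; apply/negP => Dp.
  have /clp[q [[Kq /= Dq] H]] : nbhs p [set q | K q -> D q < 0].
    exact: (cvgr_lt _ (DC p Kp) 0 Dp).
  by have := H Kq; rewrite ltNge Dq.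
have S0 : S !=set0 by exists (x1, t1); apply: contact => //; rewrite /D /v/= subr_ge0.
have sndC : {within S, continuous (@snd E R)}.
  by apply: continuous_subspaceT => p; exact: cvg_snd.
have [[xs ts]] := compact_EVT_min S0 SC sndC.
rewrite inE => -[[/= _ tsab] Ds] tmin.
have below x t : ta <= t < ts -> D (x, t) < 0.
  move=> /andP[tat tts]; rewrite ltNge; apply/negP => Dn.
  have tt : ta <= t <= tb by rewrite tat/=; case/andP: tsab => _; exact/le_trans/ltW.
  have := tmin (x, t); rewrite inE => /(_ (contact _ _ tt Dn)).
  by rewrite /= leNgt tts.
have tats : ta < ts.
  rewrite lt_neqAle (andP tsab).1 andbT; apply/eqP => tsE.
  by have := init xs; move: Ds; rewrite -tsE /D /v /=; lra.
have ts0 : 0 < ts by exact: le_lt_trans tats.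
have Dd x : is_derive ts (1 : R) (fun t => D (x, t))
    (derive1 (u x) ts - (dB ts - drho ts * zeta (enorm (x - a) - rho ts))).
  have rd : is_derive ts (1 : R) (fun t => enorm (x - a) - rho t) (- drho ts).
    have := is_deriveBf (is_derive_cst (enorm (x - a)) ts (1 : R)) (rhod ts).
    by rewrite sub0r.
  have Vr := @is_derive_comp _ V (fun t => enorm (x - a) - rho t) ts _ _ (Vd _) rd.
  have := is_deriveBf (is_derive1P (@sol_dt _ _ _ _ _ su x ts ts0)) (is_deriveDf (Bd ts) Vr).
  by rewrite mulrN mulrC.
have Dle x : D (x, ts) <= 0.
  rewrite leNgt; apply/negP => Dx.
  have Dn : \forall t \near ts, 0 < D (x, t).
    by apply: (cvgr_gt _ (is_derive_continuous (Dd x))).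
  have [e /= e0 H] := (nbhs_ballP _ _).1 (filterI Dn (lt_nbhsr tats)).
  have [] := H (ts - e / 2); first by rewrite /ball/= ltr_distlC; lra.
  move=> /= + tt; apply/negP; rewrite -leNgt ltW//; apply: below.
  by rewrite ltW//=; lra.
have Ds0 : D (xs, ts) = 0 by apply/eqP; rewrite eq_le Dle.
have ut : dB ts - drho ts * zeta (enorm (xs - a) - rho ts) <= derive1 (u xs) ts.
  rewrite -subr_ge0; apply: (derive_ge0_left_max (Dd xs)).
  near=> t => tts; rewrite Ds0.
  move: tts; rewrite le_eqVlt => /predU1P[->|tts]; first by rewrite Ds0.
  rewrite ltW//; apply: below; rewrite tts andbT.
  by near: t; have := lt_nbhsr tats; apply: filterS => y /= /ltW.
pose xi := enorm (xs - a) - rho ts.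
have xixi1 : xi <= xi1.
  rewrite leNgt; apply/negP => xix.
  have := MB ts tsab; have := uM xs ts tsab; have := Vm _ _ (ltW xix).
  by move: Ds; rewrite /D /v /= -/xi; lra.
have tsab' : ta < ts <= tb by rewrite tats; case/andP: tsab.
have [k Wk] := strict ts xi tsab' xixi1.
have [||e [z [e1 z0 gz]]] := @touching_divergence R N g W zeta V (u ^~ ts) a xs
  (B ts) (rho ts) r0 k N0 rg (sol_C2 su ts0) r00 (r0rho _ tsab) Vd gW zeta0 zetaN Wk.
- by move=> y; have := Dle y; rewrite /D /v /=; lra.
- by move: Ds0; rewrite /D /v /=; lra.
have := sol_eq su ts0 z0 e1 gz.
have -> : u xs ts = B ts + V xi by move: Ds0; rewrite /D /v /= -/xi; lra.
by rewrite -/xi in ut *; lra.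
Unshelve. all: by end_near. Qed.

End radial_comparison.

(** * Finite speed of propagation *)

Section profile.
Context {R : realType}.
Implicit Types (g W zeta V : R -> R).

(** A barrier profile is prescribed by its flux [W], which stays the same when the
    flux law [g] is regularized. *)
Record profile g W zeta V : Prop := Profile {
  profile_flux : forall x, g (zeta x) = W x ;
  profile_ge0 : forall x, 0 <= zeta x ;
  profile_eq0 : forall x, x <= 0 -> zeta x = 0 ;
  profile_derive : forall x : R, is_derive x (1 : R) V (zeta x) ;
  profile_V0 : forall x, x <= 0 -> V x = 0 }.

Definition ramp (s : R) : R := Num.min (Num.max s 0) 1.

Lemma ramp_le0 s : s <= 0 -> ramp s = 0.
Proof. by move=> s0; rewrite /ramp max_r// min_l. Qed.

Lemma ramp_ge1 s : 1 <= s -> ramp s = 1.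
Proof. by move=> s1; rewrite /ramp max_l ?min_r//; lra. Qed.

Lemma ramp01 s : 0 <= ramp s <= 1.
Proof. by rewrite /ramp ge_min lexx orbT le_min le_max lexx orbT/= ler01. Qed.

Lemma ramp_slope s s' : s <= s' -> 0 <= ramp s' - ramp s <= s' - s.
Proof.
have rE x : [\/ x <= 0 /\ ramp x = 0, (0 <= x <= 1) /\ ramp x = x | 1 <= x /\ ramp x = 1].
  have /orP[x0|x0] := le_total x 0; first by apply: Or31; rewrite ramp_le0.
  have /orP[x1|x1] := le_total x 1; last by apply: Or33; rewrite ramp_ge1.
  by apply: Or32; rewrite /ramp max_l// min_l// x0.
by move=> ss'; case: (rE s) => -[s1 ->]; case: (rE s') => -[s2 ->]; lra.
Qed.

Lemma ramp_continuous : continuous ramp.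
Proof.
move=> s; apply/cvgrPdist_lt => e e0; near=> y.
apply: (@le_lt_trans _ _ `|s - y|).
  have [ys|/ltW ys] := leP y s.
    by have /andP[h1 h2] := ramp_slope ys; rewrite !ger0_norm ?subr_ge0//; lra.
  have /andP[h1 h2] := ramp_slope ys.
  by rewrite (distrC (ramp s)) (distrC s) !ger0_norm ?subr_ge0//; lra.
by near: y; apply: cvgr_dist_lt; [exact: cvg_id|].
Unshelve. all: by end_near. Qed.

Lemma flux_law0 g : flux_law g -> g 0 = 0.
Proof. by move=> [/(_ 0) + _ _ _]; rewrite oppr0; lra. Qed.

Lemma flux_mono g : flux_law g -> {mono g : x y / x <= y}.
Proof. by move=> [_ + _ _]; exact: le_mono. Qed.

Lemma flux_mono_lt g : flux_law g -> {mono g : x y / x < y}.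
Proof. by move=> /flux_mono; exact: leW_mono. Qed.

Lemma profile_exists g W : flux_law g -> continuous W ->
  (forall x, 0 <= W x) -> (forall x, x <= 0 -> W x = 0) ->
  exists zeta V, profile g W zeta V.
Proof.
move=> gl WC W0 Wn.
have [h [gh hg hC hm]] := increasing_inverse (flux_incr gl) (flux_surj gl).
have g0 := flux_law0 gl.
have [F FD] := @antiderivative R (h \o W) (fun x => continuous_comp (WC x) (hC (W x))).
have zn x : x <= 0 -> h (W x) = 0 by move=> x0; rewrite Wn// -g0 gh.
exists (h \o W), (fun x => F x - F 0); split => //.
- by move=> x /=; rewrite hg.
- by move=> x /=; rewrite -(flux_mono gl) hg g0.
- move=> x; have := is_deriveBf (FD x) (is_derive_cst (F 0) x (1 : R)).
  by rewrite subr0.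
- move=> x x0; have D (t : R) : x <= t <= 0 -> is_derive t (1 : R) F 0.
    by move=> /andP[_ t0]; have := FD t; rewrite /= zn.
  have := @is_derive_unique_eq _ F (fun=> 0) (fun=> 0) x 0 x0 D.
  rewrite subrr => H; apply/eqP; rewrite -oppr_eq0 opprB; apply/eqP; apply: H.
Qed.

Lemma profile_homo g W zeta V : profile g W zeta V ->
  forall x y, x <= y -> V x <= V y.
Proof.
by move=> p x y xy; apply: (is_derive_homo xy (fun t _ => profile_derive p t)) => t _;
  exact: (profile_ge0 p).
Qed.

Lemma profile_V_ge0 g W zeta V : profile g W zeta V -> forall x, 0 <= V x.
Proof.
move=> p x; case: (leP x 0) => [x0|/ltW x0]; first by rewrite (profile_V0 p).
by rewrite -(profile_V0 p (lexx 0)) (profile_homo p).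
Qed.

End profile.

Section finite_speed.
Context {R : realType} {N : nat}.
Notation E := 'rV[R]_N.

Lemma small_flux (g : R -> R) (e : R) : flux_law g -> 0 < e ->
  exists2 z, 0 < z & g z < e.
Proof.
move=> gl e0; have [z gz] := flux_surj gl (e / 2).
by exists z; first (by rewrite -(flux_mono_lt gl) (flux_law0 gl) gz; lra); lra.
Qed.

(** Above the level [B] of the spatially constant supersolution a ramp of slope
    [zeta1] is added that moves inwards with a speed so large that it absorbs the
    reaction term; the flux of the ramp is small.  Hence an upper bound on a ball
    is transported by the ordinary differential equation on a slowly shrinking
    ball. *)
Lemma finite_speed_comparison (g f : R -> R) (u : E -> R -> R) (a : E)
    (ta tb M b0 L kap zeta1 rho0 : R) (B dB : R -> R) :
  let xi1 := 1 + (M - b0 + 1) / zeta1 in let C := L * xi1 in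
  (0 < N)%N -> regular_flux g -> bounded_solution g f u -> 0 <= ta ->
  0 <= L -> (forall s s' : R, `|f s - f s'| <= L * `|s - s'|) ->
  0 < zeta1 -> N%:R * g zeta1 < kap -> b0 <= M ->
  (forall t : R, is_derive t (1 : R) B (dB t)) ->
  (forall t : R, ta <= t <= tb -> f (B t) + kap <= dB t) ->
  (forall t : R, ta <= t <= tb -> b0 <= B t) ->
  (forall x (t : R), ta <= t <= tb -> u x t <= M) ->
  (forall x, enorm (x - a) <= rho0 + xi1 -> u x ta < B ta) ->
  (forall t : R, ta <= t <= tb -> 1 <= rho0 - C * (t - ta)) ->
  forall x (t : R), ta <= t <= tb -> enorm (x - a) <= rho0 - C * (t - ta) ->
    u x t < B t.
Proof.
move=> xi1 C N0 rg su ta0 L0 fL z0 Ngz bM Bd Bsup b0B uM init rho1 x t tt xr.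
have gl := regular_flux_law rg; have g0 := flux_law0 gl.
have d0 : 0 < g zeta1 by rewrite -g0 (flux_mono_lt gl).
have xi11 : 1 <= xi1 by rewrite lerDl divr_ge0//; lra.
pose m := @ramp R.
pose W (s : R) := g zeta1 * m s.
have [||| zeta [V p]] := @profile_exists R g W gl.
- by move=> s; apply: cvgM; [exact: cvg_cst|exact: ramp_continuous].
- by move=> s; rewrite mulr_ge0 ?(ltW d0)//; case/andP: (ramp01 s).
- by move=> s s0; rewrite /W /m ramp_le0// mulr0.
have zm s s' : s <= s' -> zeta s <= zeta s'.
  move=> ss'; rewrite -(flux_mono gl) !(profile_flux p) ler_wpM2l ?(ltW d0)//.
  by have /andP[] := ramp_slope ss'; rewrite /m; lra.
have z1 s : 1 <= s -> zeta s = zeta1.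
  move=> s1; apply: (inc_inj (flux_mono gl)).
  by rewrite (profile_flux p) /W /m ramp_ge1// mulr1.
have VV := profile_derive p.
have Vle s : V s <= Num.max s 0 * zeta s.
  case: (leP s 0) => s0; first by rewrite (profile_V0 p)// mul0r.
  have [c /andP[c0 cs]] := mvt_open s0 (fun t _ => VV t).
  rewrite (profile_V0 p (lexx 0)) !subr0 => ->; rewrite mulrC; apply: ler_wpM2l; first exact: ltW.
  by apply: zm; exact: ltW.
have Vxi1 : M - b0 + 1 <= V xi1.
  have xi1E : zeta1 * (xi1 - 1) = M - b0 + 1.
    by rewrite /xi1; field; exact: lt0r_neq0.
  have V1 := profile_V_ge0 p 1.
  move: xi11; rewrite le_eqVlt => /predU1P[s1|s1].
    by move: xi1E V1; rewrite -s1 subrr mulr0 => <-.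
  have [c /andP[c1 _]] := mvt_open s1 (fun t _ => VV t).
  by rewrite (z1 c (ltW c1)) xi1E; lra.
pose rho (t : R) := rho0 - C * (t - ta).
have rhod (s : R) : is_derive s (1 : R) rho (- C).
  have := is_derive_affine s (rho0 + C * ta) (- C); congr is_derive.
  by apply/funext => y; rewrite /rho; ring.
have main := @radial_comparison R N g f u a ta tb 1 M xi1 W zeta V B dB rho (fun=> - C)
  N0 rg su ta0 Bd rhod ltr01 rho1 VV (profile_flux p) (profile_ge0 p) (profile_eq0 p) uM.
suff : u x t < B t + V (enorm (x - a) - rho t).
  by rewrite (profile_V0 p) ?addr0// subr_le0.
apply: main => //.
- by move=> s ss; have := b0B s ss; lra.
- move=> s xi ss xixi; exists (g zeta1).
    near=> r; rewrite -mulrBr mulrCA [X in _ <= X](_ : _ = g zeta1 * (r * r)); last by rewrite expr2.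
    rewrite ler_pM2l//.
    case: (leP 0 r) => r0.
      have := @ramp_slope _ xi (xi + r); rewrite lerDl => /(_ r0) /andP[_].
      by rewrite [xi + r]addrC addrK => H; rewrite ler_wpM2l.
    have := @ramp_slope _ (xi + r) xi; rewrite gerDl => /(_ (ltW r0)) /andP[_ H].
    by apply: ler_wnM2l; [exact: ltW|rewrite /m; lra].
  have ss' : ta <= s <= tb by case/andP: ss => /ltW -> ->.
  have := Bsup s ss'; rewrite divr1 mulNr opprK => Bs.
  have fB : f (B s + V xi) <= f (B s) + L * V xi.
    have := fL (B s + V xi) (B s); rewrite addrAC subrr add0r (ger0_norm (profile_V_ge0 p xi)).
    by rewrite ler_norml => /andP[_]; lra.
  have LV : L * V xi <= C * zeta xi.
    rewrite /C -mulrA ler_wpM2l// (le_trans (Vle xi))// ler_wpM2r ?(profile_ge0 p)//.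
    by rewrite ge_max xixi/=; lra.
  have Wle : (N%:R - 1) * W xi <= (N%:R - 1) * g zeta1.
    apply: ler_wpM2l; first by rewrite subr_ge0 ler1n.
    by rewrite /W /m ger_pMr//; case/andP: (ramp01 xi).
  by move: Ngz; rewrite -[N%:R](subrK 1) mulrDl mul1r; lra.
- move=> y; rewrite /rho subrr mulr0 subr0.
  case: (leP (enorm (y - a)) (rho0 + xi1)) => yr.
    by have := init y yr; have := profile_V_ge0 p (enorm (y - a) - rho0); lra.
  have tab : ta <= ta <= tb by rewrite lexx; case/andP: tt; exact: le_trans.
  have := b0B ta tab; have := uM y ta tab.
  have : V xi1 <= V (enorm (y - a) - rho0) by apply: (profile_homo p); lra.
  by lra.
Unshelve. all: by end_near. Qed.

(** The constant [1], raised by a small multiple of [exp ((L + 1) t)], is a strict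
    supersolution; the ball is taken so large that it still contains the given
    point after it has shrunk. *)
Lemma solution_le1 (g f : R -> R) (u : E -> R -> R) (L : R) :
  (0 < N)%N -> regular_flux g -> bounded_solution g f u ->
  0 <= L -> (forall s s' : R, `|f s - f s'| <= L * `|s - s'|) -> f 1 = 0 ->
  (forall x, u x 0 <= 1) -> forall x (t : R), 0 <= t -> u x t <= 1.
Proof.
move=> N0 rg su L0 fL f1 u1 x t t0.
have gl := regular_flux_law rg.
have [M0 uM0] := sol_bounded su t.
pose M := Num.max M0 1.
have uM y s : 0 <= s <= t -> u y s <= M.
  by move=> st; rewrite le_max (le_trans (ler_norm _))// uM0.
have M1 : 1 <= M by rewrite le_max lexx orbT.
pose ex := expR ((L + 1) * t).
have ex0 : 0 < ex by exact: expR_gt0.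
apply/ler_addgt0Pr => eta0 eta00.
pose eta := eta0 / ex; have etap : 0 < eta by rewrite divr_gt0.
have NP : (0 : R) < N%:R by rewrite ltr0n.
have [z1 z10 gz1] := small_flux gl (divr_gt0 etap NP).
have Ngz : N%:R * g z1 < eta by rewrite mulrC -ltr_pdivlMr.
pose B (s : R) := 1 + eta * expR ((L + 1) * s).
pose xi1 := 1 + (M - 1 + 1) / z1.
have Bd (s : R) : is_derive s (1 : R) B ((L + 1) * (eta * expR ((L + 1) * s))).
  have ed := @is_derive_comp R expR (fun s => (L + 1) * s) s _ _ (is_derive_expR _)
    (is_deriveZf (L + 1) (is_derive_id s (1 : R))).
  have := is_deriveDf (is_derive_cst (1 : R) s (1 : R)) (is_deriveZf eta ed).
  by rewrite add0r mulr1; congr is_derive; ring.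
have Bge (s : R) : 0 <= s -> 1 + eta <= B s.
  move=> s0; rewrite lerD2l ler_peMr// ?(ltW etap)// -expR0 ler_expR.
  by rewrite mulr_ge0// addr_ge0.
have := @finite_speed_comparison g f u x 0 t M 1 L eta z1 (1 + L * xi1 * t) B _
  N0 rg su (lexx 0) L0 fL z10 Ngz M1 Bd _ _ uM _ _ x t.
rewrite subrr enorm0 t0 lexx => H; apply: ltW; rewrite -/xi1 in H.
have -> : 1 + eta0 = B t by rewrite /B /eta -/ex divfK// gt_eqF.
have xi10 : 0 <= xi1 by rewrite addr_ge0// divr_ge0 ?(ltW z10)//; lra.
have Ct (s : R) : 0 <= s <= t -> 1 <= 1 + L * xi1 * t - L * xi1 * (s - 0).
  move=> /andP[s0 st]; rewrite subr0 -addrA lerDl -mulrBr mulr_ge0 ?mulr_ge0//.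
  by rewrite subr_ge0.
apply: H => //.
- move=> s /andP[s0 _]; have := fL (B s) 1; rewrite f1 subr0.
  have Bs := Bge s s0.
  rewrite [`|B s - 1|]ger0_norm; last by lra.
  have := ler_norm (f (B s)); rewrite /B [1 + _ - 1]addrAC subrr add0r => h1 h2.
  have : eta <= eta * expR ((L + 1) * s) by move: Bs; rewrite /B; lra.
  move: h1 h2; set X := eta * expR _ => h1 h2 h3.
  by rewrite [(L + 1) * X]mulrDl mul1r; lra.
- by move=> s /andP[s0 _]; have := Bge s s0; lra.
- by move=> y _; rewrite (le_lt_trans (u1 y))//; have := Bge 0 (lexx 0); lra.
- by have := Ct t; rewrite t0 lexx => /(_ isT); lra.
Qed.

End finite_speed.

(** * The travelling front *)

Section front.
Context {R : realType}.
Implicit Types (g f p Z : R -> R).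

Record bistable_law f (mu L : R) : Prop := BistableLaw {
  law_L0 : 0 <= L ;
  law_lip : forall s s', `|f s - f s'| <= L * `|s - s'| ;
  law_mu : -1 < mu < 1 ;
  law_N1 : f (-1) = 0 ;
  law_fmu : f mu = 0 ;
  law_1 : f 1 = 0 ;
  law_neg : forall s, -1 < s < mu -> f s < 0 ;
  law_pos : forall s, mu < s < 1 -> 0 < f s }.

Lemma bistable_bistable_law f mu : bistable f mu -> exists L, bistable_law f mu L.
Proof.
move=> [[k kf] fmu [f1 f2 f3] fn fp]; exists `|k|; split => // s s'.
have H := kf (s, s') (conj I I).
by rewrite (le_trans H)// ler_wpM2r// ler_norm.
Qed.

Lemma bistable_lawN f mu L : bistable_law f mu L ->
  bistable_law (fun s => - f (- s)) (- mu) L.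
Proof.
move=> [L0 fL fmu f1 f2 f3 fn fp]; split => //.
- by move=> s s'; rewrite -opprD normrN (le_trans (fL _ _))// -opprB normrN opprK addrC.
- by rewrite ltrNl opprK ltrNl; case/andP: fmu => -> ->.
- by rewrite opprK f3 oppr0.
- by rewrite opprK f2 oppr0.
- by rewrite f1 oppr0.
- by move=> s /andP[s1 s2]; rewrite oppr_lt0 fp//; apply/andP; split; lra.
- by move=> s /andP[s1 s2]; rewrite oppr_gt0 fn//; apply/andP; split; lra.
Qed.

Lemma law_continuous f mu L : bistable_law f mu L -> continuous f.
Proof.
move=> fl x; have L1 : 0 < L + 1 by have := law_L0 fl; lra.
apply/cvgrPdist_lt => e e0; near=> y.
apply: (le_lt_trans (law_lip fl x y)).
apply: (@le_lt_trans _ _ ((L + 1) * `|x - y|)).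
  by rewrite ler_wpM2r//; lra.
rewrite mulrC -ltr_pdivlMr//; near: y; apply/nbhs_ballP.
by exists (e / (L + 1)) => //=; rewrite divr_gt0.
Unshelve. all: by end_near. Qed.

(** The front as an increasing function: [p (x + c t)] solves the evolution
    equation, so that the state [1], on the right, advances when [c > 0].  As [p]
    is monotone, the limits at infinity amount to taking values near [-1] and [1]. *)
Record front_profile g f (mu c : R) p Z : Prop := FrontProfile {
  front_slope : forall x : R, is_derive x (1 : R) p (Z x) ;
  front_slope_cont : continuous Z ;
  front_slope_ge0 : forall x, 0 <= Z x ;
  front_ode : forall x : R, is_derive x (1 : R) (fun y => g (Z y)) (c * Z x - f (p x)) ;
  front_low : forall e, 0 < e -> exists x, p x < -1 + e ;
  front_high : forall e, 0 < e -> exists x, 1 - e < p x ;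
  front_range : forall x, -1 <= p x <= 1 ;
  front_at0 : p 0 = mu }.

Lemma front_front_profile phi f mu q c : flux_law (flux1 phi) ->
  front phi f mu q c ->
  front_profile (flux1 phi) f mu c (fun x => q (- x)) (fun x => - derive1 q (- x)).
Proof.
move=> gl [[qd qC] qf qe q0 qm qp qmu].
have pD (x : R) : is_derive x (1 : R) (fun x => q (- x)) (- derive1 q (- x)).
  have := is_derive_comp (is_derive1P (qd (- x))) (is_deriveNf (is_derive_id x (1 : R))).
  by rewrite mulrN1.
have hom (x y : R) : x <= y -> q (- x) <= q (- y).
  move=> xy; apply: (is_derive_homo xy (fun t _ => pD t)) => t _.
  by rewrite oppr_ge0.
have low e : 0 < e -> exists x, forall y, y <= x -> q (- y) < -1 + e.
  move=> e0; have [M [_ HM]] : \forall x \near +oo, q x < -1 + e.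
    by apply: (cvgr_lt _ qp); lra.
  by exists (- M - 1) => y yM; apply: HM; lra.
have high e : 0 < e -> exists x, forall y, x <= y -> 1 - e < q (- y).
  move=> e0; have [M [_ HM]] : \forall x \near -oo, 1 - e < q x.
    by apply: (cvgr_gt _ qm); lra.
  by exists (- M + 1) => y yM; apply: HM; lra.
split => //.
- move=> x; apply: cvgN; apply: (@continuous_comp _ _ _ -%R (derive1 q)).
    exact: opp_continuous.
  exact: qC.
- by move=> x; rewrite oppr_ge0.
- move=> x; have D := is_derive1P (qf (- x)).
  have := is_deriveNf (is_derive_comp D (is_deriveNf (is_derive_id x (1 : R)))).
  rewrite mulrN1 opprK.
  have -> : derive1 (flux1 phi \o derive1 q) (- x) =
      c * - derive1 q (- x) - f (q (- x)) by have := qe (- x); lra.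
  by congr is_derive; apply/funext => y; rewrite (flux_odd gl).
- by move=> e /low[x H]; exists x; exact: H.
- by move=> e /high[x H]; exists x; exact: H.
- move=> x; apply/andP; split; rewrite leNgt; apply/negP => H.
    have [M [_ HM]] : \forall y \near +oo, (q (- x) - 1) / 2 < q y.
      by apply: (cvgr_gt _ qp); lra.
    pose y := Num.max (M + 1) (- x).
    have yM : M < y by rewrite lt_max; apply/orP; left; lra.
    have yx : - y <= x by rewrite lerNl le_max lexx orbT.
    by have := HM y yM; have := hom _ _ yx; rewrite opprK; lra.
  have [M [_ HM]] : \forall y \near -oo, q y < (q (- x) + 1) / 2.
    by apply: (cvgr_lt _ qm); lra.
  pose y := Num.min (M - 1) (- x).
  have yM : y < M by rewrite gt_min; apply/orP; left; lra.
  have yx : x <= - y by rewrite lerNr ge_min lexx orbT.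
  by have := HM y yM; have := hom _ _ yx; rewrite opprK; lra.
- by rewrite oppr0.
Qed.

(** The reflection of the values exchanges the two limit states, so that the
    roles of the advancing and the receding state are exchanged as well. *)
Lemma front_profileN g f mu c p Z : flux_law g -> front_profile g f mu c p Z ->
  front_profile g (fun s => - f (- s)) (- mu) (- c) (fun x => - p (- x))
    (fun x => Z (- x)).
Proof.
move=> gl [pD ZC Z0 pE lo hi rg p0]; split.
- move=> x; have := is_deriveNf (is_derive_comp (pD (- x)) (is_deriveNf (is_derive_id x (1 : R)))).
  by rewrite mulrN1 opprK.
- move=> x; apply: (@continuous_comp _ _ _ -%R Z); first exact: opp_continuous.
  exact: ZC.
- by move=> x; exact: Z0.
- move=> x; have := is_derive_comp (pE (- x)) (is_deriveNf (is_derive_id x (1 : R))).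
  by rewrite mulrN1 !opprK opprB mulNr addrC.
- by move=> e /hi[x H]; exists (- x); rewrite opprK; lra.
- by move=> e /lo[x H]; exists (- x); rewrite opprK; lra.
- by move=> x; have /andP[] := rg (- x) => ? ?; apply/andP; split; lra.
- by rewrite oppr0 p0.
Qed.

Section front_theory.
Context (g f p Z : R -> R) (mu L c : R).
Context (gl : flux_law g) (fl : bistable_law f mu L) (fp : front_profile g f mu c p Z).

Let pD (x : R) : is_derive x (1 : R) p (Z x). Proof. exact: front_slope fp x. Qed.

Lemma front_homo x y : x <= y -> p x <= p y.
Proof.
by move=> xy; apply: (is_derive_homo xy (fun t _ => pD t)) => t _;
  exact: (front_slope_ge0 fp).
Qed.

Lemma front_cont : continuous p.
Proof. by move=> x; exact: is_derive_continuous (pD x). Qed.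

Lemma front_low_near e : 0 < e -> exists x, forall y, y <= x -> p y < -1 + e.
Proof.
move=> /(front_low fp)[x px]; exists x => y /front_homo; lra.
Qed.

Lemma front_high_near e : 0 < e -> exists x, forall y, x <= y -> 1 - e < p y.
Proof.
move=> /(front_high fp)[x px]; exists x => y /front_homo; lra.
Qed.

Lemma front_flat_left e a : 0 < e -> exists2 x, x <= a & Z x < e /\ p x < -1 + e.
Proof.
move=> e0; have [x0 H] := front_low_near e0.
pose y := Num.min x0 a.
have y1 : y - 1 < y by lra.
have [x /andP[x1 x2]] := mvt_open y1 (fun t _ => pD t).
have yx0 : y <= x0 by rewrite ge_min lexx.
have ya : y <= a by rewrite ge_min lexx orbT.
have := H y yx0; have := H x; have /andP[h1 _] := front_range fp (y - 1).
by exists x; [lra|split; [nra|apply: H; lra]].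
Qed.

Lemma front_flat_right e a : 0 < e -> exists2 x, a <= x & Z x < e /\ 1 - e < p x.
Proof.
move=> e0; have [x0 H] := front_high_near e0.
pose y := Num.max x0 a.
have y1 : y < y + 1 by lra.
have [x /andP[x1 x2]] := mvt_open y1 (fun t _ => pD t).
have yx0 : x0 <= y by rewrite le_max lexx.
have ya : a <= y by rewrite le_max lexx orbT.
have := H y yx0; have := H x; have /andP[_ h1] := front_range fp (y + 1).
by exists x; [lra|split; [nra|apply: H; lra]].
Qed.

(** The first integral obtained by multiplying the front equation with the slope:
    [H] is an antiderivative of the inverse of the flux, so that [H (g Z)] plays
    the role of the kinetic energy. *)
Lemma front_energy : exists F E : R -> R,
  [/\ forall x : R, is_derive x (1 : R) F (f x),
      forall x : R, is_derive x (1 : R) E (c * Z x ^+ 2) &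
      forall x, 0 <= E x - F (p x) <= Z x * g (Z x)].
Proof.
have [h [gh hg hC hm]] := increasing_inverse (flux_incr gl) (flux_surj gl).
have [F FD] := antiderivative (law_continuous fl).
have [H HD] := antiderivative hC.
exists F, (fun x => H (g (Z x)) - H 0 + F (p x)); split => //.
  move=> x; have D1 := is_derive_comp (HD (g (Z x))) (front_ode fp x).
  have D2 := is_derive_comp (FD (p x)) (pD x).
  have := is_deriveDf (is_deriveBf D1 (is_derive_cst (H 0) x (1 : R))) D2.
  by rewrite gh expr2; congr is_derive; ring.
move=> x; rewrite addrK; have Z0 := front_slope_ge0 fp x.
have g0 := flux_law0 gl.
move: Z0; rewrite le_eqVlt => /predU1P[<-|Z0]; first by rewrite g0 subrr mulr0 lexx.
have gZ0 : 0 < g (Z x) by rewrite -g0 (flux_mono_lt gl).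
have [w /andP[w1 w2] ->] := mvt_open gZ0 (fun t _ => HD t).
have hmono : {mono h : x y / x <= y} by exact: le_mono.
rewrite subr0 mulr_ge0 ?(ltW gZ0)//=; last by rewrite -(gh 0) g0 hmono ltW.
by rewrite ler_wpM2r ?(ltW gZ0)// -[leRHS]gh hmono ltW.
Qed.

Let small_energy e : 0 < e -> exists2 d, 0 < d & forall z, 0 <= z < d -> z * g z < e.
Proof.
move=> e0; have zgC : {for (0 : R), continuous (fun z : R => z * g z)}.
  by apply: cvgM; [exact: cvg_id|exact: (flux_cont gl)].
have : \forall z \near (0 : R), z * g z < e.
  by apply: (cvgr_lt _ zgC); rewrite mul0r.
move=> /nbhs_ballP[d /= d0 H]; exists d => // z /andP[z0 zd]; apply: H.
by rewrite /ball/= sub0r normrN ger0_norm.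
Qed.

Let energy_left F E d a : (forall x : R, is_derive x (1 : R) F (f x)) ->
  (forall x, 0 <= E x - F (p x) <= Z x * g (Z x)) -> 0 < d ->
  exists2 x, x <= a & `|E x - F (-1)| < d.
Proof.
move=> FD EF d0; have d2 : 0 < d / 2 by lra.
have [z z0 Hz] := small_energy d2.
have FC := is_derive_continuous (FD (-1)).
have /nbhs_ballP[r /= r0 Hr] : \forall s \near (-1 : R), `|F (-1) - F s| < d / 2.
  exact: (cvgrPdist_lt _ _).1 FC _ d2.
have zr0 : 0 < Num.min z r by rewrite lt_min z0.
have [x xa [Zx px]] := front_flat_left a zr0.
exists x => //; move: Zx; rewrite lt_min => /andP[Zz _].
have /andP[p1 _] := front_range fp x.
have : ball (-1 : R) r (p x).
  rewrite /ball/= ltr_distlC; apply/andP; split; first by lra.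
  by rewrite (lt_le_trans px)// lerD2l ge_min lexx orbT.
move=> /Hr; rewrite ltr_distlC => /andP[h1 h2].
have := Hz (Z x); rewrite (front_slope_ge0 fp) Zz => /(_ isT) h3.
by have /andP[h4 h5] := EF x; rewrite ltr_norml; apply/andP; split; lra.
Qed.

Let energy_right F E d a : (forall x : R, is_derive x (1 : R) F (f x)) ->
  (forall x, 0 <= E x - F (p x) <= Z x * g (Z x)) -> 0 < d ->
  exists2 x, a <= x & `|E x - F 1| < d.
Proof.
move=> FD EF d0; have d2 : 0 < d / 2 by lra.
have [z z0 Hz] := small_energy d2.
have FC := is_derive_continuous (FD 1).
have /nbhs_ballP[r /= r0 Hr] : \forall s \near (1 : R), `|F 1 - F s| < d / 2.
  exact: (cvgrPdist_lt _ _).1 FC _ d2.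
have zr0 : 0 < Num.min z r by rewrite lt_min z0.
have [x xa [Zx px]] := front_flat_right a zr0.
exists x => //; move: Zx; rewrite lt_min => /andP[Zz _].
have /andP[_ p1] := front_range fp x.
have : ball (1 : R) r (p x).
  rewrite /ball/= ltr_distlC; apply/andP; split; last by lra.
  by rewrite (le_lt_trans _ px)// lerD2l lerN2 ge_min lexx orbT.
move=> /Hr; rewrite ltr_distlC => /andP[h1 h2].
have := Hz (Z x); rewrite (front_slope_ge0 fp) Zz => /(_ isT) h3.
by have /andP[h4 h5] := EF x; rewrite ltr_norml; apply/andP; split; lra.
Qed.

(** The energy is monotone in the direction given by the sign of [c], and it runs
    from [F (-1)] to [F 1]. *)
Lemma front_speed_gt0 (F : R -> R) : (forall x : R, is_derive x (1 : R) F (f x)) ->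
  F (-1) < F 1 -> 0 < c.
Proof.
move=> FD Flt; rewrite ltNge; apply/negP => c0.
have [F' [E [FD' ED EF]]] := front_energy.
have FF : F' 1 - F' (-1) = F 1 - F (-1).
  by apply: (@is_derive_unique_eq _ F' F f) => //; lra.
have d0 : 0 < (F 1 - F (-1)) / 2 by lra.
have [x _ Ex] := energy_left 0 FD' EF d0.
have [y xy Ey] := energy_right x FD' EF d0.
have : - E x <= - E y.
  apply: (@is_derive_homo _ (fun x => - E x) (fun x => - (c * Z x ^+ 2)) _ _ xy).
  by move=> t _; rewrite oppr_ge0 mulr_le0_ge0// sqr_ge0.
by move: Ex Ey; rewrite !ltr_norml => /andP[h1 h2] /andP[h3 h4]; lra.
Qed.

(** At a zero of the slope the flux is minimal, hence [f] vanishes and the value is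
    [mu].  The energy would be [F mu] there, which is less than its limit
    [F (-1)] at [-oo]. *)
Lemma front_slope_gt0 x : 0 < c -> -1 < p x < 1 -> 0 < Z x.
Proof.
move=> c0 px; rewrite lt_neqAle (front_slope_ge0 fp) andbT; apply/eqP => Z0.
have fpx : f (p x) = 0.
  have g0 := flux_law0 gl.
  have D : is_derive x (1 : R) (fun y => - g (Z y)) (- (c * Z x - f (p x))).
    exact: is_deriveNf (front_ode fp x).
  have := derive_eq0_max D _; rewrite -Z0 mulr0 sub0r opprK; apply.
  near=> y; rewrite lerN2 (flux_mono gl); exact: (front_slope_ge0 fp).
have pmu : p x = mu.
  case: (ltgtP (p x) mu) => // h; case/andP: px => p1 p2.
    by have := law_neg fl (s := p x); rewrite p1 h fpx ltxx => /(_ isT).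
  by have := law_pos fl (s := p x); rewrite p2 h fpx ltxx => /(_ isT).
have [F [E [FD ED EF]]] := front_energy.
have /andP[mu1 mu2] := law_mu fl.
have Fmu : - F (-1) < - F mu.
  apply: (@is_derive_homo_lt _ (fun x => - F x) (fun x => - f x) _ _ mu1).
  by move=> t tmu; rewrite oppr_gt0 (law_neg fl).
have d0 : 0 < F (-1) - F mu by lra.
have [y yx Ey] := energy_left x FD EF d0.
have : E y <= E x.
  apply: (is_derive_homo yx (fun t _ => ED t)) => t _.
  by rewrite mulr_ge0 ?sqr_ge0// ltW.
have := EF x; rewrite -Z0 mul0r pmu => /andP[h1 h2].
by move: Ey; rewrite ltr_norml => /andP[h3 h4]; lra.
Unshelve. all: by end_near. Qed.

(** Over any interval of length one there is a point of slope at most [2], and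
    [g Z - c p] has a bounded derivative. *)
Lemma front_flux_bounded : exists W, forall x, g (Z x) <= W.
Proof.
exists (g 2 + 2 * `|c| + 2 * L) => x.
have x1 : x - 1 < x by lra.
have [y /andP[y1 y2] ye] := mvt_open x1 (fun t _ => pD t).
have rx := front_range fp x; have rx1 := front_range fp (x - 1).
have ry := front_range fp y.
have Zy : Z y <= 2 by move: ye; rewrite subKr; lra.
have D (t : R) : is_derive t (1 : R) (fun s => g (Z s) - c * p s) (- f (p t)).
  have := is_deriveBf (front_ode fp t) (is_deriveZf c (pD t)).
  by congr is_derive; ring.
have [t _ te] := mvt_open y2 (fun t _ => D t).
have rt := front_range fp t.
have ft : `|f (p t)| <= 2 * L.
  have := law_lip fl (p t) 1; rewrite (law_1 fl) subr0 => h.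
  apply: (le_trans h); rewrite mulrC ler_wpM2r ?(law_L0 fl)//.
  by rewrite ler_norml; lra.
have L0 := law_L0 fl.
have h1 : - f (p t) * (x - y) <= 2 * L.
  apply: le_trans (ler_norm _) _; rewrite normrM normrN.
  rewrite -[leRHS]mulr1 ler_pM// ger0_norm; lra.
have h2 : c * p x - c * p y <= 2 * `|c|.
  rewrite -mulrBr; apply: le_trans (ler_norm _) _; rewrite normrM mulrC.
  by rewrite ler_wpM2r// ler_norml; lra.
have h3 : g (Z y) <= g 2 by rewrite (flux_mono gl).
by lra.
Qed.

End front_theory.

End front.

(** * A barrier built from the front *)

Section glue.
Context {R : realType}.
Implicit Types (W : R -> R).

(** The profile of the barrier consists of three pieces. *)
Definition glue (t : R) W1 W2 (x : R) : R := if x <= t then W1 x else W2 x.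

Lemma glue_le t W1 W2 x : x <= t -> glue t W1 W2 x = W1 x.
Proof. by rewrite /glue => ->. Qed.

Lemma glue_ge t W1 W2 x : W1 t = W2 t -> t <= x -> glue t W1 W2 x = W2 x.
Proof.
rewrite /glue => e; rewrite le_eqVlt => /predU1P[<-|tx]; first by rewrite lexx.
by rewrite leNgt tx.
Qed.

Lemma glue_continuous t W1 W2 : continuous W1 -> continuous W2 -> W1 t = W2 t ->
  continuous (glue t W1 W2).
Proof.
move=> c1 c2 e x; apply/cvgrPdist_lt => eps eps0.
have n1 : \forall y \near x, `|W1 x - W1 y| < eps.
  exact: (cvgrPdist_lt _ _).1 (c1 x) eps eps0.
have n2 : \forall y \near x, `|W2 x - W2 y| < eps.
  exact: (cvgrPdist_lt _ _).1 (c2 x) eps eps0.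
case: (ltgtP x t) => [xt|tx|xt].
- near=> y; have yt : y <= t by apply: ltW; near: y; exact: lt_nbhsl.
  by rewrite !glue_le ?(ltW xt)//; near: y.
- near=> y; have yt : t <= y by apply: ltW; near: y; exact: lt_nbhsr.
  by rewrite !glue_ge ?(ltW tx)//; near: y.
- near=> y; have /orP[yt|yt] := le_total y t.
    by rewrite !glue_le ?xt//; rewrite -xt; near: y.
  by rewrite !glue_ge ?xt//; rewrite -xt; near: y.
Unshelve. all: by end_near. Qed.

Lemma slope_le_glue t W1 W2 x K : W1 t = W2 t ->
  (x <= t -> slope_le W1 x K) -> (t <= x -> slope_le W2 x K) ->
  slope_le (glue t W1 W2) x K.
Proof.
move=> e s1 s2; rewrite /slope_le.
have shift : x + s @[s --> (0 : R)] --> x.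
  have : x + s @[s --> (0 : R)] --> x + 0.
    by apply: cvgD; [exact: cvg_cst|exact: cvg_id].
  by rewrite addr0.
case: (ltgtP x t) => [xt|tx|xt].
- have n := s1 (ltW xt); near=> s.
  have st : x + s <= t by apply: ltW; near: s; exact: (cvgr_lt _ shift).
  by rewrite !glue_le ?(ltW xt)//; near: s.
- have n := s2 (ltW tx); near=> s.
  have st : t <= x + s by apply: ltW; near: s; exact: (cvgr_gt _ shift).
  by rewrite !glue_ge ?(ltW tx)//; near: s.
- have xt' : x <= t by rewrite xt.
  have tx' : t <= x by rewrite xt.
  have n1 := s1 xt'; have n2 := s2 tx'; near=> s.
  have /orP[st|st] := le_total (x + s) t.
    by rewrite !glue_le//; near: s.
  by rewrite !glue_ge//; near: s.
Unshelve. all: by end_near. Qed.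

Lemma slope_le_derive W x (k K : R) : is_derive x (1 : R) W k -> k < K ->
  slope_le W x K.
Proof.
move=> Wd kK; have := is_derive_scale 1 Wd; rewrite mul1r.
move=> /is_derive1_caratheodory[h [hE hC h0]].
have : \forall s \near (0 : R), h s < K by apply: (cvgr_lt (h 0) hC); rewrite h0.
apply: filterS => s hs; have := hE s; rewrite mulr0 addr0 mul1r subr0 => ->.
by rewrite expr2 mulrCA ler_wpM2r ?(ltW hs)// -expr2 sqr_ge0.
Qed.

Lemma slope_le_near W1 W2 x K : (\forall y \near x, W1 y = W2 y) ->
  slope_le W1 x K -> slope_le W2 x K.
Proof.
move=> e; have e0 := nbhs_singleton e.
have shift : x + s @[s --> (0 : R)] --> x.
  have : x + s @[s --> (0 : R)] --> x + 0.
    by apply: cvgD; [exact: cvg_cst|exact: cvg_id].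
  by rewrite addr0.
rewrite /slope_le => H; have e1 := shift _ e.
by apply: filterS2 H e1 => s Hs /= es; rewrite -es -e0.
Qed.

Lemma slope_le_linear_ramp (k x K : R) : 0 <= k -> k <= K ->
  slope_le (fun y => k * Num.max y 0) x K.
Proof.
move=> k0 kK; near=> s; rewrite -mulrBr mulrCA expr2.
have s2 : 0 <= s * s by rewrite -expr2 sqr_ge0.
apply: (@le_trans _ _ (k * (s * s))); last by rewrite ler_wpM2r.
rewrite ler_wpM2l//.
have [s0|/ltW s0] := leP 0 s.
  rewrite ler_wpM2l// lerBlDr ge_max; apply/andP; split.
    by rewrite addrC lerD2l le_max lexx.
  by rewrite addr_ge0// le_max lexx orbT.
apply: ler_wnM2l => //.
rewrite lerBrDr -lerBrDl ge_max !lerBrDl !le_max.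
by rewrite addrC lexx/= addr0 s0 orbT.
Unshelve. all: by end_near. Qed.

Lemma continuous_maxr (F G : R -> R) : continuous F -> continuous G ->
  continuous (fun x => Num.max (F x) (G x)).
Proof. by move=> FC GC x; exact: (@continuous_max R R F G x (FC x) (GC x)). Qed.

Lemma continuous_minr (F G : R -> R) : continuous F -> continuous G ->
  continuous (fun x => Num.min (F x) (G x)).
Proof. by move=> FC GC x; exact: (@continuous_min R R F G x (FC x) (GC x)). Qed.

Lemma exists_min_pos (F : R -> R) a b : a <= b ->
  (forall x, a <= x <= b -> {for x, continuous F}) ->
  (forall x, a <= x <= b -> 0 < F x) ->
  exists2 m, 0 < m & forall x, a <= x <= b -> m <= F x.
Proof.
move=> ab FC F0; have [|x xab xm] := @EVT_min R F a b ab.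
  apply: continuous_in_subspaceT => x; rewrite inE/= in_itv/=; exact: FC.
exists (F x); first by apply: F0; move: xab; rewrite in_itv.
by move=> y yab; apply: xm; rewrite in_itv.
Qed.

End glue.

Section perturbation.
Context {R : realType}.
Context (g f p Z : R -> R) (mu L c : R).
Context (gl : flux_law g) (fl : bistable_law f mu L) (fp : front_profile g f mu c p Z).
Context (Zpos : forall x, -1 < p x < 1 -> 0 < Z x).

Let pD (x : R) : is_derive x (1 : R) p (Z x). Proof. exact: front_slope fp x. Qed.
Let pC : continuous p. Proof. exact: front_cont fp. Qed.

(** The perturbation has the sign of [f] along the front, which is what turns the
    front into a strict supersolution. *)
Definition perturbed_flux (theta x : R) : R := g (Z x) + theta * (p x - mu).

Lemma perturbed_flux_derive theta (x : R) :
  is_derive x (1 : R) (perturbed_flux theta) ((c + theta) * Z x - f (p x)).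
Proof.
have := is_deriveDf (front_ode fp x) (is_deriveZf theta
  (is_deriveBf (pD x) (is_derive_cst mu x (1 : R)))).
by rewrite subr0; congr is_derive; ring.
Qed.

Lemma perturbed_flux_cont theta : continuous (perturbed_flux theta).
Proof. by move=> x; exact: is_derive_continuous (perturbed_flux_derive theta x). Qed.

Lemma front_gt_N1 x : 0 < Z x -> -1 < p x.
Proof.
move=> Zx; have /andP[p1 _] := front_range fp x.
rewrite lt_neqAle p1 andbT; apply/eqP => pE.
have D := is_deriveNf (pD x).
have := derive_eq0_max D _; rewrite -pE => /(_ _)/eqP.
rewrite oppr_eq0 (gt_eqF Zx) => H; apply: notF; apply: H.
by near=> y; rewrite lerN2; case/andP: (front_range fp y).
Unshelve. all: by end_near. Qed.

Lemma front_value v : -1 < v < 1 -> exists x, p x = v.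
Proof.
move=> /andP[v1 v2].
have [a pa] : exists a, p a < -1 + (v + 1) by apply: (front_low fp); lra.
have [b pb] : exists b, 1 - (1 - v) < p b by apply: (front_high fp); lra.
have ab : a <= b.
  by rewrite leNgt; apply/negP => /ltW/(front_homo fp); lra.
have [||x _ <-] := @IVT R p a b v ab; last by exists x.
  exact: continuous_subspaceT.
by rewrite ge_min le_max; apply/andP; split; apply/orP; [left|right]; lra.
Qed.

Lemma front_lt_homo x y : p x < p y -> x < y.
Proof. by move=> pxy; rewrite ltNge; apply/negP => /(front_homo fp); lra. Qed.

(** Since the slope of the front tends to zero along a sequence at [-oo], the
    lowered flux vanishes at a value above [-1]. *)
Lemma perturbed_flux_zero delta sigma : 0 < delta -> 0 < sigma ->
  exists theta xs, [/\ 0 < theta <= delta / 2, theta <= 1,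
    perturbed_flux theta xs = 0, -1 < p xs < mu /\ p xs < -1 + sigma &
    forall x, xs < x -> p x < 1 -> 0 < perturbed_flux theta x].
Proof.
move=> d0 s0; have /andP[mu1 mu2] := law_mu fl.
have g0 := flux_law0 gl.
have wpos x : -1 < p x < 1 -> 0 < g (Z x).
  by move=> /Zpos; rewrite -(flux_mono_lt gl) g0.
(* [theta] is so small that the perturbed flux is positive from the value [v] on *)
pose v := -1 + Num.min sigma (mu + 1) / 2.
have [v1 v2 v3] : [/\ -1 < v, v < mu & v < -1 + sigma].
  have m1 : Num.min sigma (mu + 1) <= sigma by rewrite ge_min lexx.
  have m2 : Num.min sigma (mu + 1) <= mu + 1 by rewrite ge_min lexx orbT.
  have m3 : 0 < Num.min sigma (mu + 1) by rewrite lt_min s0; lra.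
  by rewrite /v; split; lra.
have [xb pxb] : exists x, p x = v by apply: front_value; lra.
have p0 := front_at0 fp.
have xb0 : xb < 0 by apply: front_lt_homo; rewrite pxb p0.
have gZC : continuous (fun x => g (Z x)).
  by move=> x; exact: is_derive_continuous (front_ode fp x).
have [m m0 mle] : exists2 m, 0 < m & forall x, xb <= x <= 0 -> m <= g (Z x).
  apply: exists_min_pos; [exact: ltW|by move=> x _; exact: gZC|].
  move=> x /andP[/(front_homo fp) h1 /(front_homo fp) h2]; apply: wpos.
  by move: h1 h2; rewrite pxb p0; lra.
pose theta := Num.min (Num.min (delta / 2) (m / 4)) 1.
have [t0 t1 t2 t3] : [/\ 0 < theta, theta <= delta / 2, theta <= m / 4 & theta <= 1].
  rewrite /theta !lt_min !ge_min !lexx !orbT ltr01 !divr_gt0//.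
have om_pos x : xb <= x -> p x < 1 -> 0 < perturbed_flux theta x.
  move=> xbx px1; have := front_homo fp xbx; rewrite pxb => px.
  rewrite /perturbed_flux; have [x0|x0] := leP x 0.
    have gm := mle x ltac:(lra).
    have := front_homo fp x0; rewrite p0 => pmu.
    have : theta * (mu - p x) <= m / 4 * 2 by apply: ler_pM => //; lra.
    by lra.
  have gx : 0 < g (Z x) by apply: wpos; lra.
  have := front_homo fp (ltW x0); rewrite p0 => pmu.
  by rewrite ltr_pwDl// mulr_ge0// ?(ltW t0)// subr_ge0.
have [xl xlxb oml] : exists2 xl, xl <= xb & perturbed_flux theta xl < 0.
  have [z z0 gz] := small_flux gl (mulr_gt0 t0 (ltac:(lra) : 0 < (mu + 1) / 2)).
  have e0 : 0 < Num.min z ((mu + 1) / 2) by rewrite lt_min z0; lra.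
  have [x xxb [Zx px]] := front_flat_left fp xb e0.
  exists x => //; move: Zx px; rewrite lt_min => /andP[Zx _] px.
  have m2 : Num.min z ((mu + 1) / 2) <= (mu + 1) / 2 by rewrite ge_min lexx orbT.
  have gZx : g (Z x) < g z by rewrite (flux_mono_lt gl).
  have : theta * ((mu + 1) / 2) <= theta * (mu - p x).
    by rewrite ler_wpM2l ?(ltW t0)//; lra.
  by rewrite /perturbed_flux; lra.
have omC : continuous (perturbed_flux theta) by exact: perturbed_flux_cont.
have omb : 0 < perturbed_flux theta xb by apply: om_pos => //; rewrite pxb; lra.
have zero a : a <= xb -> perturbed_flux theta a <= 0 ->
    exists2 x, a <= x <= xb & perturbed_flux theta x = 0.
  move=> axb oma; have [||x xin xE] := @IVT R (perturbed_flux theta) a xb 0 axb.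
  - exact: continuous_subspaceT.
  - by rewrite ge_min oma le_max (ltW omb) orbT.
  - by exists x.
pose S := [set x : R | xl <= x <= xb] `&` [set x | perturbed_flux theta x = 0].
have S0 : S !=set0 by have [x] := zero xl xlxb (ltW oml); exists x.
have SC : compact S.
  have Kc := @segment_compact R xl xb.
  apply: (subclosed_compact _ Kc); last by move=> x []; rewrite /= in_itv.
  apply: closedI.
    rewrite (_ : [set x : R | xl <= x <= xb] = `[xl, xb]%classic); first exact: interval_closed.
    by apply/seteqP; split => x /=; rewrite in_itv.
  exact: (@preimage_closed _ _ (perturbed_flux theta) [set 0]).
have idC : continuous (@id R) by move=> x; exact: cvg_id.
have [xs] := compact_EVT_max S0 SC (continuous_subspaceT idC).
rewrite inE => -[/= /andP[xs1 xs2] xsE] xsmax.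
have pxs : p xs <= v by rewrite -pxb; exact: (front_homo fp).
have gxs : 0 < g (Z xs).
  have : 0 < theta * (mu - p xs) by rewrite mulr_gt0//; lra.
  by move: xsE; rewrite /perturbed_flux; lra.
exists theta, xs; split => //; first by rewrite t0.
- split; last by lra.
  apply/andP; split; last by lra.
  by apply: front_gt_N1; rewrite -(flux_mono_lt gl) g0.
- move=> x xsx px1; have [xxb|xxb] := leP xb x; first exact: om_pos.
  rewrite ltNge; apply/negP => omx.
  have [y /andP[y1 y2] yE] := zero x (ltW xxb) omx.
  have := xsmax y; rewrite inE => /(_ _) H.
  have : y <= xs by apply: H; split => //=; apply/andP; split => //; lra.
  by lra.
Unshelve. all: by end_near. Qed.

(** The sign of [f] and the sign of the perturbation of the flux agree, so that
    the perturbed profile is a strict supersolution for the speed [c + delta]. *)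
Lemma perturbed_slack (h : R -> R) theta delta x : cancel g h -> cancel h g ->
  0 < theta <= delta / 2 -> -1 < p x < 1 -> 0 < perturbed_flux theta x ->
  0 < (delta - theta) * h (perturbed_flux theta x) -
      f (p x) * (1 - h (perturbed_flux theta x) / Z x).
Proof.
move=> gh hg /andP[t0 t1] px om; have g0 := flux_law0 gl.
have Zx := Zpos px; have /andP[p1 p2] := px.
set z := h _; have gz : g z = perturbed_flux theta x by rewrite hg.
have z0 : 0 < z by rewrite -(flux_mono_lt gl) g0 gz.
have h1 : 0 < (delta - theta) * z by rewrite mulr_gt0//; lra.
suff : 0 <= - f (p x) * (1 - z / Z x) by lra.
have zE : 1 - z / Z x = (Z x - z) / Z x by field; exact: lt0r_neq0.
rewrite zE; case: (ltgtP (p x) mu) => pm.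
- have fx : f (p x) < 0 by apply: (law_neg fl); rewrite p1.
  have zZ : z < Z x.
    rewrite -(flux_mono_lt gl) gz /perturbed_flux gtrDl nmulr_llt0//; lra.
  by rewrite mulr_ge0 ?divr_ge0//; lra.
- have fx : 0 < f (p x) by apply: (law_pos fl); rewrite p2 pm.
  have zZ : Z x < z.
    by rewrite -(flux_mono_lt gl) gz /perturbed_flux ltrDl mulr_gt0//; lra.
  have : 0 <= (z - Z x) / Z x by rewrite divr_ge0//; lra.
  move=> H; have : 0 <= f (p x) * ((z - Z x) / Z x) by rewrite mulr_ge0// ltW.
  by rewrite -opprB mulNr; lra.
- by rewrite pm (law_fmu fl) oppr0 mul0r.
Qed.

Context (h : R -> R) (gh : cancel g h) (hg : cancel h g) (hC : continuous h).

Let hle : {mono h : x y / x <= y}.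
Proof. by move=> x y; rewrite -(flux_mono gl) !hg. Qed.

Let hlt : {mono h : x y / x < y}. Proof. exact: leW_mono hle. Qed.

Let h0 : h 0 = 0. Proof. by have := gh 0; rewrite (flux_law0 gl). Qed.

(** The foot [xs] of the perturbed flux is left only slightly, so that the slope
    [h (om x1)] and the increment of the level are small there compared with the
    reaction term, which is bounded away from zero near [p xs]. *)
Lemma perturbed_lower_end delta sigma : 0 < delta -> 0 < sigma ->
  exists theta xs k1 eta x1, let om := perturbed_flux theta in
  [/\ 0 < theta <= delta / 2 /\ theta <= 1,
      [/\ 0 < k1, 0 < eta, eta <= (1 + p xs) / 2 &
        forall Q, `|Q - p xs| <= eta -> f Q <= - (3 * k1)],
      [/\ p xs <= p x1, p x1 < mu, p x1 < -1 + sigma & p x1 - p xs <= eta / 2],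
      [/\ 0 < om x1, `|c + delta| * h (om x1) <= k1 & om x1 * h (om x1) <= k1 * (eta / 2)] &
      forall x, x1 <= x -> p x < 1 -> 0 < om x].
Proof.
move=> d0 s0; have L0 := law_L0 fl.
have [theta [xs [tt t2 oms [/andP[ps1 ps2] ps3] ompos]]] :=
  perturbed_flux_zero d0 s0.
exists theta, xs; set om := perturbed_flux theta in oms ompos *.
have omC : continuous om by exact: perturbed_flux_cont.
have fps : f (p xs) < 0 by apply: (law_neg fl); rewrite ps1.
have [k1 k10 fk1] : exists2 k1, 0 < k1 & f (p xs) = - (4 * k1).
  by exists (- f (p xs) / 4); lra.
have L1 : 0 < L + 1 by lra.
pose eta := Num.min (k1 / (L + 1)) ((1 + p xs) / 2).
have eta0 : 0 < eta by rewrite lt_min divr_gt0//=; lra.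
have eta1 : L * eta <= k1.
  have : (L + 1) * eta <= k1 by rewrite mulrC -ler_pdivlMr// ge_min lexx.
  by rewrite mulrDl mul1r; lra.
have eta2 : eta <= (1 + p xs) / 2 by rewrite ge_min lexx orbT.
have fbot Q : `|Q - p xs| <= eta -> f Q <= - (3 * k1).
  move=> Qp; have := law_lip fl Q (p xs).
  have : L * `|Q - p xs| <= L * eta by rewrite ler_wpM2l.
  move=> h1 h2; have := le_trans (ler_norm _) (le_trans h2 h1).
  by rewrite fk1; lra.
have n1 : \forall x \near xs, p x < Num.min (Num.min mu (-1 + sigma)) (p xs + eta / 2).
  have q0 : p xs < Num.min (Num.min mu (-1 + sigma)) (p xs + eta / 2).
    by rewrite !lt_min ps2 ps3; lra.
  have C : {for xs, continuous p} by exact: pC.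
  exact: (cvgr_lt _ C _ q0).
have homC : {for xs, continuous (fun x => h (om x))}.
  by apply: (@continuous_comp _ _ _ om h); [exact: omC|exact: hC].
have n2 : \forall x \near xs, `|c + delta| * h (om x) < k1.
  have C : {for xs, continuous (fun x => `|c + delta| * h (om x))}.
    by apply: cvgM; [exact: cvg_cst|exact: homC].
  by apply: (cvgr_lt _ C); rewrite oms h0 mulr0.
have n3 : \forall x \near xs, om x * h (om x) < k1 * (eta / 2).
  have C : {for xs, continuous (fun x => om x * h (om x))}.
    by apply: cvgM; [exact: omC|exact: homC].
  by apply: (cvgr_lt _ C); rewrite oms mul0r mulr_gt0//; lra.
have [r /= r0 Hr] := (nbhs_ballP _ _).1 (filterI n1 (filterI n2 n3)).
have [] := Hr (xs + r / 2); first by rewrite /ball/= ltr_distlC; lra.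
have xsx : xs < xs + r / 2 by lra.
move: (xs + r / 2) xsx => x1 xsx1; rewrite !lt_min => /andP[/andP[h1 h2] h3] [h4 h5].
have mu1 : mu < 1 by case/andP: (law_mu fl).
exists k1, eta, x1; split => //.
- by split => //; [exact/(front_homo fp)/ltW|lra].
- by split; [apply: ompos => //; lra|exact: ltW|exact: ltW].
- by move=> x xx; apply: ompos; exact: lt_le_trans xx.
Qed.

(** Close to the level [1] the flux may be reduced to half its value, at a rate
    [Bt] that dominates the other terms, on an interval of length [len] over which
    the level [1] is passed. *)
Lemma perturbed_upper_end theta d M : 0 < theta -> 0 <= M ->
  exists x2 Bt len, let om := perturbed_flux theta in
  [/\ mu < p x2 < 1 /\ 0 < om x2, 0 < len /\ d * M + 3 * L + 1 < Bt, 0 < Bt /\ Bt * len < om x2 / 2,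
      M * len <= 1 & 1 < p x2 + h (om x2 / 2) * len].
Proof.
move=> t0 M0; have L0 := law_L0 fl; have /andP[mu1 mu2] := law_mu fl.
pose w2 := theta * (1 - mu) / 2.
have w20 : 0 < w2 by rewrite divr_gt0// mulr_gt0//; lra.
have [w2h w2q] : 0 < w2 / 2 /\ w2 / 4 < w2 / 2 by split; lra.
have [m3 m30 m3E] : exists2 m3, 0 < m3 & m3 = h (w2 / 2).
  by exists (h (w2 / 2)) => //; rewrite -h0 hlt.
have [Bt Bt0 BtE] : exists2 Bt, 0 < Bt & d * M + 3 * L + 1 < Bt.
  exists (`|d * M| + 3 * L + 2); have := ler_norm (d * M); last by lra.
  by have := normr_ge0 (d * M); lra.
have M1 : 0 < M + 1 by lra.
pose sm := Num.min (Num.min (1 - mu) (w2 / 4 * m3 / Bt)) (m3 / (M + 1)).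
have sm0 : 0 < sm by rewrite !lt_min subr_gt0 mu2 !divr_gt0// mulr_gt0// divr_gt0.
have [sm1 sm2 sm3] : [/\ sm <= 1 - mu, sm <= w2 / 4 * m3 / Bt & sm <= m3 / (M + 1)].
  by rewrite !ge_min !lexx !orbT.
have [len len0 m3len] : exists2 len, 0 < len & sm = m3 * len.
  by exists (sm / m3); rewrite ?divr_gt0// mulrC divfK// gt_eqF.
rewrite {}m3len in sm0 sm1 sm2 sm3.
have Btlen : Bt * len <= w2 / 4.
  move: sm2; rewrite ler_pdivlMr// => sm2.
  by rewrite -(ler_pM2l m30) [Bt * _]mulrC mulrA [leRHS]mulrC.
have Mlen : M * len <= 1.
  have : (M + 1) * len <= 1.
    move: sm3; rewrite ler_pdivlMr// => sm3.
    by rewrite -(ler_pM2l m30) mulr1 [_ * len]mulrC mulrA.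
  by rewrite mulrDl mul1r; lra.
have [x2 px2] : exists x, p x = 1 - m3 * len / 2 by apply: front_value; lra.
have omx2 : w2 <= perturbed_flux theta x2.
  have Z2 : 0 <= g (Z x2) by rewrite -(flux_law0 gl) (flux_mono gl) (front_slope_ge0 fp).
  have : theta * ((1 - mu) / 2) <= theta * (p x2 - mu).
    by rewrite ler_wpM2l ?(ltW t0)// px2; lra.
  by rewrite /perturbed_flux /w2 mulrA; lra.
exists x2, Bt, len; split => //.
- by rewrite px2; split; lra.
- by split => //; lra.
- have : m3 * len <= h (perturbed_flux theta x2 / 2) * len.
    by rewrite ler_wpM2r ?(ltW len0)// m3E hle; lra.
  by rewrite px2; lra.
Qed.

(** With the parameter [s] such that [ds / dx = Z / h om] the level [p] has the
    slope [h om] instead of [Z]. *)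
Lemma perturbed_parametrization theta x1 x2 : x1 < x2 ->
  (forall x, x1 <= x <= x2 -> -1 < p x < 1 /\ 0 < perturbed_flux theta x) ->
  exists xm (Y : R -> R), [/\ 0 < xm, Y 0 = x1 /\ Y xm = x2, continuous Y &
    forall s : R, 0 <= s <= xm -> x1 <= Y s <= x2 /\
      is_derive s (1 : R) Y (h (perturbed_flux theta (Y s)) / Z (Y s))].
Proof.
move=> x12 pin; set om := perturbed_flux theta in pin *.
have omC : continuous om by exact: perturbed_flux_cont.
pose z x := h (om x).
have zin x : x1 <= x <= x2 -> 0 < z x by move=> /pin[_]; rewrite -hlt h0.
have zC : continuous z.
  by move=> x; apply: (@continuous_comp _ _ _ om h); [exact: omC|exact: hC].
have Zin x : x1 <= x <= x2 -> 0 < Z x by move=> /pin[/Zpos].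
have ZC : continuous Z by exact: (front_slope_cont fp).
pose cl (x : R) := Num.max x1 (Num.min x x2).
have clin x : x1 <= cl x <= x2.
  by rewrite /cl le_max lexx/= ge_max ge_min lexx orbT (ltW x12).
have clE x : x1 <= x <= x2 -> cl x = x.
  by move=> /andP[h1 h2]; rewrite /cl min_l// max_r.
have clC : continuous cl.
  apply: continuous_maxr; first exact: cst_continuous.
  by apply: continuous_minr; [move=> x; exact: cvg_id|exact: cst_continuous].
have bin x : x1 <= x <= x2 -> {for x, continuous (fun x => Z x / z x)}.
  move=> xx; apply: cvgM; first exact: ZC.
  by apply: cvgV; [rewrite gt_eqF// zin|exact: zC].
pose b x := Z (cl x) / z (cl x).
have bC : continuous b.
  move=> x; apply: (@continuous_comp _ _ _ cl (fun x => Z x / z x)); first exact: clC.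
  exact: bin.
have [mb mb0 bge] : exists2 m, 0 < m & forall x, x1 <= x <= x2 -> m <= Z x / z x.
  apply: exists_min_pos; [exact: ltW|exact: bin|].
  by move=> x xx; rewrite divr_gt0 ?Zin ?zin.
have [Y [Y0 Ym Ys YD]] := @autonomous_ode R b mb x1 bC mb0 (fun x => bge _ (clin x)).
have [xm Yxm] := Ys x2.
have Yle : {mono Y : x y / x <= y} by exact: le_mono.
have Ylt : {mono Y : x y / x < y} by exact: leW_mono.
exists xm, Y; split => //; first by rewrite -Ylt Y0 Yxm.
  by move=> x; exact: is_derive_continuous (YD x).
move=> s /andP[s0 sm]; have Yi : x1 <= Y s <= x2 by rewrite -Y0 -Yxm !Yle s0.
by split=> //; have := YD s; rewrite /b clE// invf_div.
Qed.

(** The derivative of the reparametrized flux appears on the left; compactness makes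
    the slack uniform. *)
Lemma perturbed_slack_min theta delta x1 x2 : x1 < x2 -> 0 < theta <= delta / 2 ->
  (forall x, x1 <= x <= x2 -> -1 < p x < 1 /\ 0 < perturbed_flux theta x) ->
  exists2 k, 0 < k & forall x, x1 <= x <= x2 ->
    (c + theta) * h (perturbed_flux theta x) -
      f (p x) * (h (perturbed_flux theta x) / Z x) + f (p x) + k <=
    (c + delta) * h (perturbed_flux theta x).
Proof.
move=> x12 tt pin; set om := perturbed_flux theta in pin *.
have omC : continuous om by exact: perturbed_flux_cont.
have zC : continuous (fun x => h (om x)).
  by move=> x; apply: (@continuous_comp _ _ _ om h); [exact: omC|exact: hC].
have [k k0 H] : exists2 m, 0 < m & forall x, x1 <= x <= x2 ->
    m <= (delta - theta) * h (om x) - f (p x) * (1 - h (om x) / Z x).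
  apply: exists_min_pos; [exact: ltW| |].
    move=> x xx; apply: cvgB.
      by apply: cvgM; [exact: cvg_cst|exact: zC].
    apply: cvgM.
      apply: (@continuous_comp _ _ _ p f); [exact: pC|exact: (law_continuous fl)].
    apply: cvgB; first exact: cvg_cst.
    apply: cvgM; first exact: zC.
    apply: cvgV; last exact: (front_slope_cont fp).
    by rewrite gt_eqF// Zpos//; case: (pin x xx).
  by move=> x /pin[px om0]; exact: perturbed_slack.
by exists k => // x /H; lra.
Qed.

End perturbation.

(** The level [Qe] is slightly above [-1].  The barrier leaves it with a flux that
    grows linearly, continues as the perturbed front, parametrized so that its
    slope matches its flux, and crosses the level [1] with a flux that decreases
    rapidly, which compensates for a possibly negative speed. *)
Lemma front_barrier {R : realType} (g f p Z : R -> R) (mu L c delta sigma : R) :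
  flux_law g -> bistable_law f mu L -> front_profile g f mu c p Z ->
  (forall x, -1 < p x < 1 -> 0 < Z x) -> 0 < delta -> 0 < sigma ->
  exists Qe W zeta V xi1 kap Wm, [/\ -1 < Qe < -1 + sigma, profile g W zeta V,
    [/\ continuous W, forall x, 0 <= W x <= Wm & forall x, x <= 0 -> W x = 0],
    [/\ 0 < xi1, 0 < kap & 1 < Qe + V xi1] &
    forall xi, xi <= xi1 -> exists2 K, slope_le W xi K &
      K + f (Qe + V xi) + kap <= (c + delta) * zeta xi].
Proof.
move=> gl fl fp Zpos d0 s0; have g0 := flux_law0 gl; have L0 := law_L0 fl.
have [h [gh hg hC hm]] := increasing_inverse (flux_incr gl) (flux_surj gl).
have hle : {mono h : x y / x <= y} by exact: le_mono.
have h0 : h 0 = 0 by rewrite -g0 gh.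
have pD := front_slope fp.
have [theta [xs [k1 [eta [x1 [[tt t2] [k10 eta0 eta2 fbot] [pxs1 x1mu x1sig px1]
  [om1 hx1 kx1] ompos]]]]]] := perturbed_lower_end gl fl fp Zpos gh hC d0 s0.
have /andP[t0 t1] := tt; move: om1 hx1 kx1 ompos.
set om := perturbed_flux g p Z mu theta => om1 hx1 kx1 ompos.
have omC : continuous om by exact: (perturbed_flux_cont fp).
have omD (x : R) : is_derive x (1 : R) om ((c + theta) * Z x - f (p x)).
  exact: (perturbed_flux_derive fp).
have [Wm omWm] : exists Wm, forall x, om x <= Wm.
  have [Wb HWb] := front_flux_bounded gl fl fp; exists (Wb + 2) => x.
  have /andP[p1 p2] := front_range fp x; have /andP[mu1 mu2] := law_mu fl.
  have : theta * (p x - mu) <= 1 * 2.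
    have [pm|pm] := leP mu (p x); first by apply: ler_pM => //; lra.
    by rewrite (@le_trans _ _ 0)// nmulr_lle0//; lra.
  by have := HWb x; rewrite /om /perturbed_flux; lra.
pose Zm := h Wm.
have Zm0 : 0 <= Zm by rewrite -h0 hle (le_trans _ (omWm x1))// ltW.
have [x2 [Bt [len [[/andP[x2mu x21] om2] [len0 BtE] [Bt0 Btlen] Zmlen top]]]] :=
  perturbed_upper_end gl fl fp gh hg `|c + delta| t0 Zm0.
rewrite -/om in om2 Btlen top.
have x12 : x1 < x2 by apply: (front_lt_homo fp); exact: lt_trans x2mu.
have pin x : x1 <= x <= x2 -> -1 < p x < 1 /\ 0 < om x.
  move=> /andP[h1 /(front_homo fp) h2].
  have px : p x < 1 by exact: le_lt_trans x21.
  by have := front_homo fp h1; split; [lra|exact: ompos].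
have [xm [X [xm0 [X0 Xxm] XC XD]]] := perturbed_parametrization gl fp Zpos gh hg hC x12 pin.
have [k2 k20 slack] := perturbed_slack_min gl fl fp Zpos gh hg hC x12 tt pin.
rewrite -/om in slack XD.
(* the three pieces meet at [xia] and [xib], and the level [1] is below that of [xic] *)
have [xia xia0 kxia] : exists2 xia, 0 < xia & k1 * xia = om x1.
  by exists (om x1 / k1); rewrite ?divr_gt0// mulrC divfK// gt_eqF.
have [xib [xab xibE]] : exists xib, xia < xib /\ xib - xia = xm.
  by exists (xia + xm); split; lra.
have [xic [xbc xicE]] : exists xic, xib < xic /\ xic - xib = len.
  by exists (xib + len); split; lra.
pose Y (xi : R) := X (xi - xia).
have YC : continuous Y.
  move=> x; apply: (@continuous_comp _ _ _ (fun x => x - xia) X); last exact: XC.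
  by apply: cvgB; [exact: cvg_id|exact: cvg_cst].
have Ya : Y xia = x1 by rewrite /Y subrr.
have Yb : Y xib = x2 by rewrite /Y xibE.
have YD (xi : R) : xia <= xi <= xib -> x1 <= Y xi <= x2 /\
    is_derive xi (1 : R) Y (h (om (Y xi)) / Z (Y xi)).
  move=> /andP[h1 h2]; have [|Xi D] := XD (xi - xia).
    by rewrite subr_ge0 h1/= -xibE lerD2r.
  split => //; have := @is_derive_comp _ X (fun s => s - xia) xi _ _ D
    (is_deriveBf (is_derive_id xi (1 : R)) (is_derive_cst xia xi (1 : R))).
  by rewrite subr0 mulr1.
clearbody Y; move: xm0 xibE => _ _; clear X X0 Xxm XC XD xm.
pose W1 (xi : R) := k1 * Num.max xi 0.
pose W2 xi := om (Y xi).
pose W3 (xi : R) := Num.max (om x2 - Bt * (xi - xib)) (om x2 / 2).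
pose W := glue xia W1 (glue xib W2 W3).
have om2h : 0 < om x2 / 2 <= om x2.
  by apply/andP; split; [rewrite divr_gt0|rewrite ler_pdivrMr// ler_pMr// ler1n].
have W23 : W2 xib = W3 xib.
  by rewrite /W2 /W3 Yb subrr mulr0 subr0 max_l//; case/andP: om2h.
have W12 : W1 xia = glue xib W2 W3 xia.
  by rewrite glue_le ?(ltW xab)// /W1 /W2 max_l ?(ltW xia0)// kxia Ya.
have W1C : continuous W1.
  have mC : continuous (fun y : R => Num.max y 0).
    by apply: continuous_maxr; [move=> x; exact: cvg_id|exact: cst_continuous].
  by move=> x; apply: cvgM; [exact: cvg_cst|exact: mC].
have W2C : continuous W2.
  by move=> x; apply: (@continuous_comp _ _ _ Y om); [exact: YC|exact: omC].
have W3l : continuous (fun x => om x2 - Bt * (x - xib)).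
  move=> x; apply: cvgB; first exact: cvg_cst.
  by apply: cvgM; [exact: cvg_cst|apply: cvgB; [exact: cvg_id|exact: cvg_cst]].
have W3C : continuous W3.
  by apply: continuous_maxr; [exact: W3l|exact: cst_continuous].
have WC : continuous W.
  by apply: glue_continuous => //; exact: glue_continuous.
have Wbot xi : xi <= xia -> W xi = W1 xi by move=> ?; rewrite /W glue_le.
have Wmid xi : xia <= xi <= xib -> W xi = W2 xi.
  by move=> /andP[h1 h2]; rewrite /W glue_ge// glue_le.
have Wtop xi : xib <= xi -> W xi = W3 xi.
  move=> h1; have ax : xia <= xi by exact: le_trans (ltW xab) h1.
  by rewrite /W glue_ge// glue_ge.
have W1x1 xi : xi <= xia -> 0 <= W1 xi <= om x1.
  move=> xx; rewrite /W1 mulr_ge0 ?(ltW k10) ?le_max ?lexx ?orbT//=.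
  by rewrite -kxia ler_wpM2l ?(ltW k10)// ge_max xx ltW.
have Wbd x : 0 <= W x <= Wm.
  have [xa|xa] := leP x xia.
    by rewrite Wbot//; have /andP[-> h1] := W1x1 x xa; exact: le_trans (omWm x1).
  have [xb|xb] := leP x xib.
    have xx : xia <= x <= xib by rewrite (ltW xa).
    by rewrite Wmid// /W2 omWm andbT ltW//; have [/pin[]] := YD x xx.
  have /andP[omh0 omhl] := om2h.
  rewrite Wtop ?(ltW xb)// /W3 le_max (ltW omh0) orbT/=.
  rewrite (le_trans _ (omWm x2))// ge_max omhl andbT gerBl mulr_ge0 ?(ltW Bt0)//.
  by rewrite subr_ge0 ltW.
have W0' x : 0 <= W x by case/andP: (Wbd x).
have W0 x : x <= 0 -> W x = 0.
  move=> x0; rewrite Wbot; first by rewrite /W1 max_r ?mulr0.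
  exact: le_trans (ltW xia0).
have [zeta [V pr]] := profile_exists gl WC W0' W0.
have zetaE x : zeta x = h (W x) by rewrite -(profile_flux pr) gh.
have VD := profile_derive pr; have zeta0 := profile_ge0 pr.
have VB := profile_homo pr; have V0 := profile_V_ge0 pr.
have zetaZm x : zeta x <= Zm by rewrite zetaE hle; case/andP: (Wbd x).
have zbot xi : xi <= xia -> zeta xi <= h (om x1).
  by move=> xx; rewrite zetaE hle Wbot//; case/andP: (W1x1 xi xx).
(* the level of the barrier is [p x1] at [xia] *)
have [Qe QeE] : exists Qe, Qe = p x1 - V xia by eexists.
have Vxia : V xia <= eta / 2.
  have [s /andP[s1 s2]] := mvt_open xia0 (fun t _ => VD t).
  rewrite (profile_V0 pr (lexx 0)) !subr0 => ->.
  rewrite -(ler_pM2l k10); apply: le_trans kx1.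
  by rewrite mulrCA kxia mulrC ler_pM2l// zbot// ltW.
have Qmid xi : xia <= xi <= xib -> Qe + V xi = p (Y xi).
  move=> /andP[h1 h2].
  have D1 (t : R) : xia <= t <= xi -> is_derive t (1 : R) (fun s => p (Y s)) (zeta t).
    move=> /andP[t1' t2']; have tx : xia <= t <= xib by rewrite t1' (le_trans t2').
    have [Yi D] := YD t tx; have := is_derive_comp (pD (Y t)) D.
    rewrite zetaE Wmid// mulrC divfK// gt_eqF// Zpos//.
    by case: (pin _ Yi).
  have := is_derive_unique_eq h1 (fun t _ => VD t) D1.
  by rewrite Ya QeE => e; rewrite addrAC -addrA e addrC subrK.
have Qtop xi : xib <= xi -> Qe + V xi = p x2 + (V xi - V xib).
  move=> h1; rewrite -Yb -Qmid ?lexx ?(ltW xab)//.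
  by rewrite addrA addrAC addrK.
have [kap [kap0 kapk1 kapk2 kap1]] :
    exists kap, [/\ 0 < kap, kap <= k1, kap < k2 & kap <= L + 1].
  have m0 : 0 < Num.min k1 (Num.min k2 1) by rewrite !lt_min k10 k20 ltr01.
  exists (Num.min k1 (Num.min k2 1) / 2).
  have m1 : Num.min k1 (Num.min k2 1) <= k1 by rewrite ge_min lexx.
  have m2 : Num.min k1 (Num.min k2 1) <= k2 by rewrite !ge_min lexx !orbT.
  have m4 : Num.min k1 (Num.min k2 1) <= 1 by rewrite !ge_min lexx !orbT.
  by move: m0 m1 m2 m4 L0; clear; move: (Num.min _ _) => m; split; lra.
exists Qe, W, zeta, V, xic, kap, Wm; split => //.
- have := V0 xia; move: pxs1 x1sig px1 QeE Vxia eta0 eta2; clear.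
  by move=> *; apply/andP; split; lra.
- split => //; first exact/(lt_trans xia0)/(lt_trans xab).
  rewrite Qtop ?(ltW xbc)//.
  have [s /andP[s1 s2] ->] := mvt_open xbc (fun t _ => VD t).
  rewrite xicE; apply: (lt_le_trans top); rewrite lerD2l ler_pM2r//.
  by rewrite zetaE hle Wtop ?(ltW s1)// /W3 le_max lexx orbT.
move=> xi xic_.
have cd x : - (`|c + delta| * zeta x) <= (c + delta) * zeta x.
  by rewrite -mulNr ler_wpM2r// lerNl -normrN ler_norm.
pose K := (c + delta) * zeta xi - f (Qe + V xi) - kap.
exists K; last by rewrite /K -addrA [_ + kap]addrC addrA !subrK.
apply: slope_le_glue => [//|xa|xa].
  apply: slope_le_linear_ramp; first exact: ltW.
  have fQ : f (Qe + V xi) <= - (3 * k1).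
    apply: fbot; rewrite ler_norml.
    have := VB _ _ xa; have := V0 xi; move: pxs1 px1 QeE Vxia; clear.
    by move=> *; apply/andP; split; lra.
  have cz : `|c + delta| * zeta xi <= k1.
    by apply: le_trans hx1; rewrite ler_wpM2l// zbot.
  by have := cd xi; rewrite /K; move: fQ cz kapk1 k10; clear; lra.
apply: slope_le_glue => [//|xb|xb].
  have xx : xia <= xi <= xib by rewrite xa.
  have [Yi YiD] := YD _ xx; have [px _] := pin _ Yi; have Zx := Zpos _ px.
  apply: (slope_le_derive (is_derive_comp (omD (Y xi)) YiD)).
  rewrite /K Qmid// zetaE Wmid// /W2.
  have -> : ((c + theta) * Z (Y xi) - f (p (Y xi))) * (h (om (Y xi)) / Z (Y xi)) =
      (c + theta) * h (om (Y xi)) - f (p (Y xi)) * (h (om (Y xi)) / Z (Y xi)).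
    by move: Zx; clear => Zx; field; exact: lt0r_neq0.
  by have := slack _ Yi; move: kapk2; clear; lra.
have near3 : \forall y \near xi, om x2 - Bt * (y - xib) = W3 y.
  have : \forall y \near xi, om x2 / 2 < om x2 - Bt * (y - xib).
    apply: (cvgr_gt _ (W3l xi)).
    have : Bt * (xi - xib) <= Bt * len by rewrite ler_pM2l// -xicE lerD2r.
    by move: Btlen; clear; lra.
  by apply: filterS => y /ltW yy; rewrite /W3 max_l.
apply: (slope_le_near near3).
have D : is_derive xi (1 : R) (fun y => om x2 - Bt * (y - xib)) (- Bt).
  have := is_derive_affine xi (om x2 + Bt * xib) (- Bt); congr is_derive.
  by apply/funext => y; ring.
apply: (slope_le_derive D).
have Vt : V xi - V xib <= 1.
  move: xb; rewrite le_eqVlt => /predU1P[->|xb]; first by rewrite subrr.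
  have [s /andP[s1 s2] ->] := mvt_open xb (fun t _ => VD t).
  apply: le_trans Zmlen; apply: ler_pM => //; first by rewrite subr_ge0 ltW.
  by rewrite -xicE lerD2r.
have Vb := VB _ _ xb.
have fQ : f (Qe + V xi) <= 2 * L.
  have := law_lip fl (Qe + V xi) 1; rewrite (law_1 fl) subr0 => hl.
  apply: le_trans (ler_norm _) _; apply: (le_trans hl); rewrite mulrC ler_wpM2r//.
  rewrite Qtop// ler_norml; have /andP[mu1 _] := law_mu fl.
  by move: Vb Vt x2mu x21 mu1; clear; move=> *; apply/andP; split; lra.
have cz : `|c + delta| * zeta xi <= `|c + delta| * Zm by rewrite ler_wpM2l.
by have := cd xi; rewrite /K; move: cz fQ BtE kap1; clear; lra.
Qed.

(** * Propagation for the regularized problems *)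

Section profile_stability.
Context {R : realType}.
Implicit Types (g W zeta V : R -> R).

(** The slope of a barrier with a given flux profile depends continuously on the
    flux law, uniformly in space. *)
Lemma profile_slope_close g W zeta V (Wm e : R) : flux_law g -> profile g W zeta V ->
  (forall x, W x <= Wm) -> 0 < e ->
  exists M d, [/\ 0 <= M, 0 < d & forall g', flux_law g' ->
    (forall z, 0 <= z <= M -> `|g' z - g z| <= d) ->
    forall zeta' V', profile g' W zeta' V' -> forall x, `|zeta' x - zeta x| <= e].
Proof.
move=> gl pr Wle e0; have [Zm gZm] := flux_surj gl Wm.
have zle x : 0 <= zeta x <= Zm.
  by rewrite (profile_ge0 pr) -(flux_mono gl) gZm (profile_flux pr) Wle.
have Zm0 : 0 <= Zm by have /andP[] := zle 0; exact: le_trans.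
have [m m0 mle] : exists2 m, 0 < m & forall z, 0 <= z <= Zm -> m <= g (z + e) - g z.
  apply: exists_min_pos => // z _.
    apply: cvgB; last exact: (flux_cont gl).
    apply: (@continuous_comp _ _ _ (fun z => z + e) g); last exact: (flux_cont gl).
    by apply: cvgD; [exact: cvg_id|exact: cvg_cst].
  by rewrite subr_gt0 (flux_mono_lt gl) ltrDl.
exists (Zm + e), (m / 2); split; [lra|lra|move=> g' gl' close zeta' V' pr' x].
have := profile_flux pr x; have := profile_flux pr' x.
have /andP[z0 zZ] := zle x; have z0' := profile_ge0 pr' x.
rewrite ler_distl; move: (W x) => w gz' gz; apply/andP; split; rewrite leNgt; apply/negP => h.
- have h1 := mle (zeta' x) ltac:(lra).
  have : g (zeta' x + e) < g (zeta x) by rewrite (flux_mono_lt gl); lra.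
  have := close (zeta' x) ltac:(lra); rewrite ler_distl; lra.
- have h1 := mle (zeta x) ltac:(lra).
  have : g' (zeta x + e) < g' (zeta' x) by rewrite (flux_mono_lt gl').
  have := close (zeta x + e) ltac:(lra); rewrite ler_distl; lra.
Qed.

(** Profiles coincide to the left of [0], where they vanish, so that the difference
    of the slopes is integrated over [[0, xi1]] only. *)
Lemma profile_close g g' W zeta zeta' V V' (e xi1 x : R) :
  profile g W zeta V -> profile g' W zeta' V' ->
  (forall x, `|zeta' x - zeta x| <= e) -> 0 <= xi1 -> x <= xi1 ->
  `|V' x - V x| <= e * xi1.
Proof.
move=> pr pr' H xi0 xx; have e0 : 0 <= e by exact: le_trans (H 0).
have [x0|x0] := leP x 0.
  by rewrite (profile_V0 pr)// (profile_V0 pr')// subrr normr0 mulr_ge0.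
have D (t : R) : is_derive t (1 : R) (fun x => V' x - V x) (zeta' t - zeta t).
  exact: (is_deriveBf (profile_derive pr' t) (profile_derive pr t)).
have [s _] := mvt_open x0 (fun t _ => D t).
rewrite (profile_V0 pr (lexx 0)) (profile_V0 pr' (lexx 0)) !subr0 => ->.
by rewrite normrM [`|x|]gtr0_norm// ler_pM// ltW.
Qed.

End profile_stability.

Section propagation.
Context {R : realType} {N : nat}.
Notation E := 'rV[R]_N.
Context (g f p Z : R -> R) (mu L c : R).
Context (gl : flux_law g) (fl : bistable_law f mu L) (fp : front_profile g f mu c p Z).
Context (Zpos : forall x, -1 < p x < 1 -> 0 < Z x).
Context (N0 : (0 < N)%N).

(** Below [mu] the reaction drives the solution close to [-1] within a time that
    does not depend on the size of the ball. *)
Lemma generation (b1 b0 : R) : -1 < b0 -> b0 < b1 -> b1 < mu ->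
  exists T C M d, [/\ 0 < T, 0 <= C, 0 <= M & 0 < d] /\
    forall g' u, regular_flux g' -> (forall z, 0 <= z <= M -> `|g' z - g z| <= d) ->
    bounded_solution g' f u -> (forall (x : E) (t : R), 0 <= t -> u x t <= 1) ->
    forall a rad, C <= rad -> (forall x, enorm (x - a) <= rad -> u x 0 < b1) ->
    forall x, enorm (x - a) <= rad - C -> u x T < b0.
Proof.
move=> b01 bb bmu; have /andP[mu1 mu2] := law_mu fl; have L0 := law_L0 fl.
have [k k0 fk] : exists2 k, 0 < k & forall s, b0 <= s <= b1 -> k <= - f s.
  apply: exists_min_pos; [exact: ltW| |].
    by move=> s _; apply: cvgN; exact: (law_continuous fl).
  by move=> s sb; rewrite oppr_gt0; apply: (law_neg fl); lra.
have NP : (0 : R) < N%:R by rewrite ltr0n.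
have [z1 z10 gz1] := small_flux gl (divr_gt0 (divr_gt0 k0 (ltr0n R 4)) NP).
pose T := (b1 - b0) / (k / 2); have T0 : 0 < T by rewrite divr_gt0//; lra.
pose xi1 := 1 + (1 - b0 + 1) / z1; pose C := xi1 + L * xi1 * T + 1.
have xi10 : 1 <= xi1 by rewrite lerDl divr_ge0 ?(ltW z10)//; lra.
have C0 : 0 <= L * xi1 * T by rewrite mulr_ge0 ?(ltW T0)// mulr_ge0//; lra.
exists T, C, z1, (k / 4 / N%:R); split.
  by split; [|rewrite /C; lra|exact: ltW|rewrite !divr_gt0].
move=> g' u rg close su u1 a rad Crad init x xr.
have Ng : N%:R * g' z1 < k / 2.
  have := close z1; rewrite (ltW z10) lexx => /(_ isT); rewrite ler_distl => /andP[_ h].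
  rewrite mulrC -ltr_pdivlMr//; apply: (le_lt_trans h).
  have -> : k / 2 / N%:R = k / 4 / N%:R + k / 4 / N%:R by field; lra.
  by rewrite ltrD2r.
pose B (t : R) := b1 - k / 2 * t.
have BT : B T = b0 by rewrite /B /T; field; lra.
have Bd (t : R) : is_derive t (1 : R) B (- (k / 2)).
  by have := is_derive_affine t b1 (- (k / 2)); congr is_derive; apply/funext => y; rewrite /B; ring.
have Bin t : 0 <= t <= T -> b0 <= B t <= b1.
  move=> /andP[t0 tT]; rewrite -BT /B lerD2l lerN2 ler_pM2l ?divr_gt0// tT gerBl.
  by rewrite mulr_ge0//; lra.
rewrite -BT.
apply: (@finite_speed_comparison _ _ g' f u a 0 T 1 b0 L (k / 2) z1 (rad - xi1) B
  (fun=> - (k / 2)) N0 rg su (lexx 0) L0 (law_lip fl) z10 Ng _ Bd) => //.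
- by lra.
- by move=> t /Bin/fk; lra.
- by move=> t /Bin/andP[].
- by move=> y t /andP[t0 _]; exact: u1.
- by move=> y; rewrite subrK /B mulr0 subr0; exact: init.
- move=> t /andP[t0 tT]; rewrite subr0.
  have : L * xi1 * t <= L * xi1 * T by rewrite ler_wpM2l// mulr_ge0//; lra.
  by move: Crad; rewrite /C /xi1; lra.
- by rewrite (ltW T0) lexx.
- by move: xr; rewrite subr0 /C /xi1; lra.
Qed.

(** After the generation time the barrier of [front_barrier] moves inwards with the
    speed [c + delta], on balls so large that their curvature is negligible. *)
Lemma propagation (delta sigma eta : R) : 0 < delta -> 0 < sigma -> 0 < eta ->
  exists T C M d, [/\ 0 < T, 0 <= C, 0 <= M & 0 < d] /\
    forall g' u, regular_flux g' -> (forall z, 0 <= z <= M -> `|g' z - g z| <= d) ->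
    bounded_solution g' f u -> (forall (x : E) (t : R), 0 <= t -> u x t <= 1) ->
    forall a rad, C <= rad -> (forall x, enorm (x - a) <= rad -> u x 0 < mu - eta) ->
    forall x t, T <= t -> enorm (x - a) <= rad - C - (c + delta) * t ->
      u x t < -1 + sigma.
Proof.
move=> d0 s0 eta0; have /andP[mu1 mu2] := law_mu fl; have L0 := law_L0 fl.
have s0' : 0 < Num.min sigma (mu + 1) by rewrite lt_min s0; lra.
have [Qe [W [zeta [V [xi1 [kap [Wm [/andP[Q1 Q2] pr [WC Wbd W0]
  [xi10 kap0 Vxi1] slack]]]]]]]] := front_barrier gl fl fp Zpos d0 s0'.
have [Qs Qmu] : Qe < -1 + sigma /\ Qe < mu.
  have m1 : Num.min sigma (mu + 1) <= sigma by rewrite ge_min lexx.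
  have m2 : Num.min sigma (mu + 1) <= mu + 1 by rewrite ge_min lexx orbT.
  by lra.
have [b1 [b1mu bb b1eta]] : exists b1, [/\ b1 < mu, (-1 + Qe) / 2 < b1 & mu - eta <= b1].
  exists (Num.max (mu - eta) ((Qe + mu) / 2)).
  by rewrite gt_max lt_max le_max lexx; split => //; [apply/andP; split|apply/orP; right]; lra.
have [T [C [M1 [d1 [[T0 C0 M10 d10] gen]]]]] := generation (ltac:(lra) : -1 < (-1 + Qe) / 2) bb b1mu.
(* [e] bounds the change of the slope of the barrier under regularization *)
pose A := `|c + delta|; have A0 : 0 <= A by exact: normr_ge0.
have ex0 : 0 < A + (L + 1) * xi1 by rewrite ltr_wpDl// mulr_gt0//; lra.
pose e := Num.min (kap / 2 / (A + (L + 1) * xi1)) ((Qe + V xi1 - 1) / 2 / xi1).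
have e0 : 0 < e by rewrite lt_min !divr_gt0//; lra.
have [e1 e2] : A * e + L * (e * xi1) <= kap / 2 /\ e * xi1 < Qe + V xi1 - 1.
  have h1 : e <= kap / 2 / (A + (L + 1) * xi1) by rewrite ge_min lexx.
  have h2 : e <= (Qe + V xi1 - 1) / 2 / xi1 by rewrite ge_min lexx orbT.
  move: h1 h2; rewrite !ler_pdivlMr// => h1 h2.
  have h3 : 0 <= e * xi1 by rewrite mulr_ge0 ?(ltW e0)// ltW.
  by split; lra.
have [M2 [d2 [M20 d20 close]]] := profile_slope_close gl pr (fun x => (andP (Wbd x)).2) e0.
have Wm0 : 0 <= Wm by have /andP[] := Wbd 0; exact: le_trans.
pose r0 := 4 * N%:R * (Wm + 1) / kap.
have NP : (0 : R) < N%:R by rewrite ltr0n.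
have r00 : 0 < r0 by rewrite divr_gt0// !mulr_gt0//; lra.
exists T, (C + xi1 + A * T + r0), (Num.max M1 M2), (Num.min d1 d2); split.
  split => //; first by rewrite !addr_ge0 ?(ltW r00) ?(ltW xi10)// mulr_ge0// ltW.
    by rewrite le_max M10.
  by rewrite lt_min d10.
move=> g' u rg gg su u1 a rad Crad init x t Tt xr.
have gl' := regular_flux_law rg.
have g1 z : 0 <= z <= M1 -> `|g' z - g z| <= d1.
  move=> /andP[z0 zM]; apply: le_trans (gg z _) _; last by rewrite ge_min lexx.
  by rewrite z0 le_max zM.
have g2 z : 0 <= z <= M2 -> `|g' z - g z| <= d2.
  move=> /andP[z0 zM]; apply: le_trans (gg z _) _; last by rewrite ge_min lexx orbT.
  by rewrite z0 le_max zM orbT.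
have [zeta' [V' pr']] := profile_exists gl' WC (fun x => (andP (Wbd x)).1) W0.
have zclose := close g' gl' g2 zeta' V' pr'.
have Vclose xi : xi <= xi1 -> `|V' xi - V xi| <= e * xi1.
  exact: (profile_close pr pr' zclose (ltW xi10)).
have AT : 0 <= A * T by rewrite mulr_ge0// ltW.
have gen1 y : enorm (y - a) <= rad - C -> u y T < (-1 + Qe) / 2.
  apply: (gen g' u rg g1 su u1); first by lra.
  by move=> y' /init; lra.
(* at time [T] the barrier exceeds [1] outside the ball on which generation took place *)
pose rho (s : R) := rad - C - xi1 - (c + delta) * (s - T).
have rhod (s : R) : is_derive s (1 : R) rho (- (c + delta)).
  have := is_derive_affine s (rad - C - xi1 + (c + delta) * T) (- (c + delta)).
  by congr is_derive; apply/funext => y; rewrite /rho; ring.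
have rhoE s : rad - (C + xi1 + A * T + r0) - (c + delta) * s + r0 <= rho s.
  have : - (A * T) <= (c + delta) * T.
    by rewrite -mulNr ler_wpM2r ?(ltW T0)// lerNl /A -normrN ler_norm.
  by rewrite /rho; lra.
have rho_r0 s : T <= s <= t -> r0 <= rho s.
  move=> /andP[Ts st]; apply: le_trans (rhoE s); rewrite lerDr.
  have xr0 := enorm_ge0 (x - a).
  have [cd|cd] := leP 0 (c + delta).
    have : (c + delta) * s <= (c + delta) * t by rewrite ler_wpM2l.
    by lra.
  have : (c + delta) * s <= 0 by rewrite nmulr_rle0// ltW// (lt_le_trans T0).
  by lra.
have xrho : enorm (x - a) <= rho t by apply: le_trans (rhoE t); lra.
suff : u x t < Qe + V' (enorm (x - a) - rho t).
  by rewrite (profile_V0 pr') ?subr_le0//; lra.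
have := @radial_comparison R N g' f u a T t r0 1 xi1 W zeta' V' (fun=> Qe) (fun=> 0) rho
  (fun=> - (c + delta)) N0 rg su (ltW T0) _ rhod r00 rho_r0 (profile_derive pr')
  (profile_flux pr') (profile_ge0 pr') (profile_eq0 pr').
apply => //.
- by move=> y s /andP[Ts _]; apply: u1; exact: le_trans (ltW T0) Ts.
- by move=> s _; have := Vclose xi1 (lexx xi1); rewrite ler_distl; lra.
- move=> s xi _ xixi; have [K WK HK] := slack xi xixi; exists K => //.
  have fV : f (Qe + V' xi) <= f (Qe + V xi) + L * (e * xi1).
    have := law_lip fl (Qe + V' xi) (Qe + V xi).
    have -> : Qe + V' xi - (Qe + V xi) = V' xi - V xi by ring.
    have : L * `|V' xi - V xi| <= L * (e * xi1) by rewrite ler_wpM2l// Vclose.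
    by move=> h1 h2; have := le_trans (ler_norm _) (le_trans h2 h1); lra.
  have zz : (c + delta) * zeta xi <= (c + delta) * zeta' xi + A * e.
    have : (c + delta) * (zeta xi - zeta' xi) <= A * e.
      apply: le_trans (ler_norm _) _; rewrite normrM ler_wpM2l// distrC; exact: zclose.
    by lra.
  have Nr : (N%:R - 1) / r0 * W xi <= kap / 4.
    have r0E : (Wm + 1) / r0 = kap / 4 / N%:R by rewrite /r0; field; lra.
    have /andP[Wx0 Wx1] := Wbd xi.
    apply: (@le_trans _ _ (N%:R / r0 * (Wm + 1))).
      apply: ler_pM => //; last by lra.
        by rewrite divr_ge0 ?(ltW r00)// subr_ge0 ler1n.
      by rewrite ler_pM2r ?invr_gt0//; lra.
    by rewrite mulrAC -mulrA r0E; have -> : N%:R * (kap / 4 / N%:R) = kap / 4 by field; lra.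
  by lra.
- move=> y; have [yr|yr] := leP (enorm (y - a)) (rad - C).
    have := gen1 y yr; have := profile_V_ge0 pr' (enorm (y - a) - rho T).
    by lra.
  have : V' xi1 <= V' (enorm (y - a) - rho T).
    by apply: (profile_homo pr'); rewrite /rho subrr mulr0; lra.
  have := Vclose xi1 (lexx xi1); rewrite ler_distl.
  have := u1 y T (ltW T0); lra.
- by rewrite Tt lexx.
Qed.

End propagation.

(** * Admissible solutions and the scaling *)

Section uniform.
Context {R : realType} {T : choiceType}.

Lemma uniform_cvg_distP (I : Type) (F : set_system I) (A : set T)
    (k : I -> T -> R) (h : T -> R) {FF : Filter F} :
  {uniform A, k @ F --> h} <->
  forall e : R, 0 < e -> \forall i \near F, forall y, A y -> `|h y - k i y| < e.
Proof.
split=> [H e e0|H P /uniform_nbhs[E [entE EP]]].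
  apply: (H [set k' : T -> R | forall y, A y -> `|h y - k' y| < e]).
  apply/uniform_nbhs; exists [set xy | `|xy.1 - xy.2| < e]; split; last first.
    by move=> k' Hk y Ay; exact: Hk.
  exact: (@entourage_ball R R (PosNum e0)).
move: entE; rewrite -entourage_from_ballE => -[e /= e0 He].
by apply: filterS (H e e0) => i kA; apply: EP => y Ay; apply: He; exact: kA.
Qed.

End uniform.

Section approximation.
Context {R : realType} {N : nat}.
Notation E := 'rV[R]_N.
Implicit Types (g f : R -> R) (u : E -> R -> R).

(** What the propagation argument needs to know about an admissible solution; this
    property is invariant under a reflection of the values. *)
Definition approximable g f u : Prop :=
  exists (gn : nat -> R -> R) (un : nat -> E -> R -> R),
  [/\ forall n, regular_flux (gn n),
      forall M d : R, 0 <= M -> 0 < d -> \forall n \near \oo,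
        forall z, 0 <= z <= M -> `|gn n z - g z| <= d,
      forall n, bounded_solution (gn n) f (un n) /\ forall x, -1 <= un n x 0 <= 1,
      forall (a : E) (r d : R), 0 < d -> \forall n \near \oo,
        forall x, enorm (x - a) <= r -> `|un n x 0 - u x 0| < d &
      forall x (t : R), 0 <= t -> un n x t @[n --> \oo] --> u x t].

Lemma approximableN g f u : approximable g f u ->
  approximable g (fun s => - f (- s)) (fun x t => - u x t).
Proof.
move=> [gn [un [rg gg su u0 uu]]]; exists gn, (fun n x t => - un n x t); split => //.
- move=> n; have [sn un1] := su n; split; first exact: bounded_solutionN.
  by move=> x; have := un1 x; lra.
- move=> a r d d0; have := u0 a r d d0; apply: filterS => n H x /H.
  by rewrite -opprD normrN.
- by move=> x t t0; exact: (cvgN (uu x t t0)).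
Qed.

Lemma admissible_approximable (L1 L2 : R) (omega phi f : R -> R) (u0 : E -> R) u :
  0 < L1 -> diffusion N L1 L2 omega phi -> admissible L1 L2 omega phi f u0 u ->
  approximable (flux1 phi) f u /\ forall x, u x 0 = u0 x.
Proof.
move=> L10 dphi [al [phin [u0n [un [[al0 _ _] [rphi cphi] [rd cu0] cs cu]]]]].
have phiE z : 0 <= z -> flux1 phi z = derive_hl phi z.
  by case: dphi => _ _ p1 _ p2; exact: (flux1_derive_hl p1 p2).
have phinE n z : 0 <= z -> flux1 (phin n) z = derive_hl (phin n) z.
  by case: (rphi n) => -[p1 _] p2 _; exact: (flux1_derive_hl p1 p2).
have cuP A : compact A -> A `<=` [set p : E * R | 0 <= p.2] -> forall e : R, 0 < e ->
    \forall n \near \oo, forall p, A p -> `|u p.1 p.2 - un n p.1 p.2| < e.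
  move=> Ac Asub.
  exact: (@uniform_cvg_distP R (E * R)%type nat \oo A (fun n p => un n p.1 p.2)
    (fun p => u p.1 p.2) _).1 (cu A Ac Asub).
have uu x t : 0 <= t -> un n x t @[n --> \oo] --> u x t.
  move=> t0; apply/cvgrPdist_lt => e e0.
  have := cuP [set (x, t)] (@compact_set1 _ (x, t)) _ e e0.
  move=> /(_ _) H; have := H ltac:(by move=> _ ->).
  by apply: filterS => n /(_ (x, t) erefl).
have u0E x : u x 0 = u0 x.
  have c0 : u0n n x @[n --> \oo] --> u0 x.
    apply/cvgrPdist_lt => e e0.
    have H : \forall n \near \oo, forall y, [set x] y -> `|u0 y - u0n n y| < e.
      exact: ((uniform_cvg_distP _ _ _).1 (cu0 [set x] (@compact_set1 _ x)) e e0).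
    by apply: filterS H => n /(_ x erefl).
  have c1 : u0n n x @[n --> \oo] --> u x 0.
    have -> : u0n ^~ x = fun n => un n x 0.
      by apply/funext => n; rewrite (classical_init (cs n)).
    exact: uu.
  by rewrite -(cvg_lim (@norm_hausdorff _ _) c1) (cvg_lim (@norm_hausdorff _ _) c0).
split => //; exists (fun n => flux1 (phin n)), un; split => //.
- by move=> n; exact: regularized_regular_flux L10 (al0 n) (rphi n).
- move=> M d M0 d0; have Mc : `[0, M]%classic `<=` `[0, +oo[%classic.
    by move=> z /=; rewrite !in_itv/= andbT => /andP[].
  have H : \forall n \near \oo, forall z, `[0, M]%classic z ->
      `|derive_hl phi z - derive_hl (phin n) z| < d.
    exact: ((uniform_cvg_distP _ _ _).1 (cphi _ (@segment_compact R 0 M) Mc) d d0).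
  apply: filterS H => n H z zM; have /andP[z0 _] := zM.
  by rewrite phinE// phiE// distrC ltW// H//= in_itv.
- move=> n; split; last first.
    by move=> x; rewrite (classical_init (cs n)); exact: (datum_range (rd n)).
  apply: classical_bounded_solution (cs n).
    exact: (regularized_grad (rphi n)).
  exact: regularized_regular_flux L10 (al0 n) (rphi n).
- move=> a r d d0.
  have Ac : compact ([set x : E | enorm (x - a) <= r] `*` [set (0 : R)]).
    by apply: compact_setX; [exact: compact_ball|exact: compact_set1].
  have Asub : [set x : E | enorm (x - a) <= r] `*` [set (0 : R)] `<=` [set p | 0 <= p.2].
    by move=> p [_ /= ->].
  have := cuP _ Ac Asub d d0; apply: filterS => n H x xr.
  by rewrite distrC; exact: (H (x, 0) (conj xr erefl)).
Unshelve. all: by end_near. Qed.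

Lemma cvg_seq_le (v : nat -> R) (l b : R) : v n @[n --> \oo] --> l ->
  (\forall n \near \oo, v n <= b) -> l <= b.
Proof.
move=> vl vb; rewrite leNgt; apply/negP => bl.
have vb' : \forall n \near \oo, b < v n by exact: (cvgr_gt _ vl).
by have [n /= [h1 h2]] := filter_ex (filterI vb vb'); move: h1; rewrite leNgt h2.
Qed.

Lemma approximable_le1 g f mu L u x (t : R) : (0 < N)%N -> bistable_law f mu L ->
  approximable g f u -> 0 <= t -> u x t <= 1.
Proof.
move=> N0 fl [gn [un [rg _ su _ uu]]] t0; apply: (cvg_seq_le (uu x t t0)).
apply: nearW => n; have [sn u1] := su n.
apply: (solution_le1 N0 (rg n) sn (law_L0 fl) (law_lip fl) (law_1 fl)) => // y.
by case/andP: (u1 y).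
Qed.

Context (g f p Z : R -> R) (mu L c : R).
Context (gl : flux_law g) (fl : bistable_law f mu L) (fp : front_profile g f mu c p Z).
Context (Zpos : forall x, -1 < p x < 1 -> 0 < Z x).
Context (N0 : (0 < N)%N).

Lemma approximable_propagation (delta sigma eta : R) :
  0 < delta -> 0 < sigma -> 0 < eta ->
  exists T C, [/\ 0 < T, 0 <= C & forall u, approximable g f u ->
    forall a rad, C <= rad -> (forall x, enorm (x - a) <= rad -> u x 0 <= mu - eta) ->
    forall x t, T <= t -> enorm (x - a) <= rad - C - (c + delta) * t ->
      u x t <= -1 + sigma].
Proof.
move=> d0 s0 eta0; have eta20 : 0 < eta / 2 by lra.
have [T [C [M [d [[T0 C0 M0 dd0] H]]]]] :=
  @propagation R N g f p Z mu L c gl fl fp Zpos N0 delta sigma (eta / 2) d0 s0 eta20.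
exists T, C; split => // u [gn [un [rg gg su u0 uu]]] a rad Crad init x t Tt xr.
have t0 : 0 <= t by exact: le_trans (ltW T0) Tt.
apply: (cvg_seq_le (uu x t t0)).
apply: filterS2 (gg M d M0 dd0) (u0 a rad (eta / 2) eta20) => n gn_close un_close.
have [sn u1] := su n; apply: ltW.
apply: (H _ _ (rg n) gn_close sn _ a rad Crad) => //.
  move=> y s s0'.
  apply: (solution_le1 N0 (rg n) sn (law_L0 fl) (law_lip fl) (law_1 fl)) => // z.
  by case/andP: (u1 z).
by move=> y yr; have := init y yr; have := un_close y yr; rewrite ltr_distl; lra.
Qed.

(** In the scaled variables the generation time and the losses of radius vanish
    with the scale. *)
Lemma scaled_propagation (u : R -> E -> R -> R) (z x : E) (r eta t sigma : R) :
  (forall eps, 0 < eps -> approximable g f (fun x t => u eps (eps *: x) (eps * t))) ->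
  0 < eta -> (\forall eps \near 0^'+, forall y, enorm (y - z) <= r -> u eps y 0 <= mu - eta) ->
  0 < t -> 0 < r -> enorm (x - z) + c * t < r -> 0 < sigma ->
  \forall q \near (x, t) & eps \near 0^'+, u eps q.1 q.2 <= -1 + sigma.
Proof.
move=> uA eta0 init t0 r0 xr s0.
(* [delta] and [d] use up only a part of the gap [s] *)
pose s := r - (enorm (x - z) + c * t); have s1 : 0 < s by rewrite subr_gt0.
pose delta := s / (8 * (t + 1)); have t1 : 0 < 8 * (t + 1) by lra.
have d0 : 0 < delta by rewrite divr_gt0.
have dt : delta * t <= s / 8.
  have -> : s / 8 = delta * (t + 1) by rewrite /delta; field; lra.
  by rewrite ler_pM2l//; lra.
have [T [C [T0 C0 H]]] := approximable_propagation d0 s0 eta0.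
pose d := Num.min (Num.min (t / 2) (s / 8)) r.
have dd0 : 0 < d by rewrite !lt_min r0 !divr_gt0.
have [d1 d2 d3] : [/\ d <= t / 2, d <= s / 8 & d <= r].
  by rewrite !ge_min !lexx !orbT.
have CT0 : 0 < C + T + 1 by lra.
have near1 : \forall q \near (x, t), t / 2 < q.2 /\
    0 < r - d - (c + delta) * q.2 - enorm (q.1 - z).
  apply: filterI.
    have c2 : (fun q : E * R => q.2) q @[q --> (x, t)] --> t by exact: cvg_snd.
    by apply: (cvgr_gt _ c2); lra.
  have c3 : (fun q : E * R => r - d - (c + delta) * q.2 - enorm (q.1 - z)) q @[q --> (x, t)] -->
      r - d - (c + delta) * t - enorm (x - z).
    have c4 : {for (x, t), continuous (fun q : E * R => enorm (q.1 - z))}.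
      apply: (@continuous_comp _ _ _ fst (fun x : E => enorm (x - z))).
        exact: cvg_fst.
      exact: continuous_dist.
    apply: cvgB; last exact: c4.
    apply: cvgB; first exact: cvg_cst.
    by apply: cvgM; [exact: cvg_cst|exact: cvg_snd].
  by apply: (cvgr_gt _ c3); move: dt d2; rewrite /s; lra.
have near2 : \forall eps \near (0 : R)^'+, [/\ 0 < eps, eps * (C + T + 1) < d &
    forall y, enorm (y - z) <= r -> u eps y 0 <= mu - eta].
  near=> eps; split; first by near: eps; exact: nbhs_right_gt.
    by rewrite -ltr_pdivlMr//; near: eps; apply: nbhs_right_lt; rewrite divr_gt0.
  by near: eps; exact: init.
exists ([set q | t / 2 < q.2 /\ 0 < r - d - (c + delta) * q.2 - enorm (q.1 - z)],
  [set eps : R | [/\ 0 < eps, eps * (C + T + 1) < d &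
    forall y, enorm (y - z) <= r -> u eps y 0 <= mu - eta]]) => //.
move=> [[x' t'] eps] /= [[tt' xr'] [eps0 epsd ini]].
have scale y : eps *: (eps^-1 *: y) = y by rewrite scalerA divff ?gt_eqF// scale1r.
have en y w : enorm (y - eps^-1 *: w) = eps^-1 * enorm (eps *: y - w).
  rewrite -{1}(_ : eps^-1 *: (eps *: y) = y).
    by rewrite -scalerBr enormZ gtr0_norm// invr_gt0.
  by rewrite scalerA mulVf ?gt_eqF// scale1r.
have epsC : eps * C <= eps * (C + T + 1) by rewrite ler_pM2l//; lra.
have epsT : eps * T <= eps * (C + T + 1) by rewrite ler_pM2l//; lra.
have -> : u eps x' t' = u eps (eps *: (eps^-1 *: x')) (eps * (eps^-1 * t')).
  by rewrite scale mulVKf// gt_eqF.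
apply: (H _ (uA eps eps0) (eps^-1 *: z) (eps^-1 * r) _ _ (eps^-1 *: x') (eps^-1 * t')).
- by rewrite mulrC ler_pdivlMr// mulrC; lra.
- by move=> y /=; rewrite en ler_pM2l ?invr_gt0// mulr0; exact: ini.
- by rewrite mulrC ler_pdivlMr// mulrC; lra.
- rewrite en scale -(ler_pM2l eps0) !mulrBr !mulrA divff ?gt_eqF// !mul1r.
  rewrite [eps * (c + delta)]mulrC -(mulrA (c + delta)) divff ?gt_eqF// mulr1.
  by lra.
Unshelve. all: by end_near. Qed.

End approximation.

(** * The two regions and the convergence *)

Section regions.
Context {R : realType} {N : nat}.
Notation E := 'rV[R]_N.
Implicit Types (v u : R -> E -> R) (mu : R) (x y z : E) (A B G : set E).

(** [Gminus] without extended real limits; its reflection describes [Gplus]. *)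
Definition below mu v : set E :=
  [set x | exists2 U, nbhs x U & exists2 eta, 0 < eta &
    \forall eps \near 0^'+, forall y, U y -> v eps y <= mu - eta].

Lemma Gminus_below mu v : Gminus mu v = below mu v.
Proof.
apply/seteqP; split => x [U xU].
  move=> /ereal_inf_lt[_ [A FA <-] supA].
  have [b bE bmu] : exists2 b : R, (ereal_sup
      ((fun eps => ereal_sup [set (v eps y)%:E | y in U]) @` A) <= b%:E)%E & b < mu.
    move: supA; case: (ereal_sup _) => [b| |] => [|//|_]; first by rewrite lte_fin; exists b.
    by exists (mu - 1); [rewrite leNye|lra].
  exists U => //; exists (mu - b); first by rewrite subr_gt0.
  apply: filterS FA => eps Aeps y Uy; rewrite subKr -lee_fin; apply: le_trans bE.
  apply: (@le_trans _ _ (ereal_sup [set (v eps y)%:E | y in U])).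
    by apply: ereal_sup_ubound; exists y.
  by apply: ereal_sup_ubound; exists eps.
move=> [eta eta0 H]; exists U => //.
apply: (@le_lt_trans _ _ (mu - eta)%:E); last by rewrite lte_fin; lra.
apply: (@le_trans _ _ (ereal_sup ((fun eps => ereal_sup [set (v eps y)%:E | y in U]) @`
  [set eps | forall y, U y -> v eps y <= mu - eta]))).
  by apply: ereal_inf_lbound; exists [set eps | forall y, U y -> v eps y <= mu - eta].
apply: ge_ereal_sup => _ [eps Heps <-]; apply: ge_ereal_sup => _ [y Uy <-].
by rewrite lee_fin; exact: Heps.
Qed.

Lemma Gplus_below mu v : Gplus mu v = below (- mu) (fun eps y => - v eps y).
Proof.
have LE U : (limf_einf (fun eps => ereal_inf [set (v eps y)%:E | y in U]) 0^'+ =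
    - limf_esup (fun eps => ereal_sup [set (- v eps y)%:E | y in U]) 0^'+)%E.
  rewrite /limf_einf; congr (- limf_esup _ _)%E; apply/funext => eps /=.
  by rewrite /ereal_inf oppeK image_comp.
rewrite -Gminus_below; apply/seteqP; split => x [U xU H]; exists U => //; move: H;
  by rewrite LE lteNr.
Qed.

Lemma open_below mu v : open (below mu v).
Proof.
rewrite openE => x [U xU [eta eta0 H]]; rewrite /interior.
apply: filterS (nbhs_interior xU) => y yU; exists U => //; by exists eta.
Qed.

Lemma below_disjoint mu v x : below mu v x ->
  below (- mu) (fun eps y => - v eps y) x -> False.
Proof.
move=> [U /nbhs_singleton xU [e1 e10 H1]] [U' /nbhs_singleton xU' [e2 e20 H2]].
have [eps [h1 h2]] := @filter_ex _ (0 : R)^'+ _ _ (@filterI _ (0 : R)^'+ _ _ _ H1 H2).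
by have := h1 x xU; have := h2 x xU'; lra.
Qed.

(** The margin [eta] is treated as a second parameter that tends to zero, so that
    compactness yields a common one. *)
Lemma below_compact mu v A : compact A -> A `<=` below mu v ->
  exists2 eta, 0 < eta &
    \forall eps \near 0^'+, forall y, A y -> v eps y <= mu - eta.
Proof.
move=> /compact_near_coveringP cA Asub.
have [] := cA _ (filter_prod (0 : R)^'+ (0 : R)^'+)
  (fun q y => v q.1 y <= mu - q.2) _ _.
  move=> x /Asub[U xU [eta eta0 H]].
  exists (U, [set q : R * R | (forall y, U y -> v q.1 y <= mu - eta) /\ q.2 < eta]) => /=.
    split => //=; exists ([set eps : R | forall y, U y -> v eps y <= mu - eta],
      [set e : R | e < eta]) => //=.
    by split => //=; exact: nbhs_right_lt.
  by move=> [y [eps e]] [/= Uy [/(_ y Uy) h1 h2]]; lra.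
move=> [Q1 Q2] [/= HQ1 HQ2] HQ.
have [eta [Q2eta eta0]] := filter_ex (filterI HQ2 (nbhs_right_gt 0)).
exists eta => //; apply: filterS HQ1 => eps Q1eps y Ay.
exact: (HQ (eps, eta)).
Qed.

(** Otherwise the indicator of [A] would be continuous along the segment and violate
    the intermediate value theorem. *)
Lemma segment_exit A B x y : open A -> open B -> (forall z, A z -> B z -> False) ->
  A x -> ~ A y -> exists2 s, 0 <= s <= 1 & ~ (A `|` B) (x + s *: (y - x)).
Proof.
move=> oA oB AB Ax nAy; apply/not_exists2P => H.
pose cl (s : R) := Num.max 0 (Num.min s 1).
have clin s : 0 <= cl s <= 1.
  by rewrite /cl le_max lexx/= ge_max ge_min lexx orbT ler01.
have clC : continuous cl.
  apply: (continuous_maxr (@cst_continuous R R 0)).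
  by apply: continuous_minr; [move=> s; exact: cvg_id|exact: cst_continuous].
pose w (s : R) := x + cl s *: (y - x).
have wC : continuous w.
  move=> s; apply: cvgD; first exact: cvg_cst.
  by apply: cvgZ; [exact: clC|exact: cvg_cst].
have wAB s : A (w s) \/ B (w s).
  by have [/(_ (clin s))//|/contrapT] := H (cl s).
pose h (s : R) : R := (w s \in A)%:R.
have hC : continuous h.
  move=> s; apply/cvgrPdist_lt => e e0; have [Aw|Bw] := wAB s.
    have : \forall s' \near s, A (w s') by apply: wC; exact: open_nbhs_nbhs.
    by apply: filterS => s' As'; rewrite /h !mem_set// subrr normr0.
  have : \forall s' \near s, B (w s') by apply: wC; exact: open_nbhs_nbhs.
  apply: filterS => s' Bs'; rewrite /h !memNset ?subrr ?normr0//.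
    by move=> /AB; exact.
  by move=> /AB; exact.
have [||s _] := @IVT R h 0 1 (1 / 2) ler01.
- exact: continuous_subspaceT.
- have -> : h 0 = 1.
    by rewrite /h /w /cl min_l// max_l// scale0r addr0 mem_set.
  have -> : h 1 = 0.
    by rewrite /h /w /cl min_r// max_r// scale1r addrC subrK memNset.
  by rewrite ge_min le_max; apply/andP; split; apply/orP; [right|left]; lra.
- by rewrite /h; case: (w s \in A) => /=; lra.
Qed.

(** The segments that start at the centre stay in the ball, hence away from [G]. *)
Lemma ball_sub_region A B G x (r : R) : open A -> open B ->
  (forall z, A z -> B z -> False) -> A `|` B `|` G = setT -> A x ->
  (forall w, G w -> r < enorm (x - w)) -> forall y, enorm (y - x) <= r -> A y.
Proof.
move=> oA oB AB ABG Ax far y yr; apply: contrapT => nAy.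
have [s /andP[s0 s1] nAB] := segment_exit oA oB AB Ax nAy.
have : (A `|` B `|` G) (x + s *: (y - x)) by rewrite ABG.
move=> [//|/far]; rewrite opprD addrA subrr add0r enormN enormZ ger0_norm//.
by apply/negP; rewrite -leNgt (le_trans _ yr)// ler_piMl// enorm_ge0.
Qed.

Lemma open_contains_ball A z : open A -> A z ->
  exists2 r : R, 0 < r & forall y, enorm (y - z) <= r -> A y.
Proof.
move=> oA Az; have [r /= r0 H] := (nbhs_ballP _ _).1 (open_nbhs_nbhs (conj oA Az)).
exists (r / 2); first by lra.
move=> y yr; apply: H; rewrite -ball_normE/= -normrN opprB.
by apply: le_lt_trans (norm_le_enorm _) _; lra.
Qed.

Lemma nbhs_enorm_lt x w (r : R) : enorm (x - w) < r ->
  \forall z \near w, enorm (x - z) < r.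
Proof.
move=> xw; have C : {for w, continuous (fun z => enorm (z - x))} by exact: continuous_dist.
have : \forall z \near w, enorm (z - x) < r.
  by apply: (cvgr_lt _ C); rewrite -enormN opprB.
by apply: filterS => z; rewrite -enormN opprB.
Qed.

End regions.

Section spreading.
Context {R : realType} {N : nat}.
Notation E := 'rV[R]_N.
Context (g f p Z : R -> R) (mu L c : R).
Context (gl : flux_law g) (fl : bistable_law f mu L) (fp : front_profile g f mu c p Z).
Context (Zpos : forall x, -1 < p x < 1 -> 0 < Z x).
Context (N0 : (0 < N)%N).

(** A ball on which the data are below [mu] shrinks with speed [c]; when [c] is
    negative it grows. *)
Lemma spreading (u : R -> E -> R -> R) (A : set (E * R)) (sigma : R) :
  (forall eps, 0 < eps -> approximable g f (fun x t => u eps (eps *: x) (eps * t))) ->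
  compact A ->
  (forall x t, A (x, t) -> 0 < t /\ exists z r, [/\ 0 < r, enorm (x - z) + c * t < r &
    forall y, enorm (y - z) <= r -> below mu (fun eps x => u eps x 0) y]) ->
  0 < sigma ->
  \forall eps \near 0^'+, forall q, A q -> u eps q.1 q.2 <= -1 + sigma.
Proof.
move=> uA cA HA s0; apply: ((compact_near_coveringP A).1 cA) => -[x t] /HA.
move=> [t0 [z [r [r0 xr rball]]]].
have [eta eta0 H] := below_compact (@compact_ball R N z r) rball.
exact: (scaled_propagation gl fl fp Zpos N0 uA eta0 H t0 r0 xr s0).
Qed.

End spreading.

Lemma potential_derive {R : realType} (f F : R -> R) : continuous f ->
  (forall x : R, is_derive x (1 : R) F (f x)) -> potential f 1 = F 1 - F (-1).
Proof.
move=> fC FD; rewrite /potential /Rintegral.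
have FC : continuous F by move=> x; exact: is_derive_continuous (FD x).
have lt11 : (-1 : R) < 1 by lra.
have cf : {within `[-1, 1], continuous f} by exact: continuous_subspaceT.
have dF : derivable_oo_LRcontinuous F (-1) 1.
  by split; [move=> x _; exact: ex_derive
    |apply: cvg_at_right_filter; exact: FC|apply: cvg_at_left_filter; exact: FC].
have F'f : {in `]-1, 1[%R, F^`() =1 f} by move=> x _; exact: derive1_val.
by rewrite (continuous_FTC2 lt11 cf dF F'f).
Qed.

Theorem theorem2p6 (R : realType) (N : nat) (hN : (0 < N)%N)
  (f : R -> R) (mu : R) (hf : bistable f mu) (hF : unbalanced f)
  (Lam1 Lam2 : R) (hLam : 0 < Lam1 < 1) (hLam2 : 1 < Lam2)
  (omega : R -> R) (homega : modulus omega)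
  (phi : R -> R) (hphi : diffusion N Lam1 Lam2 omega phi)
  (q : R -> R) (c : R) (hc : front phi f mu q c)
  (u0 : R -> 'rV[R]_N -> R) (u : R -> 'rV[R]_N -> R -> R)
  (hu : forall eps, 0 < eps ->
    admissible_scaled Lam1 Lam2 omega phi f eps (u0 eps) (u eps))
  (beta : R) (hbeta : 0 < beta < 1) (K : R -> R)
  (hu0 : forall eps, 0 < eps ->
    [/\ forall x, -1 <= u0 eps x <= 1,
        forall x, differentiable (u0 eps) x,
        forall x, enorm (grad (u0 eps) x) <= K eps &
        holder beta (K eps) (grad (u0 eps))])
  (hG : closure (Gminus mu u0) `|` closure (Gplus mu u0) = setT)
  (* the signed distance is defined at every point of the space *)
  (hdist : Gminus mu u0 `|` Gplus mu u0 `|` interface mu u0 = setT) :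
  let dist := signed_dist (Gminus mu u0) (Gplus mu u0) (interface mu u0) in
  [/\ 0 < c,
      forall A : set ('rV[R]_N * R), compact A ->
        A `<=` [set p | 0 < p.2 /\ ((c * p.2)%:E < dist p.1)%E] ->
        {uniform A, (fun eps p => u eps p.1 p.2) @ 0^'+ --> (fun=> -1 : R)} &
      forall A : set ('rV[R]_N * R), compact A ->
        A `<=` [set p | 0 < p.2 /\ (dist p.1 < (c * p.2)%:E)%E] ->
        {uniform A, (fun eps p => u eps p.1 p.2) @ 0^'+ --> (fun=> 1 : R)}].
Proof.
move=> dist; have L10 : 0 < Lam1 by case/andP: hLam.
have gl := diffusion_flux_law L10 hphi.
have [L fl] := bistable_bistable_law hf.
have fp := front_front_profile gl hc.
have c0 : 0 < c.
  have [F FD] := antiderivative (law_continuous fl).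
  apply: (front_speed_gt0 gl fl fp FD); rewrite -subr_gt0.
  rewrite -(potential_derive (law_continuous fl) FD); exact: unbalanced_pos hF.
have Zpos x := @front_slope_gt0 R _ _ _ _ mu L c gl fl fp x c0.
have uA eps : 0 < eps -> approximable (flux1 phi) f (fun x t => u eps (eps *: x) (eps * t))
    /\ forall x, u eps x 0 = u0 eps x.
  move=> eps0; have [uA uE] := admissible_approximable L10 hphi (hu eps eps0).
  split => // x; have := uE (eps^-1 *: x).
  by rewrite mulr0 scalerA divff ?gt_eqF// scale1r.
have uA1 eps (e0 : 0 < eps) := (uA eps e0).1.
have uA1N eps (e0 : 0 < eps) := approximableN (uA1 eps e0).
have uE s (r : R) : below r (fun eps x => s * u0 eps x) =
    below r (fun eps x => s * u eps x 0).
  apply/seteqP; split => x [U xU [eta eta0 H]]; exists U => //; exists eta => //;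
    near=> eps => y Uy; have eps0 : 0 < eps by near: eps; exact: nbhs_right_gt.
    by rewrite (uA eps eps0).2; move: y Uy; near: eps; exact: H.
  by rewrite -(uA eps eps0).2; move: y Uy; near: eps; exact: H.
have GmE : Gminus mu u0 = below mu (fun eps x => u eps x 0).
  have := uE 1 mu; rewrite Gminus_below.
  by under eq_fun do under eq_fun do rewrite mul1r;
     under [in RHS]eq_fun do under eq_fun do rewrite mul1r.
have GpE : Gplus mu u0 = below (- mu) (fun eps x => - u eps x 0).
  have := uE (-1) (- mu); rewrite Gplus_below.
  by under eq_fun do under eq_fun do rewrite mulN1r;
     under [in RHS]eq_fun do under eq_fun do rewrite mulN1r.
have oGm : open (Gminus mu u0) by rewrite Gminus_below; exact: open_below.
have oGp : open (Gplus mu u0) by rewrite Gplus_below; exact: open_below.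
have GG z : Gminus mu u0 z -> Gplus mu u0 z -> False.
  by rewrite Gminus_below Gplus_below; exact: below_disjoint.
have edist0 x : (0 <= Defs.edist x (interface mu u0))%E.
  by apply: le_ereal_inf_tmp => _ [y _ <-]; rewrite lee_fin enorm_ge0.
have flN := bistable_lawN fl; have fpN := front_profileN gl fp.
have bnd eps x t : 0 < eps -> 0 <= t -> -1 <= u eps x t <= 1.
  move=> eps0 t0; have t0' : 0 <= eps^-1 * t by rewrite mulr_ge0// invr_ge0 ltW.
  have := approximable_le1 (eps^-1 *: x) hN fl (uA1 eps eps0) t0'.
  have := approximable_le1 (eps^-1 *: x) hN flN (uA1N eps eps0) t0'.
  by rewrite /= scalerA mulVKf ?gt_eqF// divff ?gt_eqF// scale1r; lra.
split => // A cA HA; apply/uniform_cvg_distP => e e0; have e20 : 0 < e / 2 by lra.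
- have : \forall eps \near 0^'+, forall p, A p -> u eps p.1 p.2 <= -1 + e / 2.
    apply: (spreading gl fl fp Zpos hN uA1 cA _ e20) => x t /HA[/= t0 xt]; split => //.
    have ct0 : 0 < c * t by rewrite mulr_gt0.
    move: xt; rewrite /dist /signed_dist; case: ifPn => [/set_mem xm xt|_].
      have [r cr rd] : exists2 r, c * t < r & (r%:E < Defs.edist x (interface mu u0))%E.
        move: xt; case: (Defs.edist _ _) => [s| |] => [xt|_|//].
          by exists ((c * t + s) / 2); rewrite ?lte_fin; rewrite lte_fin in xt; lra.
        by exists (c * t + 1); rewrite ?ltry//; lra.
      exists x, r; rewrite subrr enorm0 add0r; split => //; first exact: lt_trans cr.
      move=> y; rewrite -GmE; apply: (ball_sub_region oGm oGp GG hdist xm) => w Gw.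
      rewrite -lte_fin; apply: lt_le_trans rd _; apply: ereal_inf_lbound.
      by exists w.
    case: ifPn => _; last by rewrite lte_fin ltNge (ltW ct0).
    by rewrite ltNge => /negP[]; apply: (@le_trans _ _ 0%E); rewrite ?oppe_le0// lee_fin ltW.
  move=> H; near=> eps => -[x t] Ap; have [/= t0 _] := HA _ Ap.
  have eps0 : 0 < eps by near: eps; exact: nbhs_right_gt.
  have Hq : forall q, A q -> u eps q.1 q.2 <= -1 + e / 2 by near: eps; exact: H.
  by have := Hq _ Ap; have := bnd eps x t eps0 (ltW t0); rewrite /= ltr_distl; lra.
- have ZposN (x : R) : -1 < - q (- - x) < 1 -> 0 < - derive1 q (- - x).
    by move=> px; apply: Zpos; lra.
  have : \forall eps \near 0^'+, forall p, A p -> - u eps p.1 p.2 <= -1 + e / 2.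
    apply: (spreading (u := fun eps x t => - u eps x t) gl flN fpN ZposN hN uA1N cA _ e20) => x t /HA[/= t0 xt]; split => //.
    have [z Gz xz] : exists2 z, Gplus mu u0 z & enorm (x - z) < c * t.
      move: xt; rewrite /dist /signed_dist; case: ifPn => [_|xm].
        move=> /ereal_inf_lt[_ [w [_ Gw] <-]]; rewrite lte_fin => xw.
        by have [z [Gz xz]] := Gw _ (nbhs_enorm_lt xw); exists z.
      case: ifPn => [/set_mem xp _|xp _].
        by exists x => //; rewrite subrr enorm0 mulr_gt0.
      have clx : closure (Gplus mu u0) x.
        have : (Gminus mu u0 `|` Gplus mu u0 `|` interface mu u0) x by rewrite hdist.
        by move=> [[/mem_set|/mem_set]|[]//]; [rewrite (negbTE xm)|rewrite (negbTE xp)].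
      have xx : enorm (x - x) < c * t by rewrite subrr enorm0 mulr_gt0.
      by have [z [Gz xz]] := clx _ (nbhs_enorm_lt xx); exists z.
    have [r r0 rball] := open_contains_ball oGp Gz.
    exists z, r; split => //; last by move=> y /rball; rewrite GpE.
    by rewrite mulNr; lra.
  move=> H; near=> eps => -[x t] Ap; have [/= t0 _] := HA _ Ap.
  have eps0 : 0 < eps by near: eps; exact: nbhs_right_gt.
  have Hq : forall q, A q -> - u eps q.1 q.2 <= -1 + e / 2 by near: eps; exact: H.
  by have := Hq _ Ap; have := bnd eps x t eps0 (ltW t0); rewrite /= ltr_distl; lra.
Unshelve. all: by end_near. Qed.
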